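(* For each compact set $K\subset\mathbb{C}^n$ and each $z\in\mathbb{C}^n$, $$\Psi_{K,\lambda}(z)=\sup\big\{|q_m(z)|^{1/\rho_m}:m\ge1,\ q_m\in\mathcal{H}_\lambda\text{ of bidegree }(\rho_m,0),\ \sup_K|q_m|\le1\big\}.$$
   Context: Fix $\lambda=(\lambda_1,\dots,\lambda_n)$ with $\lambda_1=1$, $\lambda_k>0$. $\Phi^X(z,t)=(z_1e^{-\lambda_1t},\dots,z_ne^{-\lambda_nt})$; $\mathbb{H}=\{\operatorname{Re}t>0\}$. $\{\rho_m\}_{m\ge0}$ is the strictly increasing enumeration of $\{\lambda_1k_1+\dots+\lambda_nk_n:k\in\mathbb{Z}^n_{\ge0}\}$. A polynomial $q\in\mathbb{C}[z,\bar z]$ is quasi-homogeneous of type $\lambda$ with bidegree $(d_1,d_2)$ if $q(\Phi^X(z,t))=e^{-d_1t}e^{-d_2\bar t}q(z)$ for all $t\in\mathbb{H}$, $z\in\mathbb{C}^n$; $\mathcal{H}_\lambda$ is the set of such polynomials. $H_\lambda$ is the set of nonconstant plurisubharmonic functions $u\ge0$ on $\mathbb{C}^n$ with $u(\Phi^X(z,t))=e^{-\operatorname{Re}t}u(z)$ for all $z\in\mathbb{C}^n$, $t\in\mathbb{C}$. For bounded $E\subset\mathbb{C}^n$, $\Psi_{E,\lambda}(z)=\sup\{u(z):u\in H_\lambda,\ u\le1\text{ on }E\}$. *)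

(* Defs.v *)
From HB Require Import structures.
From mathcomp Require Import all_boot all_order all_algebra.
From mathcomp Require Import all_classical all_reals all_analysis.
From mathcomp.real_closed Require Import complex.
Import Order.TTheory GRing.Theory Num.Theory.
Import numFieldNormedType.Exports.

Set Implicit Arguments.
Unset Strict Implicit.
Unset Printing Implicit Defensive.

Local Open Scope classical_set_scope.
Local Open Scope ring_scope.
Local Open Scope complex_scope.

(* The complex plane, with its standard (Euclidean, modulus) topology. *)
Definition CC (R : realType) := (R[i])^o.
(* C^n, as row vectors; the topology is the product (sup-norm) topology,
   which is the Euclidean topology of C^n. *)
Definition Cn (R : realType) (n : nat) := 'rV[CC R]_n.

Section Defs.
Variables (R : realType) (n : nat).

Definition cexp (w : CC R) : CC R :=
  (expR (complex.Re w) * cos (complex.Im w)) +i* (expR (complex.Re w) * sin (complex.Im w)).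

Definition cmod (w : CC R) : R :=
  Num.sqrt (complex.Re w ^+ 2 + complex.Im w ^+ 2).

Definition PhiX (lam : 'I_n -> R) (z : Cn R n) (t : CC R) : Cn R n :=
  \row_k (z ord0 k * cexp (- ((lam k)%:C * t))).

Definition poly_zzbar (q : Cn R n -> CC R) : Prop :=
  exists (N : nat) (c : 'I_N -> CC R) (a b : 'I_N -> 'I_n -> nat),
    forall z : Cn R n,
      q z = \sum_(j < N) (c j * \prod_(k < n)
                ((z ord0 k) ^+ (a j k) * (conjc (z ord0 k)) ^+ (b j k))).

Definition quasi_hom (lam : 'I_n -> R) (d1 d2 : R) (q : Cn R n -> CC R) :
  Prop :=
  poly_zzbar q /\
  forall (t : CC R) (z : Cn R n), 0 < complex.Re t ->
    q (PhiX lam z t) = cexp (- (d1%:C * t)) * cexp (- (d2%:C * conjc t)) * q z.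

Definition usc (u : Cn R n -> R) : Prop :=
  forall (z : Cn R n) (c : R), u z < c -> \forall w \near z, u w < c.

Definition psh (u : Cn R n -> R) : Prop :=
  usc u /\
  forall a b : Cn R n,
    ((u a)%:E <= ((2 * pi)^-1)%:E *
       \int[@lebesgue_measure R]_(th in `[0%R, (2 * pi)%R]%classic)
          (u (a + cexp (0 +i* th) *: b))%:E)%E.

Definition H_lam (lam : 'I_n -> R) (u : Cn R n -> R) : Prop :=
  [/\ psh u,
      (forall z, 0 <= u z),
      (exists z w, u z != u w) &
      (forall (z : Cn R n) (t : CC R), u (PhiX lam z t) = expR (- complex.Re t) * u z)].

Definition Psi (lam : 'I_n -> R) (E : set (Cn R n)) (z : Cn R n) : \bar R :=
  ereal_sup [set (u z)%:E | u in [set u | H_lam lam u /\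
                                        (forall w, E w -> u w <= 1)]].

Definition weight_semigroup (lam : 'I_n -> R) (r : R) : Prop :=
  exists k : 'I_n -> nat, r = \sum_(i < n) lam i * (k i)%:R.

End Defs.

(* Main.v *)
Require Import Defs.
From HB Require Import structures.
From mathcomp Require Import all_boot all_order all_algebra.
From mathcomp Require Import all_classical all_reals all_analysis.
From mathcomp Require Import measurable_realfun.
From mathcomp.real_closed Require Import complex.
From mathcomp Require Import zify ring lra.
Import Order.TTheory GRing.Theory Num.Theory.
Import numFieldNormedType.Exports.
Local Open Scope classical_set_scope.
Local Open Scope ring_scope.
Set Implicit Arguments.
Unset Strict Implicit.
Unset Printing Implicit Defensive.
Import ComplexField.

(* That the right-hand side is at most Psi: averaging over the imaginary flow
   and letting Re t tend to infinity shows that a quasi-homogeneous q of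
   bidegree (rho, 0) is a holomorphic polynomial, and |q|^(1/rho) is then
   plurisubharmonic.  On a line this follows from factoring q and the AM-GM
   inequality over N-th roots of unity.

   Conversely, let u be in H_lambda with u <= 1 on K and u(p) > 1, and let K0 be
   the union of the images of K and 0 under the imaginary flow.  The maximum
   principle for u on the polynomially convex hull of K0 shows that p is not in
   that hull, so |e| <= B on K0 and |e(p)| > B for some polynomial e.  Each
   quasi-homogeneous component of e^m is bounded by B^m on K0, and the number of
   components grows polynomially in m, so some component exceeds B^m at p.

   The maximum principle replaces the usual d-bar argument by Rossi's local
   maximum principle: a polynomial P with P(p) = 0 cannot satisfy
   Re P(y) <= - c |y - p|^2 on the hull of K near a point p of the hull away
   from K (this comes from the nonemptiness of spectra in the algebra of
   polynomials under the supremum norm on K).  A counterexample u is smoothed by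
   averaging in the real coordinate directions, after a rotation about p that
   preserves its value; at a maximum of u + eps |.|^2 over the hull, the
   pluriharmonic part of the second-order expansion is the real part of such a polynomial. *)

(** * Modulus, exponential and roots of unity *)

(** For incommensurable weights the imaginary flow sweeps [K] into a set that need not be closed.
    Hulls are therefore defined by bounds on polynomials instead of maxima, [pol_bounded] takes the
    place of compactness, and the maximum principle asks for a bound on u in a uniform neighbourhood
    of the set. The point 0 is added to [K] because u(0) = 0 leaves the bound intact, the set
    becomes nonempty, and a component of weight 0, being constant, cannot be larger at p than it is
    at 0; so the component found has positive weight. The algebra of polynomials under a supremum
    norm is not complete, so inverses and ideal memberships hold only up to an arbitrarily small
    error. Contour integrals are replaced by averages over N-th roots of unity, which are exact on
    polynomials of degree below N and need no integration theory. An average over a unit segment has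
    the difference of the original function at distance 1 as its derivative. Each averaging thus
    buys one order of regularity, and three of them give a quadratic expansion with cubic remainder.
    Such averages may lower the value at p, which is what the choice of the rotation repairs. *)

Section ModulusExp.
Variable R : realType.
Implicit Types (z w : R[i]) (x y : R).

Lemma cmodC z : ((cmod z)%:C)%C = `|z|.
Proof. by rewrite normc_def. Qed.

Lemma cmodM z w : cmod (z * w : R[i]) = cmod z * cmod w.
Proof. by apply: complexI; rewrite rmorphM /= !cmodC normrM. Qed.

Lemma cmodD z w : cmod (z + w : R[i]) <= cmod z + cmod w.
Proof. by rewrite -lecR rmorphD /= !cmodC ler_normD. Qed.

Lemma cmodN z : cmod (- z : R[i]) = cmod z.
Proof. by apply: complexI; rewrite !cmodC normrN. Qed.

Lemma cmodB z w : cmod (z - w : R[i]) <= cmod z + cmod w.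
Proof. by rewrite (le_trans (cmodD _ _))// cmodN. Qed.

Lemma cmod_distrC z w : cmod (z - w : R[i]) = cmod (w - z : R[i]).
Proof. by rewrite -cmodN opprB. Qed.

Lemma cmod_ge0 z : 0 <= cmod z.
Proof. exact: sqrtr_ge0. Qed.

Lemma cmod0 : cmod (0 : R[i]) = 0.
Proof. by apply: complexI; rewrite cmodC normr0. Qed.

Lemma cmod1 : cmod (1 : R[i]) = 1.
Proof. by apply: complexI; rewrite cmodC normr1. Qed.

Lemma cmod_eq0 z : (cmod z == 0) = (z == 0).
Proof. by rewrite -(inj_eq (@complexI R)) cmodC normr_eq0. Qed.

Lemma cmod_gt0 z : (0 < cmod z) = (z != 0).
Proof. by rewrite lt_neqAle cmod_ge0 andbT eq_sym cmod_eq0. Qed.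

Lemma cmodX z n : cmod (z ^+ n : R[i]) = cmod z ^+ n.
Proof. by apply: complexI; rewrite rmorphXn /= !cmodC normrX. Qed.

Lemma cmodV z : cmod (z^-1 : R[i]) = (cmod z)^-1.
Proof. by apply: complexI; rewrite fmorphV /= !cmodC normfV. Qed.

Lemma cmod_real x : cmod (x%:C)%C = `|x|.
Proof. by rewrite /cmod /= expr0n addr0 sqrtr_sqr. Qed.

Lemma cmod_nat n : cmod (n%:R : R[i]) = n%:R.
Proof. by rewrite -(rmorph_nat (real_complex R)) cmod_real ger0_norm. Qed.

Lemma cmod_lower z w : cmod z - cmod w <= cmod (z - w : R[i]).
Proof. by rewrite lerBlDr (le_trans _ (cmodD _ _))// subrK. Qed.

Lemma cmod_sum (I : Type) (r : seq I) (P : pred I) (F : I -> R[i]) :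
  cmod (\sum_(i <- r | P i) F i) <= \sum_(i <- r | P i) cmod (F i).
Proof.
elim/big_rec2: _ => [|i y1 y2 _ h]; first by rewrite cmod0.
by rewrite (le_trans (cmodD _ _))// lerD2l.
Qed.

Lemma cmod_prod (I : Type) (r : seq I) (P : pred I) (F : I -> R[i]) :
  cmod (\prod_(i <- r | P i) F i) = \prod_(i <- r | P i) cmod (F i).
Proof.
elim/big_rec2: _ => [|i y1 y2 _ h]; first by rewrite cmod1.
by rewrite cmodM h.
Qed.

Lemma cmod_sqr z : cmod z ^+ 2 = complex.Re z ^+ 2 + complex.Im z ^+ 2.
Proof. by rewrite sqr_sqrtr// addr_ge0// sqr_ge0. Qed.

Lemma Re_le_cmod z : `|complex.Re z| <= cmod z.
Proof. by rewrite -sqrtr_sqr ler_wsqrtr// lerDl sqr_ge0. Qed.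

Lemma Im_le_cmod z : `|complex.Im z| <= cmod z.
Proof. by rewrite -sqrtr_sqr ler_wsqrtr// lerDr sqr_ge0. Qed.

Lemma cmod_le_ReIm z : cmod z <= `|complex.Re z| + `|complex.Im z|.
Proof.
rewrite -(@ler_pXn2r _ 2) ?nnegrE ?cmod_ge0 ?addr_ge0// cmod_sqr.
rewrite -[complex.Re z ^+ 2]real_normK ?num_real//.
rewrite -[complex.Im z ^+ 2]real_normK ?num_real// sqrrD.
by rewrite -addrA [_ *+ 2 + _]addrC addrA lerDl mulrn_wge0// mulr_ge0.
Qed.

Lemma cexpD z w : cexp (z + w : R[i]) = cexp z * cexp w.
Proof.
case: z w => [a b] [c d]; rewrite /cexp /= expRD cosD sinD.
by congr Complex => /=; ring.
Qed.

Lemma cexp0 : cexp (0 : R[i]) = 1.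
Proof. by rewrite /cexp /= expR0 cos0 sin0 mulr1 mulr0. Qed.

Lemma cexpXn z n : cexp z ^+ n = cexp (n%:R * z : R[i]).
Proof.
elim: n => [|n IH]; first by rewrite mul0r cexp0.
by rewrite exprS IH -cexpD -natr1 mulrDl mul1r addrC.
Qed.

Lemma cmod_cexp z : cmod (cexp z) = expR (complex.Re z).
Proof.
rewrite /cmod /cexp /= !exprMn -mulrDr cos2Dsin2 mulr1 sqrtr_sqr.
by rewrite ger0_norm ?expR_ge0.
Qed.

Definition cis x : R[i] := cexp (Complex 0 x).

Lemma cmod_cis x : cmod (cis x) = 1.
Proof. by rewrite cmod_cexp expR0. Qed.

Lemma cisD x y : cis (x + y) = cis x * cis y.
Proof. by rewrite /cis -cexpD; congr cexp; congr Complex; rewrite addr0. Qed.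

Lemma cis0 : cis 0 = 1.
Proof. by rewrite /cis cexp0. Qed.

Lemma cisXn x n : cis x ^+ n = cis (n%:R * x).
Proof.
elim: n => [|n IH]; first by rewrite mul0r cis0.
by rewrite exprS IH -cisD -natr1 mulrDl mul1r addrC.
Qed.

Lemma cis2pi : cis (pi *+ 2) = 1.
Proof. by rewrite /cis /cexp /= expR0 !mul1r cos2pi sin2pi. Qed.

Definition wroot n : R[i] := cis (pi *+ 2 / n%:R).

Lemma cmod_wroot n : cmod (wroot n) = 1.
Proof. exact: cmod_cis. Qed.

(** The half angle lies strictly between 0 and pi, where the sine is positive, so that cos x = 1 - 2
    sin(x/2)^2 is below 1. *)
Lemma cis_eq1 x : 0 < x < pi *+ 2 -> cis x != 1.
Proof.
move=> /andP[x0 x2]; apply/eqP; rewrite /cis /cexp /= expR0 !mul1r => -[c s].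
have pi0 := @pi_gt0 R.
have hx : `|x / 2| <= pi by rewrite ger0_norm; lra.
have : 0 < sin (x / 2) by apply: sin_gt0_pi; apply/andP; split; lra.
have := cos_mulr2n (x / 2); rewrite cos2sin2 mulr2n -splitr c => h h'; nra.
Qed.

Lemma prim_wroot n : (0 < n)%N -> n.-primitive_root (wroot n).
Proof.
move=> n0; apply/andP; split => //; apply/forallP => -[i ilt] /=.
rewrite unity_rootE /wroot cisXn; apply/eqP.
have n0' : (n%:R : R) != 0 by rewrite pnatr_eq0 -lt0n.
case: (eqVneq i.+1 n) => [->|ine].
  by rewrite mulrC divfK // cis2pi eqxx.
apply/negbTE/cis_eq1; have lt : (i.+1 < n)%N by rewrite ltn_neqAle ine.
have p2 : (0 : R) < pi *+ 2 by rewrite mulrn_wgt0 ?pi_gt0.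
rewrite mulrC -mulrA mulr_gt0 ?mulr_gt0 ?invr_gt0 ?ltr0n //=.
by rewrite gtr_pMr // mulrC ltr_pdivrMr ?ltr0n// mul1r ltr_nat.
Qed.

(** Orthogonality of the characters of a cyclic group: unless n divides k this is a geometric sum
    over a full period. Every discrete contour integral below rests on it. *)
Lemma sum_wroot n k : (0 < n)%N ->
  \sum_(j < n) (wroot n ^+ j) ^+ k = if (n %| k)%N then n%:R else 0.
Proof.
move=> n0; have pw := prim_wroot n0.
under eq_bigr do rewrite exprAC.
case: ifPn => [|nk].
  rewrite (prim_order_dvd pw) => /eqP ->.
  by under eq_bigr do rewrite expr1n; rewrite sumr_const card_ord.
have w1 : wroot n ^+ k - 1 != 0 by rewrite subr_eq0 -(prim_order_dvd pw).
apply: (mulfI w1); rewrite mulr0 -subrX1 -exprM mulnC exprM.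
by rewrite (prim_expr_order pw) expr1n subrr.
Qed.

End ModulusExp.

(** * A spectral argument *)

Lemma small_expr (R : realType) (r eta : R) : 0 <= r < 1 -> 0 < eta ->
  exists k0, forall k, (k0 <= k)%N -> r ^+ k <= eta.
Proof.
move=> /andP[r0 r1] e0; have nr : `|r| < 1 by rewrite ger0_norm.
have [k0 _ h] : \forall k \near \oo, `|0 - r ^+ k| < eta.
  exact: (cvgrPdist_lt _ _).1 (cvg_expr nr) _ e0.
exists k0 => k /h /=; rewrite sub0r normrN ger0_norm ?exprn_ge0// => /ltW.
exact.
Qed.

(** The property is monotone in its constant, so the local constants of a finite cover of the
    compact square merge into their maximum. *)
Lemma square_cover (R : realType) (P : R -> R[i] -> Prop) (L : R) :
  (forall C C' z, C <= C' -> P C z -> P C' z) ->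
  (forall z, exists C d, 0 < d /\ forall w, `|complex.Re w - complex.Re z| < d ->
     `|complex.Im w - complex.Im z| < d -> P C w) ->
  exists C, 1 <= C /\
    forall w, `|complex.Re w| <= L -> `|complex.Im w| <= L -> P C w.
Proof.
move=> mono loc.
have cpt : compact (`[- L, L] `*` `[- L, L] : set (R * R)).
  by apply: compact_setX; exact: segment_compact.
have /compact_near_coveringP cov := cpt.
have := cov R (@pinfty_nbhs R) (fun C xy => P C (Complex xy.1 xy.2)) _ _.
case.
  move=> [x y] _; have [C [d [d0 h]]] := loc (Complex x y).
  exists (ball (x, y) d, [set C' | C < C']).
    by split; [exact: nbhsx_ballx | apply: nbhs_pinfty_gt; exact: num_real].
  move=> [[x' y'] C'] /= [[bx by'] CC']; apply: (mono C); first exact: ltW.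
  by apply: h => /=; rewrite distrC.
move=> M [_ hM]; pose C := Num.max (M + 1) 1.
exists C; split; first by rewrite le_max lexx orbT.
move=> [x y] /= hx hy.
have MC : M < C by rewrite lt_max ltrDl ltr01.
by apply: (hM C MC (x, y)); split; rewrite /= in_itv /= -ler_norml.
Qed.

(** The inner sum is formally (z^N - a^N) / (z - a). Multiplied by z it contains z^(N - k) a^k, and
    summing over the roots z of rho^N cancels every term but k = 0. *)
Lemma sum_roots_geometric (R : realType) (B : comPzRingType)
    (emb : {rmorphism R[i] -> B}) (N : nat) (rho : R[i]) (a : B) : (0 < N)%N ->
  \sum_(j < N) emb (rho * wroot R N ^+ j) *
    (\sum_(k < N) emb (rho * wroot R N ^+ j) ^+ (N.-1 - k) * a ^+ k) =
  emb N%:R * emb rho ^+ N.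
Proof.
move=> N0; pose z j := rho * wroot R N ^+ j.
have sumz k : (k < N)%N -> \sum_(j < N) z j ^+ (N - k) =
    if k == 0%N then N%:R * rho ^+ N else 0.
  move=> kN; under eq_bigr do rewrite exprMn.
  rewrite -mulr_sumr sum_wroot//; case: eqVneq => [->|k0].
    by rewrite subn0 dvdnn mulrC.
  rewrite gtnNdvd ?mulr0// ?subn_gt0//; lia.
under eq_bigr => j _ do rewrite -/(z j) mulr_sumr.
clearbody z.
rewrite exchange_big /=.
transitivity (\sum_(k < N) emb (\sum_(j < N) z j ^+ (N - k)) * a ^+ k).
  apply: eq_bigr => k _; rewrite rmorph_sum mulr_suml; apply: eq_bigr => j _.
  rewrite mulrA -exprS rmorphXn; congr (_ ^+ _ * _); have := ltn_ord k; lia.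
rewrite (bigD1 (Ordinal N0)) //= [X in _ + X]big1 ?addr0; last first.
  move=> k k0; rewrite sumz// ifN ?rmorph0 ?mul0r//.
by rewrite sumz//= expr0 mulr1 rmorphM rmorphXn.
Qed.

Section Spectrum.
Variables (R : realType) (B : comPzRingType) (emb : {rmorphism R[i] -> B}).
(** [Q r x] reads: the seminorm of x is at most r. A relation avoids the infimum in the definition
    of a quotient seminorm, to which the section will be applied. *)
Variable Q : R -> B -> Prop.
Hypothesis Qge0 : forall r x, Q r x -> 0 <= r.
Hypothesis Qle : forall r s x, r <= s -> Q r x -> Q s x.
Hypothesis QD : forall r s x y, Q r x -> Q s y -> Q (r + s) (x + y).
Hypothesis QM : forall r s x y, Q r x -> Q s y -> Q (r * s) (x * y).
Hypothesis Qc : forall c, Q (cmod c) (emb c).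

Let Q0 : Q 0 0.
Proof. by have := Qc 0; rewrite cmod0 rmorph0. Qed.

Let QZ c r x : Q r x -> Q (cmod c * r) (emb c * x).
Proof. exact/QM/Qc. Qed.

Let QN r x : Q r x -> Q r (- x).
Proof.
by move=> /(QZ (-1)); rewrite cmodN cmod1 mul1r rmorphN1 mulN1r.
Qed.

Let QX r x n : Q r x -> Q (r ^+ n) (x ^+ n).
Proof.
move=> h; elim: n => [|n IH]; last by rewrite !exprS; apply: QM.
by rewrite !expr0; have := Qc 1; rewrite cmod1 rmorph1.
Qed.

Let Qsum n (F : 'I_n -> B) (r : 'I_n -> R) :
  (forall i, Q (r i) (F i)) -> Q (\sum_i r i) (\sum_i F i).
Proof. by move=> h; elim/big_rec2: _ => [//|i y1 y2 _]; apply: QD. Qed.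

(** Without completeness a true inverse may not exist; what matters is that the bound [C] is the
    same for every precision [eta]. *)
Definition approx_inv (a : B) (C : R) (zeta : R[i]) :=
  forall eta, 0 < eta -> exists b, Q C b /\ Q eta (1 - b * (emb zeta - a)).

(** Truncated Neumann series: with e = 1 - b (zeta - a), the element b (1 + e + ... + e^(k-1)) has
    error e^k, and its seminorm stays below s / (1 - r) for all k. *)
Lemma approx_inv_of a zeta b r s : r < 1 -> Q s b ->
  Q r (1 - b * (emb zeta - a)) -> approx_inv a (s / (1 - r)) zeta.
Proof.
move=> r1 Qs Qr eta eta0; have r0 := Qge0 Qr; have s0 := Qge0 Qs.
have [k /(_ _ (leqnn k)) hk] := @small_expr _ r eta (introT andP (conj r0 r1)) eta0.
set e := 1 - b * (emb zeta - a) in Qr.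
have e1 : (1 - e) * (\sum_(i < k) e ^+ i) = 1 - e ^+ k.
  by rewrite -[in LHS]opprB mulNr -subrX1 opprB.
exists (b * \sum_(i < k) e ^+ i); split; last first.
  rewrite mulrAC -[b * _](subKr 1) -/e e1 subKr.
  exact: Qle hk (QX _ Qr).
apply: (@Qle (s * \sum_(i < k) r ^+ i)).
  rewrite ler_wpM2l// -[leRHS]mul1r ler_pdivlMr ?subr_gt0// mulrC.
  by rewrite -[1 - r]opprB mulNr -subrX1 opprB gerBl exprn_ge0.
by apply/QM/Qsum => // i; apply: QX.
Qed.

Lemma approx_inv_le a C C' zeta : C <= C' -> approx_inv a C zeta ->
  approx_inv a C' zeta.
Proof.
move=> CC' h eta /h[b [Cb eb]]; exists b; split => //; exact: Qle Cb.
Qed.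

(** Moving [zeta] by less than d in each real coordinate adds at most 2 s d to the error, so
    invertibility is an open condition with a locally uniform constant; the square is compact. *)
Lemma approx_inv_bounded a L :
  (forall zeta, exists b r s, [/\ r < 1, Q s b & Q r (1 - b * (emb zeta - a))]) ->
  exists C, 1 <= C /\ forall w, `|complex.Re w| <= L -> `|complex.Im w| <= L ->
    approx_inv a C w.
Proof.
move=> inv; apply: square_cover; first exact: approx_inv_le.
move=> z; have [b [r [s [r1 Qs Qr]]]] := inv z.
have s0 := Qge0 Qs; have r0 := Qge0 Qr.
pose d := (1 - r) / (4 * (s + 1)).
have s1 : 0 < s + 1 by lra.
have d0 : 0 < d by rewrite divr_gt0 ?mulr_gt0//; lra.
exists (s / (1 - (r + (1 - r) / 2))), d; split => // w h1 h2.
apply: (@approx_inv_of _ _ b) => //; first by lra.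
have -> : 1 - b * (emb w - a) = (1 - b * (emb z - a)) + b * emb (z - w).
  by rewrite rmorphB; ring.
apply: QD => //; apply: (@Qle (s * (d + d))); last first.
  apply: QM => //; apply: Qle (Qc _); apply: le_trans (cmod_le_ReIm _) _.
  by rewrite !raddfB /= ![`|complex.Re z - _|]distrC ![`|complex.Im z - _|]distrC lerD// ltW.
have -> : s * (d + d) = (1 - r) / 2 * (s / (s + 1)) by rewrite /d; field; lra.
by rewrite ler_piMr// ?divr_ge0 ?ler_pdivrMr//; lra.
Qed.

(* With y = (a/rho)^N, the average of zeta/(zeta - a) over the N-th roots of
   rho^N is 1/(1 - y). *)
Section Contradiction.
Variables (a : B) (A C : R).
Hypothesis QA : Q A a.
Hypothesis C1 : 1 <= C.
Let L := 2 * A + 2.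
Hypothesis inv : forall w, `|complex.Re w| <= L -> `|complex.Im w| <= L ->
  approx_inv a C w.
Hypothesis Q1 : forall r, r < 1 -> ~ Q r 1.

Let A0 : 0 <= A. Proof. exact: Qge0 QA. Qed.

(** Approximate form of the resolvent identity b - b' = (z' - z) b b'. *)
Lemma resolvent_dist (eta : R) (z z' : R[i]) (b b' : B) : 
  Q C b -> Q C b' -> Q eta (1 - b * (emb z - a)) ->
  Q eta (1 - b' * (emb z' - a)) ->
  Q (2 * C * eta + C ^+ 2 * cmod (z' - z : R[i])) (b - b').
Proof.
move=> Cb Cb' eb eb'.
have -> : b - b' = (b * (1 - b' * (emb z' - a)) - b' * (1 - b * (emb z - a)))
    + emb (z' - z) * (b * b').
  by rewrite rmorphB; ring.
apply: (@Qle ((C * eta + C * eta) + cmod (z' - z : R[i]) * (C * C))).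
  by rewrite le_eqVlt; apply/orP; left; apply/eqP; ring.
by apply: QD; [apply: QD; [|apply: QN]; apply: QM|apply: QM => //; apply: QM].
Qed.

(** [Phi] stands for rho^N / (rho^N - a^N). The denominator is cleared because rho^N - a^N need not
    be invertible. *)
Lemma root_average (N : nat) (rho eta E : R) (b : 'I_N -> B) : (0 < N)%N ->
  0 <= rho -> rho <= E -> A <= E -> 1 <= E ->
  let z j : R[i] := (rho%:C)%C * wroot R N ^+ j in
  (forall j : 'I_N, Q eta (1 - b j * (emb (z j) - a))) ->
  let Phi := emb (N%:R^-1) * \sum_(j < N) emb (z j) * b j in
  Q (N%:R * E ^+ N * eta)
    ((emb (rho%:C)%C ^+ N - a ^+ N) * Phi - emb (rho%:C)%C ^+ N).
Proof.
move=> N0 rho0 rE AE E1 z eb Phi; have E0 : 0 <= E by rewrite (le_trans ler01).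
have pw := prim_wroot R N0.
have N0' : (N%:R : R[i]) != 0 by rewrite pnatr_eq0 -lt0n.
have zN j : z j ^+ N = (rho%:C)%C ^+ N.
  by rewrite exprMn exprAC (prim_expr_order pw) expr1n mulr1.
have cz j : cmod (z j) = rho.
  by rewrite cmodM cmodX cmod_wroot expr1n mulr1 cmod_real ger0_norm.
pose q j := \sum_(k < N) emb (z j) ^+ (N.-1 - k) * a ^+ k.
have qE j : emb (rho%:C)%C ^+ N - a ^+ N = (emb (z j) - a) * q j.
  by rewrite -subrXX -(rmorphXn emb) -(zN j) rmorphXn.
have sumzq : \sum_(j < N) emb (z j) * q j = emb N%:R * emb (rho%:C)%C ^+ N.
  exact: sum_roots_geometric.
clearbody z.
have -> : (emb (rho%:C)%C ^+ N - a ^+ N) * Phi - emb (rho%:C)%C ^+ N =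
    emb (N%:R^-1) * \sum_(j < N) (- (emb (z j) * q j * (1 - b j * (emb (z j) - a)))).
  have eN : emb (N%:R^-1) * (emb N%:R * emb (rho%:C)%C ^+ N) = emb (rho%:C)%C ^+ N.
    by rewrite mulrA -rmorphM mulVf// rmorph1 mul1r.
  rewrite -{2}eN -sumzq /Phi mulrCA -mulrBr mulr_sumr -sumrB; congr (_ * _).
  by apply: eq_bigr => j _; rewrite (qE j); ring.
apply: (@Qle (cmod (N%:R^-1 : R[i]) * \sum_(j < N) (rho * (\sum_(k < N) E ^+ N.-1) * eta))).
  rewrite cmodV cmod_nat !sumr_const !card_ord.
  have eta0 := Qge0 (eb (Ordinal N0)).
  rewrite -[X in _ * X]mulr_natl mulKf ?pnatr_eq0 -?lt0n// ler_wpM2r//.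
  rewrite -[E ^+ _ *+ N]mulr_natl mulrCA ler_wpM2l ?ler0n//.
  by rewrite -[in leRHS](prednK N0) exprS ler_wpM2r// exprn_ge0.
apply: QZ; apply: Qsum => j; apply: QN; apply: QM => //; apply: QM.
  by rewrite -(cz j).
apply: Qsum => k; apply: (@Qle (rho ^+ (N.-1 - k) * A ^+ k)).
  have -> : N.-1 = (N.-1 - k + k)%N by have := ltn_ord k; lia.
  by rewrite addnK exprD ler_pM ?exprn_ge0 ?lerXn2r ?nnegrE.
by apply: QM; apply: QX => //; rewrite -(cz j).
Qed.

(** For large N the element 1 / (1 - (a/rho)^N) is almost idempotent. It is 0 at rho = 0 and should
    be near 1 once rho exceeds the seminorm of [a]; but along a grid of radii too fine for a jump it
    stays small. *)
Lemma no_bounded_resolvent : False.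
Proof.
have C0 : 0 < C := lt_le_trans ltr01 C1.
have A0' := A0.
have L0 : 0 < L by rewrite /L; lra.
pose rmax := 2 * A + 1.
have rm0 : 0 < rmax by rewrite /rmax; have := A0; lra.
(* The grid step is such that consecutive values of [Phi] differ by at most 1/10: 1/20 is due to the
   step and 1/40 to the precision [eta] chosen below. *)
have [M M0 hM] : exists2 M : nat, (0 < M)%N &
    C * (rmax / M%:R) + L * (C ^+ 2 * (rmax / M%:R)) <= 20^-1 /\ rmax / M%:R <= 1.
  pose T := 20 * (C * rmax + L * (C ^+ 2 * rmax)) + rmax.
  have T0 : 0 < T.
    by rewrite /T ltr_wpDl// mulr_ge0// addr_ge0// !mulr_ge0// ?sqr_ge0 ?ltW.
  exists (Num.truncn T).+1 => //.
  have hT := truncnS_gt T.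
  have M0 : (0 : R) < (Num.truncn T).+1%:R by rewrite ltr0n.
  set m := (_.+1)%:R in hT M0 *.
  have P1 : 0 <= C * rmax + L * (C ^+ 2 * rmax).
    by rewrite addr_ge0// !mulr_ge0// ?sqr_ge0 ?ltW.
  split; last by rewrite ler_pdivrMr// mul1r ltW// (le_lt_trans _ hT)// /T; lra.
  rewrite !mulrA -mulrDl ler_pdivrMr//.
  move: hT; rewrite /T -!mulrA; set X := _ + L * _ in P1 *; lra.
have M0' : (0 : R) < M%:R by rewrite ltr0n.
pose sg := rmax / M%:R.
have sg0 : 0 < sg by rewrite divr_gt0.
have [sgC sg1] := hM.
pose rho i : R := i%:R * sg.
have rhoM : rho M = rmax by rewrite /rho /sg mulrC divfK// gt_eqF.
have rho_ge0 i : 0 <= rho i by rewrite mulr_ge0// ltW.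
have rho_gt0 i : 0 < rho i.+1 by rewrite mulr_gt0// ltr0n.
have rhoL i : (i <= M.+1)%N -> rho i <= L.
  move=> iM; apply: (@le_trans _ _ (rho M.+1)); first by rewrite ler_wpM2r ?ler_nat// ltW.
  by rewrite /rho -natr1 mulrDl mul1r -/(rho M) rhoM /L /rmax; rewrite -/sg in sg1; lra.
(* [N] is chosen after the grid: i/(i+1) <= 1 - 1/(M+1) makes the N-th powers of all ratios of
   consecutive radii at most 1/10. *)
have [N N0 hN] : exists2 N : nat, (0 < N)%N &
    forall i, (i <= M)%N -> (rho i / rho i.+1) ^+ N <= 10^-1.
  have q01 : 0 <= 1 - (M.+1%:R : R)^-1 < 1.
    by rewrite subr_ge0 invf_le1 ?ltr0n// ler1n /= gtrBl invr_gt0 ltr0n.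
  have [k hk] := @small_expr _ _ (10^-1) q01 (ltac:(lra)).
  exists k.+1 => // i iM; apply: le_trans (hk _ (leqnSn k)).
  rewrite lerXn2r ?nnegrE ?divr_ge0//; first by case/andP: q01.
  rewrite /rho -mulf_div divff ?gt_eqF// mulr1 ler_pdivrMr ?ltr0n// mulrBl mul1r.
  rewrite -natr1 lerBrDr -natr1 lerD2l mulrC ler_pdivrMr ?ltr_wpDl//.
  by rewrite mul1r lerD2r ler_nat.
pose E := L + A + 1.
have E1 : 1 <= E by rewrite /E; lra.
have E0 : 0 <= E by lra.
have sgN : 0 < sg ^+ N by rewrite exprn_gt0.
pose D := N%:R * E ^+ N.
have D0 : 0 < D by rewrite mulr_gt0 ?ltr0n// exprn_gt0//; lra.
have DE : D = N%:R * E ^+ N by [].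
clearbody D.
(* The precision comes last: errors are multiplied by [D] and then divided by N-th powers of radii,
   which can be as small as sg^N. *)
pose eta := Num.min (Num.min (80^-1 / (L * C)) 1) (Num.min 1 (sg ^+ N) / (50 * D)).
have eta0 : 0 < eta.
  have m1 : 0 < Num.min 1 (sg ^+ N) by rewrite lt_min ltr01.
  rewrite lt_min; apply/andP; split; last by apply: divr_gt0 => //; rewrite mulr_gt0.
  by rewrite lt_min ltr01 andbT; apply: divr_gt0; [lra|rewrite mulr_gt0].
have eta1 : L * (2 * C * eta) <= 40^-1.
  have : eta <= 80^-1 / (L * C) by rewrite !ge_min lexx.
  by rewrite ler_pdivlMr ?mulr_gt0// => h; lra.
have eta2 : D * eta <= sg ^+ N / 50 /\ D * eta <= 1 / 50.
  have : eta <= Num.min 1 (sg ^+ N) / (50 * D) by rewrite ge_min lexx orbT.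
  rewrite ler_pdivlMr ?mulr_gt0// => h.
  have m1 : Num.min 1 (sg ^+ N) <= 1 by rewrite ge_min lexx.
  have m2 : Num.min 1 (sg ^+ N) <= sg ^+ N by rewrite ge_min lexx orbT.
  split; lra.
have bE w : exists b : B, `|complex.Re w| <= L -> `|complex.Im w| <= L ->
    Q C b /\ Q eta (1 - b * (emb w - a)).
  have [h1|h1] := leP `|complex.Re w| L; last by exists 0.
  have [h2|h2] := leP `|complex.Im w| L; last by exists 0.
  by have [b hb] := inv h1 h2 eta0; exists b.
pose bb w : B := sval (cid (bE w)).
have bbP w : cmod w <= L -> Q C (bb w) /\ Q eta (1 - bb w * (emb w - a)).
  move=> h; apply: (svalP (cid (bE w))).
    exact: le_trans (Re_le_cmod _) h.
  exact: le_trans (Im_le_cmod _) h.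
pose z i j : R[i] := ((rho i)%:C)%C * wroot R N ^+ j.
have cz i j : cmod (z i j) = rho i.
  by rewrite cmodM cmodX cmod_wroot expr1n mulr1 cmod_real ger0_norm.
have zP i j : (i <= M.+1)%N ->
    Q C (bb (z i j)) /\ Q eta (1 - bb (z i j) * (emb (z i j) - a)).
  by move=> iM; apply: bbP; rewrite cz rhoL.
pose Phi i := emb (N%:R^-1) * \sum_(j < N) emb (z i j) * bb (z i j).
have eP i : (i <= M.+1)%N -> Q (D * eta)
    ((emb ((rho i)%:C)%C ^+ N - a ^+ N) * Phi i - emb ((rho i)%:C)%C ^+ N).
  move=> iM; rewrite DE; apply: root_average => //; first by have := rhoL _ iM; rewrite /E; lra.
    by rewrite /E; lra.
  by move=> j; have [] := zP i j iM.
have avgQ (r : R) (F : 'I_N -> B) : (forall j, Q r (F j)) ->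
    Q r (emb (N%:R^-1) * \sum_(j < N) F j).
  move=> h; apply: (@Qle (cmod (N%:R^-1 : R[i]) * \sum_(j < N) r)).
    rewrite cmodV cmod_nat sumr_const card_ord -[r *+ N]mulr_natl mulKf//.
    by rewrite pnatr_eq0 -lt0n.
  by apply: QZ; apply: Qsum.
have dP i : (i <= M)%N -> Q (10^-1) (Phi i.+1 - Phi i).
  move=> iM; rewrite /Phi -mulrBr -sumrB; apply: avgQ => j.
  have [b1 e1] := zP i j (leqW iM); have [b2 e2] := zP i.+1 j iM.
  have -> : emb (z i.+1 j) * bb (z i.+1 j) - emb (z i j) * bb (z i j) =
      emb (z i.+1 j - z i j) * bb (z i.+1 j)
      + emb (z i j) * (bb (z i.+1 j) - bb (z i j)).
    by rewrite rmorphB; ring.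
  have dz : cmod (z i.+1 j - z i j : R[i]) = sg.
    rewrite /z -mulrBl cmodM cmodX cmod_wroot expr1n mulr1 -rmorphB cmod_real.
    by rewrite /rho -natr1 mulrDl mul1r addrC addKr ger0_norm// ltW.
  apply: (@Qle (sg * C + L * (2 * C * eta + C ^+ 2 * sg))).
    rewrite -/sg in sgC; lra.
  apply: QD.
    by apply: QM => //; rewrite -dz.
  apply: QM; first by apply: Qle (Qc _); rewrite cz rhoL// leqW.
  rewrite -dz cmod_distrC; exact: resolvent_dist.
(* From 1/4 at i follow the rough bounds 7/20 and 9/20 at the next two radii; the near idempotence
   [PE] turns these back into 1/4 at i + 1. *)
have rec i : (i <= M)%N -> Q (4^-1) (Phi i).
  elim: i => [|i IH] iM.
    apply: (@Qle 0); first by lra.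
    have -> : Phi 0 = 0.
      rewrite /Phi big1 ?mulr0// => j _.
      by rewrite /z /rho mul0r !(rmorph0, mul0r).
    exact: Q0.
  have q0 := IH (ltnW iM).
  have q1 : Q (4^-1 + 10^-1) (Phi i.+1).
    by rewrite -[Phi i.+1](subrK (Phi i)) addrC; apply: QD => //; apply: dP; exact: ltnW.
  have q2 : Q (4^-1 + 10^-1 + 10^-1) (Phi i.+2).
    by rewrite -[Phi i.+2](subrK (Phi i.+1)) addrC; apply: QD => //; exact: dP.
  set P := Phi i.+1 in q1 *; set P' := Phi i.+2 in q2 *.
  have e1 := eP i.+1 (leqW iM); have e2 := eP i.+2 iM.
  rewrite -/P in e1; rewrite -/P' in e2.
  set e := _ - _ in e1; set e' := _ - _ in e2.
  have b0 : rho i.+2 ^+ N != 0 by rewrite gt_eqF// exprn_gt0// mulr_gt0// ltr0n.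
  pose be : R[i] := ((rho i.+2 ^+ N)%:C)%C.
  have be0 : be != 0 by rewrite -cmod_eq0 cmod_real normr_eq0.
  pose t := (rho i.+1 / rho i.+2) ^+ N.
  have t01 : 0 <= t <= 10^-1 by rewrite exprn_ge0 ?divr_ge0//= hN.
  have tE : emb (t%:C)%C = emb be^-1 * emb ((rho i.+1)%:C)%C ^+ N.
    rewrite -(rmorphXn emb) -(rmorphM emb) /be /t expr_div_n; congr (emb _).
    by rewrite rmorphM fmorphV !rmorphXn mulrC.
  have bE' : emb be^-1 * emb ((rho i.+2)%:C)%C ^+ N = 1.
    rewrite -(rmorphXn emb) -(rmorphM emb) -(rmorphXn (real_complex R)).
    by rewrite -/be mulVf// rmorph1.
  (* With y the N-th power of a divided by the larger radius, P = t / (t - y) and P' = 1 / (1 - y)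
     would satisfy this without the last summand, which collects the errors. For small t it says
     that P is nearly P P'. *)
  have PE : P = emb (t%:C)%C * P' + emb ((1 - t)%:C)%C * (P * P')
      + emb be^-1 * (e * P' - e' * P).
    rewrite rmorphB rmorphB !rmorph1 tE /e /e'.
    set x := emb be^-1 in bE' *; set y := _ ^+ N in bE' *.
    by rewrite -{1}[P]mul1r -bE'; ring: bE'.
  rewrite PE; apply: (@Qle (t * (4^-1 + 10^-1 + 10^-1)
     + (1 - t) * ((4^-1 + 10^-1) * (4^-1 + 10^-1 + 10^-1))
     + (rho i.+2 ^+ N)^-1 * (D * eta * (4^-1 + 10^-1 + 10^-1) + D * eta * (4^-1 + 10^-1)))).
    have [h1 h2] := eta2.
    have : (rho i.+2 ^+ N)^-1 * (D * eta) <= 50^-1.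
      rewrite mulrC ler_pdivrMr ?exprn_gt0 ?rho_gt0//.
      apply: le_trans h1 _; rewrite [leRHS]mulrC ler_wpM2r//.
      by rewrite lerXn2r ?nnegrE ?rho_ge0 ?(ltW sg0)// /rho ler_peMl ?(ltW sg0)// ler1n.
    move: t01 => /andP[? ?]; set X := (rho i.+2 ^+ N)^-1 * (D * eta) => ?.
    have -> : (rho i.+2 ^+ N)^-1 * (D * eta * (4^-1 + 10^-1 + 10^-1) + D * eta * (4^-1 + 10^-1)) = X * (4^-1 + 10^-1 + 10^-1 + 4^-1 + 10^-1) by rewrite /X; ring.
    by lra.
  case/andP: t01 => t0 t1.
  apply: QD; [apply: QD|].
  - by apply: QM => //; apply: Qle (Qc _); rewrite cmod_real ger0_norm.
  - apply: QM; last exact: QM.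
    by apply: Qle (Qc _); rewrite cmod_real ger0_norm//; lra.
  - apply: QM; last by apply: QD; [|apply: QN]; apply: QM.
    apply: Qle (Qc _); rewrite cmodV cmod_real ger0_norm// exprn_ge0//.
have qM := rec M (leqnn M); have eM := eP M (leqnSn M).
have r1 : 1 <= rmax ^+ N by rewrite exprn_ege1// /rmax; lra.
pose be : R[i] := ((rmax ^+ N)%:C)%C.
have be0 : be != 0 by rewrite -cmod_eq0 cmod_real normr_eq0 gt_eqF//; lra.
rewrite rhoM in eM; set e := _ - _ in eM.
(* At [rmax] the factor (a/rmax)^N has seminorm at most 1, so the three terms bound 1 by 1/4 + 1/4 +
   1/50. *)
have one : 1 = Phi M - emb be^-1 * (a ^+ N * Phi M) - emb be^-1 * e.
  rewrite /e; have bE' : emb be^-1 * emb (rmax%:C)%C ^+ N = 1.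
      rewrite -(rmorphXn emb) -(rmorphM emb) -(rmorphXn (real_complex R)).
    by rewrite -/be mulVf// rmorph1.
  set x := emb be^-1 in bE' *; set y := _ ^+ N in bE' *.
  by ring: bE'.
have cbe : cmod (be^-1 : R[i]) = (rmax ^+ N)^-1.
  by rewrite cmodV cmod_real ger0_norm//; lra.
apply: (@Q1 (4^-1 + (rmax ^+ N)^-1 * (A ^+ N * 4^-1) + (rmax ^+ N)^-1 * (D * eta))).
  have [_ h2] := eta2.
  have i1 : (rmax ^+ N)^-1 <= 1 by rewrite invf_le1//; lra.
  have i0 : 0 <= (rmax ^+ N)^-1 by rewrite invr_ge0; lra.
  have h3 : (rmax ^+ N)^-1 * A ^+ N <= 1.
    rewrite mulrC ler_pdivrMr ?mul1r; last by lra.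
    rewrite lerXn2r ?nnegrE ?(ltW rm0)//; apply: (@le_trans _ _ (2 * A)).
      by rewrite ler_peMl// ler1n.
    by rewrite lerDl.
  have h4 : (rmax ^+ N)^-1 * (D * eta) <= 1 / 50.
    by apply: le_trans h2; rewrite ler_piMl// mulr_ge0// ltW.
  by rewrite mulrA; lra.
rewrite one; apply: QD; [apply: QD => //|]; apply: QN.
  by apply: QM; [rewrite -cbe|apply: QM => //; apply: QX].
by apply: QM => //; rewrite -cbe.
Qed.
End Contradiction.

Lemma spectrum_nonempty a A : Q A a -> (forall r, r < 1 -> ~ Q r 1) ->
  exists zeta, forall b r s, r < 1 -> Q s b -> ~ Q r (1 - b * (emb zeta - a)).
Proof.
move=> QA Q1; apply: contrapT => /forallNP h.
have [] := @approx_inv_bounded a (2 * A + 2).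
  move=> zeta; have /existsNP[b /existsNP[r /existsNP[s H]]] := h zeta.
  exists b, r, s; apply: contrapT => H'; apply: H => r1 Qs Qr; exact: H'.
move=> C [C1 inv]; exact: (no_bounded_resolvent QA C1 inv Q1).
Qed.
End Spectrum.

(** * Polynomial functions of finitely many of countably many variables *)

Section PolynomialFunctions.
Variable R : realType.
Local Notation C := (R[i]).
Local Notation env := (nat -> R[i]).

Inductive pexp := PCst of C | PVar of nat | PAdd of pexp & pexp | PMul of pexp & pexp.

Fixpoint pev (p : pexp) (x : env) : C :=
  match p with
  | PCst c => c
  | PVar i => x i
  | PAdd p q => pev p x + pev q x
  | PMul p q => pev p x * pev q x
  end.

Definition pol (q : env -> C) := exists p, q = pev p.

Lemma pol_cst c : pol (fun=> c). Proof. by exists (PCst c). Qed.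
Lemma pol_var i : pol (fun x => x i). Proof. by exists (PVar i). Qed.
Lemma pol_add f g : pol f -> pol g -> pol (fun x => f x + g x).
Proof. by move=> [p ->] [q ->]; exists (PAdd p q). Qed.
Lemma pol_mul f g : pol f -> pol g -> pol (fun x => f x * g x).
Proof. by move=> [p ->] [q ->]; exists (PMul p q). Qed.
Lemma pol_opp f : pol f -> pol (fun x => - f x).
Proof.
move=> /(pol_mul (pol_cst (-1))) [p hp]; exists p; rewrite -hp.
by apply/funext => x; rewrite mulN1r.
Qed.
Lemma pol_sub f g : pol f -> pol g -> pol (fun x => f x - g x).
Proof. by move=> pf /pol_opp; apply: pol_add. Qed.
Lemma pol_exp f n : pol f -> pol (fun x => f x ^+ n).
Proof.
move=> pf; elim: n => [|n]; first by under eq_fun do rewrite expr0; apply: pol_cst.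
by move=> /(pol_mul pf); under eq_fun do rewrite -exprS.
Qed.
Lemma pol_sum (I : Type) (r : seq I) (P : pred I) (F : I -> env -> C) :
  (forall i, pol (F i)) -> pol (fun x => \sum_(i <- r | P i) F i x).
Proof.
move=> pF; elim: r => [|i r IH].
  by under eq_fun do rewrite big_nil; apply: pol_cst.
under eq_fun do rewrite big_cons.
by case: (P i) => //; apply: pol_add.
Qed.
Lemma pol_prod (I : Type) (r : seq I) (P : pred I) (F : I -> env -> C) :
  (forall i, pol (F i)) -> pol (fun x => \prod_(i <- r | P i) F i x).
Proof.
move=> pF; elim: r => [|i r IH].
  by under eq_fun do rewrite big_nil; apply: pol_cst.
under eq_fun do rewrite big_cons.
by case: (P i) => //; apply: pol_mul.
Qed.
Lemma pol_comp q (s : nat -> env -> C) : pol q -> (forall i, pol (s i)) ->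
  pol (fun x => q (fun i => s i x)).
Proof.
move=> [p ->] ps; elim: p => [c|i|p IHp q' IHq|p IHp q' IHq] /=.
- exact: pol_cst.
- by have [p' hp'] := ps i; exists p'; rewrite -hp'.
- exact: pol_add.
- exact: pol_mul.
Qed.

Definition upd (x : env) (i : nat) (t : C) : env :=
  fun j => if j == i then t else x j.

Lemma pol_upd q i (s : env -> C) : pol q -> pol s -> pol (fun x => q (upd x i (s x))).
Proof.
move=> pq ps; apply: (@pol_comp _ (fun j x => upd x i (s x) j)) => // j.
by rewrite /upd; case: eqP => // _; apply: pol_var.
Qed.

Lemma pol_coef q i : pol q -> exists d (c : nat -> env -> C),
  (forall k, pol (c k)) /\
  forall x t, q (upd x i t) = \sum_(k < d) c k x * t ^+ k.
Proof.
move=> [p ->]; elim: p => [c|j|p IHp q' IHq|p IHp q' IHq] /=.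
- exists 1%N, (fun _ _ => c); split => [k|x t]; first exact: pol_cst.
  by rewrite big_ord1 expr0 mulr1.
- exists 2%N, (fun k x => if j == i then (k == 1%N)%:R else if k == 0%N then x j else 0).
  split => [k|x t].
    case: eqP => _; first exact: pol_cst.
    by case: eqP => _; [exact: pol_var|exact: pol_cst].
  rewrite !big_ord_recl big_ord0 /= /upd /bump /=.
  by case: eqP => _; rewrite ?mulr1 ?mul0r ?mul1r ?addr0 ?add0r.
- have [d1 [c1 [p1 h1]]] := IHp; have [d2 [c2 [p2 h2]]] := IHq.
  exists (maxn d1 d2), (fun k x => (if (k < d1)%N then c1 k x else 0) +
    (if (k < d2)%N then c2 k x else 0)); split => [k|x t].
    by apply: pol_add; [case: (k < d1)%N|case: (k < d2)%N] => //; apply: pol_cst.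
  rewrite h1 h2 (@big_ord_widen _ _ _ d1 (maxn d1 d2) (fun k => c1 k x * t ^+ k) (leq_maxl d1 d2)).
  rewrite (@big_ord_widen _ _ _ d2 (maxn d1 d2) (fun k => c2 k x * t ^+ k) (leq_maxr d1 d2)).
  rewrite [X in X + _ = _]big_mkcond /= [X in _ + X = _]big_mkcond /= -big_split /=.
  apply: eq_bigr => k _; rewrite mulrDl.
  by case: ifP => _; case: ifP => _; rewrite ?mul0r.
- have [d1 [c1 [p1 h1]]] := IHp; have [d2 [c2 [p2 h2]]] := IHq.
  exists (d1 + d2)%N, (fun k x => \sum_(a < d1) \sum_(b < d2)
    (if (a + b == k)%N then c1 a x * c2 b x else 0)); split => [k|x t].
    apply: pol_sum => a; apply: pol_sum => b.
    by case: (a + b == k)%N; [apply: pol_mul|apply: pol_cst].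
  rewrite h1 h2 mulr_suml; under [RHS]eq_bigr do rewrite mulr_suml.
  rewrite [RHS]exchange_big /=; apply: eq_bigr => a _.
  rewrite mulr_sumr; under [RHS]eq_bigr do rewrite mulr_suml.
  rewrite [RHS]exchange_big /=; apply: eq_bigr => b _.
  have ab : (a + b < d1 + d2)%N by rewrite -addSn leq_add// ltnW.
  rewrite (bigD1 (Ordinal ab)) //= eqxx big1 ?addr0.
    by rewrite exprD mulrACA.
  move=> k kab; case: eqP => [e|_]; last by rewrite mul0r.
  by move: kab; rewrite -val_eqE /= -e eqxx.
Qed.

End PolynomialFunctions.

(** * Polynomially convex hulls *)

Section Hull.
Variable R : realType.
Local Notation C := (R[i]).
Local Notation env := (nat -> R[i]).
Implicit Types (K : set env) (q f g h : env -> C).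

Definition hull K : set env := [set x | forall q, pol q ->
  forall B : R, (forall y, K y -> cmod (q y) <= B) -> cmod (q x) <= B].

Definition pol_bounded K := forall q, pol q ->
  exists B : R, 0 <= B /\ forall y, K y -> cmod (q y) <= B.

Definition supported n K := forall y, K y -> forall i, (n <= i)%N -> y i = 0.

Lemma subset_hull K : K `<=` hull K.
Proof. by move=> x Kx q pq B; apply. Qed.

Lemma hull_mono K K' : K `<=` hull K' -> hull K `<=` hull K'.
Proof. by move=> KK' x hx q pq B hB; apply: hx => // y /KK'; apply. Qed.

Lemma pol_bounded_coord K :
  (forall i, exists B : R, forall y, K y -> cmod (y i) <= B) -> pol_bounded K.
Proof.
move=> h q [p ->].
suff [B hB] : exists B : R, forall y, K y -> cmod (pev p y) <= B.
  exists (Num.max 0 B); split; first by rewrite le_max lexx.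
  by move=> y /hB hy; rewrite le_max hy orbT.
elim: p => [c|i|p [B hB] p' [B' hB']|p [B hB] p' [B' hB']] /=.
- by exists (cmod c).
- exact: h.
- exists (B + B') => y Ky; rewrite (le_trans (cmodD _ _))// lerD//; [exact: hB|exact: hB'].
- exists (B * B') => y Ky; rewrite cmodM ler_pM ?cmod_ge0//; [exact: hB|exact: hB'].
Qed.

Lemma pol_bounded_hull K : pol_bounded K -> pol_bounded (hull K).
Proof.
by move=> h q pq; have [B [B0 hB]] := h _ pq; exists B; split => // y; apply.
Qed.

Lemma pol_bounded_sub K K' : K `<=` K' -> pol_bounded K' -> pol_bounded K.
Proof.
by move=> s h q pq; have [B [B0 hB]] := h _ pq; exists B; split => // y /s/hB.
Qed.

(** * Ideals of polynomials and the quotient seminorm *)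

Definition ideal (I : (env -> C) -> Prop) :=
  [/\ forall f, I f -> pol f, I (fun=> 0),
      forall f g, I f -> I g -> I (fun x => f x + g x) &
      forall f g, pol f -> I g -> I (fun x => f x * g x)].

Definition adjoin I h (f : env -> C) := exists i b,
  [/\ I i, pol b & f = fun x => i x + b x * h x].

Lemma ideal_adjoin I h : ideal I -> pol h -> ideal (adjoin I h).
Proof.
move=> [Ip I0 ID IM] ph; split.
- move=> _ [i [b [Ii pb ->]]]; apply: pol_add; [exact: Ip|exact: pol_mul].
- exists (fun=> 0), (fun=> 0); split => //; first exact: pol_cst.
  by apply/funext => x; rewrite mul0r addr0.
- move=> _ _ [i [b [Ii pb ->]]] [i' [b' [Ii' pb' ->]]].
  exists (fun x => i x + i' x), (fun x => b x + b' x); split.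
  + exact: ID.
  + exact: pol_add.
  + by apply/funext => x; ring.
- move=> f _ pf [i [b [Ii pb ->]]].
  exists (fun x => f x * i x), (fun x => f x * b x); split.
  + exact: IM.
  + exact: pol_mul.
  + by apply/funext => x; ring.
Qed.

(** The relation to which the spectral argument is applied: it bounds the quotient modulo [I] of the
    supremum seminorm on [K]. *)
Definition near_ideal K (I : (env -> C) -> Prop) (r : R) (q : env -> C) :=
  pol q /\ exists2 i, I i & forall y, K y -> cmod (q y - i y) <= r.

Definition proper K I := forall r : R, r < 1 -> ~ near_ideal K I r 1.

Definition cemb (c : C) : env -> C := fun=> c.

Lemma cemb_zmod : zmod_morphism cemb.
Proof. by move=> x y; apply/funext. Qed.
Lemma cemb_monoid : monoid_morphism cemb.
Proof. by split => [|x y]; apply/funext. Qed.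
HB.instance Definition _ := GRing.isZmodMorphism.Build C (env -> C) cemb cemb_zmod.
HB.instance Definition _ := GRing.isMonoidMorphism.Build C (env -> C) cemb cemb_monoid.

(** [zeta] is a spectral value of [a] modulo [I]. If i + b (zeta - a) came within r < 1 of 1, then b
    would be an approximate inverse of zeta - a in the quotient. *)
Lemma proper_adjoin K I a : K !=set0 -> pol_bounded K -> ideal I -> proper K I ->
  pol a -> exists zeta, proper K (adjoin I (fun x => zeta - a x)).
Proof.
move=> [y0 Ky0] bK [Ip I0 ID IM] pI pa.
have [Ba [Ba0 hBa]] := bK _ pa.
have [] := @spectrum_nonempty R (env -> C) cemb (near_ideal K I) _ _ _ _ _ a Ba.
- move=> r x [_ [i Ii h]]; exact: le_trans (cmod_ge0 _) (h _ Ky0).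
- move=> r s x rs [px [i Ii h]]; split => //; exists i => // y /h h'; exact: le_trans h' rs.
- move=> r s x y [px [i Ii hi]] [py [j Ij hj]]; split; first exact: pol_add.
  exists (fun x => i x + j x); first exact: ID.
  move=> z Kz; rewrite opprD addrACA (le_trans (cmodD _ _))// lerD//; [exact: hi|exact: hj].
- move=> r s x y [px [i Ii hi]] [py [j Ij hj]]; split; first exact: pol_mul.
  (* Chosen so that the difference to x y factors as (x - i)(y - j). *)
  exists (fun t => y t * i t + (x t - i t) * j t).
    apply: ID; apply: IM => //; apply: pol_sub => //; exact: Ip.
  move=> z Kz; have -> : (x * y) z - (y z * i z + (x z - i z) * j z) =
      (x z - i z) * (y z - j z).
    by change ((x * y) z) with (x z * y z); ring.
  by rewrite cmodM ler_pM ?cmod_ge0//; [exact: hi|exact: hj].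
- move=> c; split; first exact: pol_cst.
  by exists (fun=> 0) => // y _; rewrite subr0.
- by split => //; exists (fun=> 0) => // y Ky; rewrite subr0; exact: hBa.
- by move=> r r1; exact: pI.
move=> zeta hz; exists zeta => r r1 [_ [_ [i [b [Ii pb ->]]] hr]].
have [s [s0 hs]] := bK _ pb.
apply: (hz b r s r1).
  by split => //; exists (fun=> 0) => // y Ky; rewrite subr0; exact: hs.
split; first by apply: pol_sub (pol_cst _) (pol_mul pb _); apply: pol_sub => //; exact: pol_cst.
exists i => // y Ky; have := hr _ Ky; congr (cmod _ <= _).
change ((1 : env -> C) y) with (1 : C).
by rewrite -[RHS]/(1 - b y * (zeta - a y) - i y); ring.
Qed.

(** Characters of the algebra are points of the hull. If [I] stayed away from 1, adjoining a
    spectral value of each of the first [M] coordinates would keep the ideal proper; these values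
    form a point of the hull at which all of [I] vanishes. *)
Lemma ideal_unit K I M : pol_bounded K -> supported M K -> ideal I ->
  (forall x, hull K x -> exists2 i, I i & i x != 0) ->
  exists2 i, I i & forall y, K y -> cmod (1 - i y) <= 2^-1.
Proof.
move=> bK sK idI nz; have [Ip I0 ID IM] := idI.
have [K0|K0] := pselect (K !=set0); last first.
  by exists (fun=> 0) => // y Ky; exfalso; apply: K0; exists y.
suff [r r1 [_ [i Ii hi]]] : exists2 r : R, r < 1 & near_ideal K I r 1.
  have [y0 Ky0] := K0; have r0 : 0 <= r := le_trans (cmod_ge0 _) (hi _ Ky0).
  have [k /(_ _ (leqnn k)) hk] := @small_expr R r 2^-1 (introT andP (conj r0 r1)) ltac:(lra).
  (* This multiple of i is 1 - (1 - i)^k, so the distance r < 1 improves to r^k <= 1/2. *)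
  exists (fun y => (\sum_(j < k) (1 - i y) ^+ j) * i y).
    apply: IM => //; apply: pol_sum => j; apply: pol_exp; apply: pol_sub (pol_cst _) _; exact: Ip.
  move=> y Ky; have -> : 1 - (\sum_(j < k) (1 - i y) ^+ j) * i y = (1 - i y) ^+ k.
    by rewrite -[RHS](subrK 1) subrX1; ring.
  by rewrite cmodX (le_trans _ hk)// lerXn2r ?nnegrE ?cmod_ge0//; exact: hi.
apply: contrapT => np.
have pI : proper K I by move=> r r1 H; apply: np; exists r.
have step m : exists J (x : env), [/\ ideal J, proper K J, forall f, I f -> J f &
    forall j, (j < m)%N -> J (fun y => y j - x j)].
  elim: m => [|m [J [x [idJ pJ IJ hJ]]]]; first by exists I, (fun=> 0); split.
  have [zeta pz] := proper_adjoin K0 bK idJ pJ (pol_var R m).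
  have pm : pol (fun x : env => zeta - x m) by apply: pol_sub (pol_cst _) (pol_var _ _).
  have [Jp J0 JD JM] := idJ.
  exists (adjoin J (fun x => zeta - x m)), (upd x m zeta); split => //.
  - exact: ideal_adjoin.
  - move=> f If; exists f, (fun=> 0); split; [exact: IJ|exact: pol_cst|].
    by apply/funext => y; rewrite mul0r addr0.
  - move=> j; rewrite ltnS leq_eqVlt /upd => /orP[/eqP ->|jm].
      exists (fun=> 0), (fun=> -1); split => //; first exact: pol_cst.
      by apply/funext => y; rewrite eqxx add0r mulN1r opprB.
    exists (fun y => y j - x j), (fun=> 0); split; [exact: hJ|exact: pol_cst|].
    by apply/funext => y; rewrite mul0r addr0 ltn_eqF.
have [J [x0 [idJ pJ IJ hJ]]] := step M; have [Jp J0 JD JM] := idJ.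
pose x : env := fun j => if (j < M)%N then x0 j else 0.
have qx q : pol q -> exists2 i, J i & forall y, K y -> q y - q x = i y.
  move=> [p ->]; elim: p => [c|i|p [i Ii hi] p' [i' Ii' hi']|p [i Ii hi] p' [i' Ii' hi']] /=.
  - by exists (fun=> 0) => // y _; rewrite subrr.
  - rewrite /x; case: ltnP => iM.
      by exists (fun y => y i - x0 i) => //; exact: hJ.
    by exists (fun=> 0) => // y /sK/(_ _ iM) ->; rewrite subrr.
  - exists (fun y => i y + i' y); first exact: JD.
    by move=> y Ky; rewrite -hi// -hi'//; ring.
  - exists (fun y => pev p' y * i y + pev p x * i' y).
      by apply: JD; apply: JM => //; [exists p'|exact: pol_cst].
    by move=> y Ky; rewrite -hi// -hi'//; ring.
have [y0 Ky0] := K0.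
(* If |q(x)| exceeded B, then q / q(x), which is 1 minus an element of [J], would be at most B /
   |q(x)| < 1 on [K], against properness. *)
have hx : hull K x.
  move=> q pq B hB; rewrite leNgt; apply/negP => Bq.
  have B0 : 0 <= B := le_trans (cmod_ge0 _) (hB _ Ky0).
  have q0 : q x != 0 by rewrite -cmod_gt0 (le_lt_trans B0).
  have [i Ii hi] := qx _ pq.
  apply: (pJ (B / cmod (q x))); first by rewrite ltr_pdivrMr ?mul1r// cmod_gt0.
  split; first exact: pol_cst.
  exists (fun y => - (q x)^-1 * i y); first by apply: JM => //; exact: pol_cst.
  move=> y Ky; rewrite -hi// /=.
  have -> : (1 : env -> C) y - - (q x)^-1 * (q y - q x) = (q y) / q x.
    by change ((1 : env -> C) y) with (1 : C); field.
  by rewrite cmodM cmodV ler_wpM2r ?invr_ge0 ?cmod_ge0//; exact: hB.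
have [i Ii ix] := nz _ hx.
have [j Jj hj] := qx _ (Ip _ Ii).
apply: (pJ 0 ltr01); split; first exact: pol_cst.
exists (fun y => (i x)^-1 * (i y - j y)).
  apply/(JM (fun=> (i x)^-1)); first exact: pol_cst.
  apply: (JD i (fun y => - j y)); first exact: IJ.
  have -> : (fun y => - j y) = (fun y => -1 * j y) by apply/funext => y; rewrite mulN1r.
  by apply: JM => //; exact: pol_cst.
move=> y Ky; rewrite -hj// subKr mulVf//.
by change ((1 : env -> C) y) with (1 : C); rewrite subrr cmod0.
Qed.

End Hull.

(** * Powers of one polynomial modulo another *)

Section Power.
Variable R : realType.
Local Notation C := (R[i]).
Local Notation env := (nat -> R[i]).
Implicit Types (K : set env) (q f g h : env -> C).

Lemma sum_circle N (rho : C) l : (0 < N)%N ->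
  \sum_(j < N) (rho * wroot R N ^+ j) ^+ l =
  if (N %| l)%N then N%:R * rho ^+ l else 0.
Proof.
move=> N0; under eq_bigr do rewrite exprMn.
by rewrite -mulr_sumr sum_wroot//; case: ifP => _; rewrite ?mulr0// mulrC.
Qed.

Lemma upd_upd (x : env) i s t : upd (upd x i s) i t = upd x i t.
Proof. by apply/funext => j; rewrite /upd; case: eqP. Qed.

Lemma upd_id (x : env) i : upd x i (x i) = x.
Proof. by apply/funext => j; rewrite /upd; case: eqP => [->|]. Qed.

Lemma supported_upd n K y i : supported n K -> K y -> (n <= i)%N -> upd y i 0 = y.
Proof. by move=> sK Ky ni; rewrite -[in RHS](upd_id y i) (sK y Ky i ni). Qed.

(* An extra variable [t] on the circle [|t| = tau] makes [g] and [1 - t h]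
   generate the unit ideal; [h ^ m] is then read off as a Taylor coefficient
   of [1 / (1 - t h)]. *)
Lemma power_mod_ideal K g h M (tau : R) : pol_bounded K -> supported M K ->
  pol g -> pol h -> 1 < tau ->
  (forall x, hull K x -> g x = 0 -> cmod (h x) < tau^-1) ->
  forall m0 (eta : R), 0 < eta -> exists m k, [/\ (m0 <= m)%N, pol k &
    forall y, K y -> cmod (h y ^+ m - g y * k y) <= eta].
Proof.
move=> bK sK pg ph tau1 small m0 eta eta0.
have tau0 : 0 < tau by lra.
pose K4 : set env := [set y | exists y0 t, [/\ K y0, cmod t = tau & y = upd y0 M t]].
pose res (f : env -> C) y := f (upd y M 0).
have pres f : pol f -> pol (res f) by move=> pf; apply: pol_upd => //; exact: pol_cst.
pose th (y : env) := 1 - y M * res h y.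
have pth : pol th by apply: pol_sub (pol_cst _) (pol_mul (pol_var _ _) (pres _ ph)).
pose I f := exists A B, [/\ pol A, pol B & f = fun y => res g y * A y + th y * B y].
have idI : ideal I.
  split.
  - move=> _ [A [B [pA pB ->]]]; apply: pol_add; apply: pol_mul => //; exact: pres.
  - exists (fun=> 0), (fun=> 0); split; [exact: pol_cst..|].
    by apply/funext => y; rewrite !mulr0 addr0.
  - move=> _ _ [A [B [pA pB ->]]] [A' [B' [pA' pB' ->]]].
    exists (fun y => A y + A' y), (fun y => B y + B' y).
    by split; [exact: pol_add..|apply/funext => y; ring].
  - move=> f _ pf [A [B [pA pB ->]]].
    exists (fun y => f y * A y), (fun y => f y * B y).
    by split; [exact: pol_mul..|apply/funext => y; ring].
have resK f y0 t : K y0 -> res f (upd y0 M t) = f y0.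
  by move=> Ky0; rewrite /res upd_upd (supported_upd sK Ky0 (leqnn M)).
have bK4 : pol_bounded K4.
  apply: pol_bounded_coord => i; have [B [B0 hB]] := bK _ (pol_var R i).
  exists (Num.max B tau) => _ [y0 [t [Ky0 ct ->]]]; rewrite /upd le_max.
  by case: eqP => _; [rewrite ct lexx orbT|rewrite hB].
have sK4 : supported M.+1 K4.
  move=> _ [y0 [t [Ky0 ct ->]]] i Mi; rewrite /upd gtn_eqF//.
  by apply: (sK _ Ky0); exact: ltnW.
have [] := @ideal_unit R K4 I M.+1 bK4 sK4 idI.
  move=> x hx; have hx' : hull K (upd x M 0).
    move=> q pq B hB; apply: (hx _ (pres _ pq) B) => _ [y0 [t [Ky0 ct ->]]].
    by rewrite resK//; exact: hB.
  have xM : cmod (x M) <= tau.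
    by apply: (hx _ (pol_var R M)) => _ [y0 [t [_ <- ->]]]; rewrite /upd eqxx.
  have [g0|g0] := eqVneq (res g x) 0; last first.
    exists (fun y => res g y * 1 + th y * 0); last by rewrite mulr1 mulr0 addr0.
    by exists (fun=> 1), (fun=> 0); split => //; exact: pol_cst.
  exists (fun y => res g y * 0 + th y * 1).
    by exists (fun=> 0), (fun=> 1); split => //; exact: pol_cst.
  rewrite mulr1 mulr0 add0r /th subr_eq0; apply/eqP => e.
  have := small _ hx' g0; rewrite -/(res h x) => hs.
  have : cmod (x M * res h x : C) < tau * tau^-1.
    rewrite cmodM; apply: le_lt_trans (_ : _ <= tau * cmod (res h x)) _.
      by rewrite ler_wpM2r ?cmod_ge0.
    by rewrite ltr_pM2l.
  by rewrite -e cmod1 divff ?gt_eqF// ltxx.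
move=> _ [A [B [pA pB ->]]] hAB.
pose e y := 1 - (res g y * A y + th y * B y).
have pe : pol e.
  by apply: pol_sub (pol_cst _) (pol_add (pol_mul (pres _ pg) pA) (pol_mul pth pB)).
have [CB [CB0 hCB]] := bK4 _ pB.
have [H [H0 hH]] := bK _ ph.
have ti : 0 <= tau^-1 < 1 by rewrite invr_ge0 ltW//= invf_lt1.
have P1 : 0 < eta / 2 / (2 * CB + 1) by rewrite !divr_gt0//; lra.
have [m1 hm1] := small_expr ti P1.
(* The order of choices matters: the bound 2 CB on [Bs] holds for every exponent [s], so [m] can be
   fixed first, and [s] then beats [W], which grows with [m]. *)
have [m [m0m hm]] : exists m, (m0 <= m)%N /\ tau ^- m * (2 * CB) <= eta / 2.
  exists (maxn m0 m1); split; first exact: leq_maxl.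
  have := hm1 _ (leq_maxr m0 _); rewrite exprVn ler_pdivlMr; last by lra.
  apply: le_trans; rewrite ler_wpM2l ?invr_ge0 ?exprn_ge0 ?ltW//; lra.
pose W := \sum_(i < m.+1) (tau * H) ^+ i.
have W0 : 0 <= W by apply: sumr_ge0 => i _; rewrite exprn_ge0// mulr_ge0// ltW.
have tm0 : 0 < tau ^- m by rewrite invr_gt0 exprn_gt0.
have half : 0 <= (2^-1 : R) < 1 by apply/andP; split; lra.
have P2 : 0 < eta / 2 / (tau ^- m * W + 1).
  by rewrite !divr_gt0// ltr_wpDl// mulr_ge0// ltW.
have [s /(_ _ (leqnn s)) hs0] := small_expr half P2.
have hs : tau ^- m * (W * 2^-1 ^+ s) <= eta / 2.
  have P : 0 <= tau ^- m * W by rewrite mulr_ge0// ltW.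
  move: hs0; rewrite ler_pdivlMr; last by lra.
  apply: le_trans; rewrite mulrA [leRHS]mulrC ler_wpM2r ?exprn_ge0//; lra.
pose E y := \sum_(j < s) e y ^+ j.
have pE : pol E by apply: pol_sum => j; exact: pol_exp.
pose As y := A y * E y; pose Bs y := B y * E y.
have pAs : pol As by exact: pol_mul.
have pBs : pol Bs by exact: pol_mul.
have ident y : 1 - e y ^+ s = res g y * As y + th y * Bs y.
  have -> : 1 - e y ^+ s = (1 - e y) * E y.
    by rewrite /E -[e y ^+ s](subrK 1) subrX1; ring.
  by rewrite /As /Bs /e; ring.
have bBs y : K4 y -> cmod (Bs y) <= 2 * CB.
  move=> Ky; rewrite cmodM mulrC ler_pM ?cmod_ge0//; last exact: hCB.
  apply: le_trans (cmod_sum _ _ _) _.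
  apply: (@le_trans _ _ (\sum_(j < s) 2^-1 ^+ j)).
    by apply: ler_sum => j _; rewrite cmodX lerXn2r ?nnegrE ?cmod_ge0 ?invr_ge0//; exact: hAB.
  have := subrX1 (2^-1 : R) s; set T := \sum_(_ < _) _ => hT.
  have : 0 <= (2^-1 : R) ^+ s by rewrite exprn_ge0.
  by lra.
have [d [c [pc hc]]] := pol_coef M pBs.
have [N [mN dN N0]] : exists N, [/\ (m < N)%N, (d < N)%N & (0 < N)%N].
  by exists (m + d).+1; rewrite !ltnS leq_addr leq_addl.
have mN' := ltnW mN.
have NR : (N%:R : C) != 0 by rewrite pnatr_eq0 -lt0n.
pose t (j : 'I_N) : C := (tau%:C)%C * wroot R N ^+ j.
have ct j : cmod (t j) = tau.
  by rewrite cmodM cmodX cmod_wroot expr1n mulr1 cmod_real ger0_norm// ltW.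
have tauC0 : (tau%:C)%C != 0 :> C by rewrite -cmod_eq0 cmod_real normr_eq0 gt_eqF.
have tN j : t j ^+ N = (tau%:C)%C ^+ N.
  by rewrite /t exprMn exprAC (prim_expr_order (prim_wroot R N0)) expr1n mulr1.
(* This is t_j^(-m), because t_j^N = tau^N; averaging against it extracts the coefficient of t^m. *)
pose w j : C := t j ^+ (N - m) / (tau%:C)%C ^+ N.
have cw j : cmod (w j) = tau ^- m.
  rewrite /w cmodM cmodV !cmodX ct cmod_real (ger0_norm (ltW tau0)).
  have tN0 : tau ^+ (N - m) != 0 by rewrite expf_neq0// gt_eqF.
  by rewrite -[in X in _ / X](subnK mN') exprD invfM mulrA divff ?mul1r.
pose k y := N%:R^-1 * \sum_(j < N) w j * ((\sum_(i < m.+1) (t j * h y) ^+ i) * As (upd y M (t j))).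
exists m, k; split => //.
  apply: pol_mul (pol_cst _) _; apply: pol_sum => j; apply: pol_mul (pol_cst _) _.
  apply: pol_mul; last by apply: pol_upd => //; exact: pol_cst.
  by apply: pol_sum => i; apply: pol_exp; apply: pol_mul (pol_cst _) ph.
move=> y Ky.
have hmE : h y ^+ m = N%:R^-1 * \sum_(j < N) w j * (\sum_(i < m.+1) (t j * h y) ^+ i).
  under eq_bigr do rewrite mulr_sumr; rewrite exchange_big /=.
  transitivity (N%:R^-1 * \sum_(i < m.+1) h y ^+ i / (tau%:C)%C ^+ N * \sum_(j < N) t j ^+ (N - m + i)).
    rewrite big_ord_recr /= big1 ?add0r.
      rewrite subnK//.
      rewrite sum_circle// dvdnn mulrCA; field.
      by rewrite NR expf_neq0.
    move=> i _; rewrite sum_circle// gtnNdvd ?mulr0//; move: (ltn_ord i) mN; clear; lia.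
  congr (_ * _); apply: eq_bigr => i _; rewrite mulr_sumr; apply: eq_bigr => j _.
  by rewrite /w (exprMn _ (t j) (h y)) (exprD (t j)); ring.
have zero : \sum_(j < N) t j * Bs (upd y M (t j)) = 0.
  under eq_bigr do rewrite hc mulr_sumr; rewrite exchange_big /= big1// => l _.
  transitivity (c l y * \sum_(j < N) t j ^+ l.+1).
    by rewrite mulr_sumr; apply: eq_bigr => j _; rewrite exprS; ring.
  rewrite sum_circle// gtnNdvd ?mulr0//; move: (ltn_ord l) dN; clear; lia.
(* Multiply 1 = g As + (1 - t h) Bs + e^s by the partial geometric sum S, for which (1 - t h) S = 1
   - (t h)^(m+1). Against t^(-m) the last power leaves h^(m+1) t Bs, whose circle average vanishes
   by [zero]. *)
have -> : h y ^+ m - g y * k y = N%:R^-1 * \sum_(j < N) w j *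
    (Bs (upd y M (t j)) + (\sum_(i < m.+1) (t j * h y) ^+ i) * e (upd y M (t j)) ^+ s).
  apply/eqP; rewrite -subr_eq0; apply/eqP.
  transitivity (- (N%:R^-1 * (h y ^+ m.+1 * \sum_(j < N) t j * Bs (upd y M (t j))))); last first.
    by rewrite zero !mulr0 oppr0.
  have factor (n' a b c' r : C) : a - g y * b - c' = - r ->
    n' * a - g y * (n' * b) - n' * c' = - (n' * r).
    by move=> E1; rewrite -[RHS]mulrN -E1; ring.
  rewrite hmE /k; apply: factor.
  rewrite !mulr_sumr -!sumrB -sumrN; apply: eq_bigr => j _.
  have thE : th (upd y M (t j)) = 1 - t j * h y by rewrite /th resK// /upd eqxx.
  have := ident (upd y M (t j)); rewrite resK// thE.
  set S := \sum_(_ < _) _; set ee := e _ ^+ s; set a := As _; set b := Bs _ => idn.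
  have SE : S * (1 - t j * h y) = 1 - (t j * h y) ^+ m.+1.
    by rewrite -[in RHS](subrK 1 ((t j * h y) ^+ m.+1)) subrX1 -/S; ring.
  have wt : w j * t j ^+ m.+1 = t j.
    rewrite /w mulrAC -exprD addnS subnK//.
    by rewrite exprSr tN mulrC mulKf// expf_neq0.
  have S1 : S = S * (g y * a + (1 - t j * h y) * b) + S * ee by rewrite -idn; ring.
  have -> : w j * S - g y * (w j * (S * a)) - w j * (b + S * ee) =
    w j * (S * (1 - t j * h y) * b - b).
    by rewrite [in X in w j * X - _]S1; ring.
  by rewrite SE (exprMn _ (t j) (h y)) -[in RHS]wt; ring.
rewrite cmodM cmodV cmod_nat.
apply: (@le_trans _ _ (N%:R^-1 * \sum_(j < N) (tau ^- m * (2 * CB + W * 2^-1 ^+ s)))).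
  rewrite ler_wpM2l ?invr_ge0 ?ler0n//; apply: le_trans (cmod_sum _ _ _) _.
  apply: ler_sum => j _; rewrite cmodM cw ler_wpM2l ?(ltW tm0)//.
  have K4j : K4 (upd y M (t j)) by exists y, (t j).
  rewrite (le_trans (cmodD _ _))// lerD ?bBs// cmodM ler_pM ?cmod_ge0//.
    apply: le_trans (cmod_sum _ _ _) _; apply: ler_sum => i _.
    rewrite cmodX lerXn2r ?nnegrE ?cmod_ge0 ?mulr_ge0 ?(ltW tau0)//.
    by rewrite cmodM ct ler_wpM2l ?(ltW tau0)//; exact: hH.
  by rewrite cmodX lerXn2r ?nnegrE ?cmod_ge0 ?invr_ge0//; exact: hAB.
rewrite sumr_const card_ord -[X in _ * X]mulr_natl mulKf ?pnatr_eq0 -?lt0n//.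
by rewrite mulrDr; lra.
Qed.

End Power.

(** * Hulls and level sets of the modulus *)

Section LocalMaximum.
Variable R : realType.
Local Notation C := (R[i]).
Local Notation env := (nat -> R[i]).
Implicit Types (K : set env) (q f g h : env -> C).

(** A discrete Cauchy integral: for large N the value is near -1 when |s| < rho and near 0 when |s|
    > rho. *)
Lemma average_resolvent N (rho : R) (s : C) : (0 < N)%N ->
  s ^+ N != (rho%:C)%C ^+ N ->
  N%:R^-1 * \sum_(j < N) ((rho%:C)%C * wroot R N ^+ j) / (s - (rho%:C)%C * wroot R N ^+ j)
  = (rho%:C)%C ^+ N / (s ^+ N - (rho%:C)%C ^+ N).
Proof.
move=> N0 sN; have D0 : s ^+ N - (rho%:C)%C ^+ N != 0 by rewrite subr_eq0.
have NR : (N%:R : C) != 0 by rewrite pnatr_eq0 -lt0n.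
apply: (mulIf D0); rewrite divfK//; apply: (mulfI NR).
rewrite -(@sum_roots_geometric R _ (idfun : {rmorphism C -> C}) N _ s N0) /=.
rewrite mulrA mulVKf// mulr_suml; apply: eq_bigr => j _.
set z : C := (rho%:C)%C * wroot R N ^+ j; have zN : z ^+ N = (rho%:C)%C ^+ N.
  by rewrite exprMn exprAC (prim_expr_order (prim_wroot R N0)) expr1n mulr1.
have sz : s - z != 0 by apply: contra sN; rewrite subr_eq0 -zN => /eqP ->.
by rewrite -mulrA; congr (_ * _); rewrite -zN -[_ - _ ^+ _]opprB subrXX; field.
Qed.

(** The inverse of l is recorded as a coordinate of its own, because the hull of a circle is a disc;
    its bound 1/r1 keeps |l| >= r1 on the hull. *)
Definition two_circles K n (r1 r2 : R) : set env :=
  [set y | exists y0 l, [/\ K y0, cmod l = r1 \/ cmod l = r2 &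
    y = upd (upd y0 n l) n.+1 l^-1]].

(** As a function of l, the product l k(l, 1/l) is a Laurent polynomial; once N exceeds all degrees
    the average over a circle is its constant term, whatever the radius. *)
Lemma average_laurent k n : pol k -> exists N1, forall N (rho : R), (N1 <= N)%N -> 0 < rho ->
  forall y, N%:R^-1 * \sum_(j < N) ((rho%:C)%C * wroot R N ^+ j) *
      k (upd (upd y n ((rho%:C)%C * wroot R N ^+ j)) n.+1 ((rho%:C)%C * wroot R N ^+ j)^-1)
    = N%:R^-1 * \sum_(j < N) wroot R N ^+ j *
      k (upd (upd y n (wroot R N ^+ j)) n.+1 (wroot R N ^+ j)^-1).
Proof.
move=> pk; have [d [c [pc hc]]] := pol_coef n.+1 pk.
have /choice [F hF] : forall b, exists dc : nat * (nat -> env -> C),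
    forall x t, c b (upd x n t) = \sum_(a < dc.1) dc.2 a x * t ^+ a.
  by move=> b; have [d' [c' [_ h]]] := pol_coef n (pc b); exists (d', c').
pose N1 := (d + \sum_(b < d) (F b).1).+2.
exists N1 => N rho N1N rho0.
have N0 : (0 < N)%N by rewrite (leq_trans _ N1N).
suff key (r : R) (y : env) : 0 < r ->
    \sum_(j < N) ((r%:C)%C * wroot R N ^+ j) *
      k (upd (upd y n ((r%:C)%C * wroot R N ^+ j)) n.+1 ((r%:C)%C * wroot R N ^+ j)^-1)
    = \sum_(b < d) \sum_(a < (F b).1) (F b).2 a y * (if a.+1 == b then N%:R else 0).
  move=> y; rewrite key//; congr (_ * _); rewrite -(@key 1)//.
  by apply: eq_bigr => j _; rewrite rmorph1 !mul1r.
move=> r0; have rC0 : (r%:C)%C != 0 :> C by rewrite -cmod_eq0 cmod_real normr_eq0 gt_eqF.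
have w0 j : wroot R N ^+ j != 0 by rewrite -cmod_eq0 cmodX cmod_wroot expr1n oner_eq0.
under eq_bigr do rewrite hc mulr_sumr.
rewrite exchange_big /=; apply: eq_bigr => b _.
under eq_bigr do rewrite hF mulr_suml mulr_sumr.
rewrite exchange_big /=; apply: eq_bigr => a _.
have bd := ltn_ord b; have ad := ltn_ord a.
have aN : (a.+1 < N)%N.
  rewrite (leq_trans _ N1N)// /N1 !ltnS (leq_trans (ltnW ad))//.
  by rewrite (bigD1 b) //= addnCA leq_addr.
have bN : (b < N)%N by rewrite (leq_trans bd)// (leq_trans _ N1N)// /N1 -addn2 -addnA leq_addr.
transitivity ((F b).2 a y * ((r%:C)%C ^- N * \sum_(j < N) ((r%:C)%C * wroot R N ^+ j) ^+ (a.+1 + (N - b)))).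
  rewrite !mulr_sumr; apply: eq_bigr => j _.
  set z : C := (r%:C)%C * wroot R N ^+ j; have zN : z ^+ N = (r%:C)%C ^+ N.
    by rewrite exprMn exprAC (prim_expr_order (prim_wroot R N0)) expr1n mulr1.
  have z0 : z != 0 by rewrite mulf_neq0.
  rewrite -zN exprD exprS.
  have -> : z ^+ (N - b) = z ^+ N * z^-1 ^+ b.
    by rewrite -[in RHS](subnK (ltnW bN)) exprD exprVn mulfK// expf_neq0.
  by field; rewrite expf_neq0.
congr (_ * _); rewrite sum_circle//; case: eqP => [ab|ab].
  by rewrite ab subnKC ?dvdnn// 1?ltnW// mulrCA mulVf ?mulr1// expf_neq0.
rewrite ifN ?mulr0//; apply/negP => /dvdnP[q]; case: q => [|[|q]] h.
- move: h bN; clear; lia.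
- apply: ab; move: h bN; clear; lia.
- have : (2 * N <= q.+2 * N)%N by rewrite leq_mul2r orbT.
  rewrite -h; move: aN bN; clear; lia.
Qed.

(** Otherwise some h has h(p) = 1 and |h| <= th < 1 on the smaller set. For l on either circle h^m
    is nearly (f - l) k(., l), so the average [kap] of l k(., l) is nearly h^m times that of l / (f
    - l). Both circles give the same polynomial [kap]. It is small on [K]: where |f| is below the
    middle radius the outer circle gives -h^m, which is small there, and elsewhere the inner circle
    gives almost 0. But at p it is near -1. *)
Lemma hull_shell K f n p (r1 r2 : R) : pol_bounded K -> supported n K -> pol f ->
  0 < r1 -> r1 < r2 -> hull K p -> cmod (f p) < r1 ->
  hull ([set y | hull K y /\ r1 <= cmod (f y) <= r2] `|`
        [set y | K y /\ cmod (f y) <= r2]) p.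
Proof.
move=> bK sK pf r10 r12 hp fp q pq B; set K' := _ `|` _ => hB.
rewrite leNgt; apply/negP => Bq.
have r20 : 0 < r2 by lra.
have [h [th [ph hp1 /andP[th0 th1] hth]]] : exists h (th : R),
    [/\ pol h, h p = 1, 0 <= th < 1 & forall y, K' y -> cmod (h y) <= th].
  have [q0|q0] := eqVneq (q p) 0.
    exists (fun=> 1), 0; split; rewrite ?lexx ?ltr01//; first exact: pol_cst.
    move=> y /hB; move: Bq; rewrite q0 cmod0 => b0 /(le_lt_trans) /(_ b0).
    by rewrite ltNge cmod_ge0.
  have cq : 0 < cmod (q p) by rewrite cmod_gt0.
  exists (fun y => (q p)^-1 * q y), (Num.max 0 B / cmod (q p)); split.
  - exact: pol_mul (pol_cst _) pq.
  - by rewrite mulVf.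
  - by rewrite divr_ge0 ?cmod_ge0 ?le_max ?lexx//= ltr_pdivrMr// mul1r gt_max cq.
  - move=> y /hB hy; rewrite cmodM cmodV mulrC ler_wpM2r ?invr_ge0 ?cmod_ge0//.
    by rewrite le_max hy orbT.
(* 1/tau is the midpoint between [th] and 1. *)
pose tau := 2 / (1 + th).
have tau1 : 1 < tau by rewrite /tau ltr_pdivlMr; lra.
have thtau : th < tau^-1 by rewrite /tau invf_div ltr_pdivlMr; lra.
pose ext y (l : C) := upd (upd y n l) n.+1 l^-1.
pose res (u : env -> C) y := u (upd (upd y n 0) n.+1 0).
have pres u : pol u -> pol (res u).
  move=> pu; apply: (@pol_upd R (fun x => u (upd x n.+1 0)) n (fun=> 0)) => //.
    by apply: pol_upd => //; exact: pol_cst.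
  exact: pol_cst.
have res_ext u y l : K y -> res u (ext y l) = u y.
  move=> Ky; rewrite /res /ext; congr u; apply/funext => j; rewrite /upd.
  case: eqP => [->|jn1]; first by rewrite (sK y Ky).
  by case: eqP => [->|//]; rewrite (sK y Ky).
have extn y l : ext y l n = l by rewrite /ext /upd ltn_eqF// eqxx.
have resK u y : K y -> res u y = u y.
  move=> Ky; rewrite /res; congr u; apply/funext => j; rewrite /upd.
  case: eqP => [->|jn1]; first by rewrite (sK y Ky).
  by case: eqP => [->|//]; rewrite (sK y Ky).
pose K2 := two_circles K n r1 r2.
have bK2 : pol_bounded K2.
  apply: pol_bounded_coord => i; have [Bi [B0 hBi]] := bK _ (pol_var R i).
  exists (Num.max (Num.max Bi r2) r1^-1) => _ [y0 [l [Ky0 cl ->]]].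
  have r1l : r1 <= cmod l <= r2 by case: cl => ->; rewrite lexx ltW.
  rewrite /upd; case: eqP => _.
    case/andP: r1l => l1 _; rewrite cmodV le_max; apply/orP; right.
    by rewrite lef_pV2 ?posrE// (lt_le_trans r10).
  by case: eqP => _; rewrite !le_max; [case/andP: r1l => _ ->; rewrite orbT|rewrite hBi].
have sK2 : supported n.+2 K2.
  move=> _ [y0 [l [Ky0 cl ->]]] i ni; rewrite /upd gtn_eqF// gtn_eqF; last exact: ltnW.
  by apply: (sK y0 Ky0); exact: leq_trans (leqW (leqnSn n)) ni.
pose g y := res f y - y n.
have pg : pol g by apply: pol_sub (pol_var _ _); exact: pres.
have small x : hull K2 x -> g x = 0 -> cmod (res h x) < tau^-1.
  move=> hx /eqP; rewrite subr_eq0 => /eqP fx; apply: le_lt_trans thtau.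
  apply: (hth (upd (upd x n 0) n.+1 0)); left; split.
    move=> u pu B' hB'; apply: (hx _ (pres _ pu)) => _ [y0 [l [Ky0 cl ->]]].
    by rewrite res_ext//; exact: hB'.
  rewrite -/(res f x) fx.
  have l2 : cmod (x n) <= r2.
    apply: (hx _ (pol_var R n)) => _ [y0 [l [Ky0 cl ->]]].
    by rewrite /upd ltn_eqF// eqxx; case: cl => ->//; exact: ltW.
  have m1 : cmod (x n.+1) <= r1^-1.
    apply: (hx _ (pol_var R n.+1)) => _ [y0 [l [Ky0 cl ->]]].
    rewrite /upd eqxx cmodV; case: cl => ->//.
    by rewrite lef_pV2 ?posrE// ltW.
  have : cmod (x n * x n.+1 - 1 : C) <= 0.
    apply: (hx (fun x => x n * x n.+1 - 1)).
      exact: pol_sub (pol_mul (pol_var _ _) (pol_var _ _)) (pol_cst _).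
    move=> _ [y0 [l [Ky0 cl ->]]]; rewrite /upd eqxx ltn_eqF// eqxx divff ?subrr ?cmod0//.
    by rewrite -cmod_gt0; case: cl => ->.
  rewrite le_eqVlt ltNge cmod_ge0 orbF cmod_eq0 subr_eq0 => /eqP lm.
  rewrite l2 andbT.
  have : cmod (x n) * cmod (x n.+1) = 1 by rewrite -cmodM lm cmod1.
  have := cmod_ge0 (x n); move: m1; set a := cmod (x n); set b := cmod (x n.+1).
  move=> b1 a0 ab; have : 1 <= a * r1^-1 by rewrite -ab ler_wpM2l.
  by rewrite ler_pdivlMr ?mul1r.
pose dl := (r2 - r1) / 2.
pose rm := (r1 + r2) / 2.
have dl0 : 0 < dl by rewrite /dl; lra.
have rm0 : 0 < rm by rewrite /rm; lra.
have r1m : r1 = rm - dl by rewrite /rm /dl; lra.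
have r2m : r2 = rm + dl by rewrite /rm /dl; lra.
clearbody dl rm.
(* The error of [kap] at distance dl from a circle, r eta / dl, is then at most 1/16 for both
   radii. *)
pose eta := dl / (16 * r2).
have eta0 : 0 < eta by rewrite mulr_gt0// invr_gt0 mulr_gt0//; lra.
have etaE : r2 * eta / dl = 16^-1 by rewrite /eta; field; rewrite !gt_eqF.
clearbody eta.
have th01 : 0 <= th < 1 by rewrite th0.
have s16 : 0 < (16^-1 : R) by lra.
have [m0 hm0] := small_expr th01 s16.
have [m [k [m0m pk hk]]] := power_mod_ideal bK2 sK2 pg (pres _ ph) tau1 small m0 eta0.
pose kk y l := k (ext y l).
have pkk l : pol (fun y => kk y l).
  apply: (@pol_upd R (fun x => k (upd x n.+1 l^-1)) n (fun=> l)); last exact: pol_cst.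
  by apply: pol_upd => //; exact: pol_cst.
(* For a fixed l the expression is a polynomial in y, so the estimate passes from [K] to its
   hull. *)
have Ebd y l : hull K y -> cmod l = r1 \/ cmod l = r2 ->
    cmod (h y ^+ m - (f y - l) * kk y l) <= eta.
  move=> hy cl; apply: (hy (fun y => h y ^+ m - (f y - l) * kk y l)).
    apply: pol_sub (pol_exp _ ph) (pol_mul (pol_sub pf (pol_cst _)) (pkk l)).
  move=> z Kz; have := hk (ext z l) _; rewrite /g !res_ext// extn.
  by apply; exists z, l.
have [H [H0 hH]] := bK _ ph.
have [N1 hN1] := average_laurent n pk.
have q1 : 0 <= r1 / rm < 1 by rewrite divr_ge0 ?ltW//= ltr_pdivrMr// mul1r r1m; move: dl0; clear; lra.
have q2 : 0 <= rm / r2 < 1 by rewrite divr_ge0 ?ltW//= ltr_pdivrMr// mul1r r2m; move: dl0; clear; lra.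
have Hm0 : 0 <= H ^+ m by rewrite exprn_ge0.
have e1 : 0 < 32^-1 / (H ^+ m + 1) by rewrite divr_gt0//; lra.
have h2 : 0 < (2^-1 : R) by lra.
have [N2 hN2] := small_expr q1 e1.
have [N3 hN3] := small_expr q2 h2.
have [N [NN1 NN2 NN3 N0]] : exists N, [/\ (N1 <= N)%N, (N2 <= N)%N, (N3 <= N)%N & (0 < N)%N].
  by exists (N1 + N2 + N3).+1; split=> //; rewrite ltnW// ltnS; clear; lia.
pose z (r : R) j : C := (r%:C)%C * wroot R N ^+ j.
pose kap r y := N%:R^-1 * \sum_(j < N) z r j * kk y (z r j).
have kap12 y : kap r1 y = kap r2 y by rewrite /kap /kk /ext /z !hN1.
have cz r j : 0 < r -> cmod (z r j) = r.
  by move=> r0; rewrite cmodM cmodX cmod_wroot expr1n mulr1 cmod_real ger0_norm// ltW.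
have NR : (N%:R : C) != 0 by rewrite pnatr_eq0 -lt0n.
have kapE (r : R) y : hull K y -> r = r1 \/ r = r2 -> cmod (f y) != r ->
    f y ^+ N != (r%:C)%C ^+ N ->
    cmod (kap r y - h y ^+ m * ((r%:C)%C ^+ N / (f y ^+ N - (r%:C)%C ^+ N)))
      <= r * eta / `|cmod (f y) - r|.
  move=> hy r12' fr fN; have r0 : 0 < r by case: r12' => ->.
  rewrite -average_resolvent// /kap mulrCA -mulrBr mulr_sumr -sumrB cmodM cmodV cmod_nat.
  have d0 : 0 < `|cmod (f y) - r| by rewrite normr_gt0 subr_eq0.
  apply: (@le_trans _ _ (N%:R^-1 * \sum_(j < N) (r * eta / `|cmod (f y) - r|))); last first.
    by rewrite sumr_const card_ord -[X in _ * X]mulr_natl mulKf// pnatr_eq0 -lt0n.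
  rewrite ler_wpM2l ?invr_ge0 ?ler0n//; apply: le_trans (cmod_sum _ _ _) _.
  apply: ler_sum => j _; rewrite -/(z r j).
  have fz : f y - z r j != 0.
    by apply: contraNneq fr => /eqP; rewrite subr_eq0 => /eqP ->; rewrite cz.
  have -> : z r j * kk y (z r j) - h y ^+ m * (z r j / (f y - z r j)) =
     - (z r j * (h y ^+ m - (f y - z r j) * kk y (z r j)) / (f y - z r j)).
    by field.
  rewrite cmodN cmodM cmodV [cmod (z r j * _)]cmodM cz//; apply: ler_pM; rewrite ?invr_ge0 ?mulr_ge0 ?cmod_ge0 ?(ltW r0)//.
    rewrite ler_wpM2l ?(ltW r0)//; apply: Ebd => //.
    by case: r12' => ->; rewrite cz//; [left|right].
  have := cmod_lower (f y) (z r j); have := cmod_lower (z r j) (f y).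
  rewrite (cmod_distrC (z r j)) cz// => a1 a2.
  by rewrite lef_pV2 ?posrE ?cmod_gt0// ler_norml a2 andbT lerNl opprB.
have pkap : pol (kap r2).
  apply: pol_mul (pol_cst _) _; apply: pol_sum => j; exact: pol_mul (pol_cst _) (pkk _).
have cN (a : C) (r : R) : 0 < r -> r ^+ N - cmod a ^+ N <= cmod (a ^+ N - (r%:C)%C ^+ N : C).
  move=> r0; rewrite cmod_distrC -cmodX; have := cmod_lower ((r%:C)%C ^+ N) (a ^+ N).
  by rewrite {1}cmodX cmod_real ger0_norm// ltW.
have cN' (a : C) (r : R) : 0 < r -> cmod a ^+ N - r ^+ N <= cmod (a ^+ N - (r%:C)%C ^+ N : C).
  move=> r0; rewrite -cmodX; have := cmod_lower (a ^+ N) ((r%:C)%C ^+ N).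
  by rewrite [X in _ - X]cmodX cmod_real ger0_norm// ltW.
have cr (r : R) : 0 < r -> cmod ((r%:C)%C ^+ N : C) = r ^+ N.
  by move=> r0; rewrite cmodX cmod_real ger0_norm// ltW.
have rN (r : R) : 0 < r -> 0 < r ^+ N by move=> r0; rewrite exprn_gt0.
have hm : th ^+ m <= 16^-1 by exact: hm0.
have farb y : hull K y -> cmod (f y) < rm ->
    f y ^+ N != (r2%:C)%C ^+ N /\ cmod (f y) ^+ N <= 2^-1 * r2 ^+ N.
  move=> hy fy; have le : cmod (f y) ^+ N <= 2^-1 * r2 ^+ N.
    apply: (@le_trans _ _ (rm ^+ N)).
      by rewrite lerXn2r ?nnegrE ?cmod_ge0 ?ltW.
    by have := hN3 N NN3; rewrite expr_div_n ler_pdivrMr// rN.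
  split => //; rewrite -subr_eq0 -cmod_gt0; apply: lt_le_trans (cN _ _ r20).
  by have := rN _ r20; move: le; set a := cmod _ ^+ N; set b := r2 ^+ N; clear; lra.
have kap_small y : K y -> cmod (kap r2 y) <= 3 / 16.
  move=> Ky; have hy : hull K y := subset_hull Ky.
  have [fy|fy] := ltP (cmod (f y)) rm.
    have [fN fN2] := farb _ hy fy.
    have ne : cmod (f y) != r2 by rewrite lt_eqF// r2m; move: fy dl0; clear; lra.
    have := kapE r2 _ hy (or_intror erefl) ne fN.
    set W : C := _ / _ => kW.
    have cW : cmod W <= 2.
      rewrite /W cmodM cmodV cr// ler_pdivrMr ?cmod_gt0 ?subr_eq0//.
      have := cN (f y) _ r20; move: fN2; set a := cmod (f y) ^+ N.
      by set b := r2 ^+ N; set c := cmod _; clear; lra.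
    have hy16 : cmod (h y ^+ m) <= 16^-1.
      rewrite cmodX (le_trans _ hm)// lerXn2r ?nnegrE ?cmod_ge0//; apply: hth; right.
      by split => //; rewrite ltW// r2m; move: fy dl0; clear; lra.
    have kk2 : r2 * eta / `|cmod (f y) - r2| <= 16^-1.
      rewrite -etaE ler_wpM2l ?mulr_ge0 ?(ltW r20) ?(ltW eta0)//.
      rewrite lef_pV2 ?posrE ?normr_gt0 ?subr_eq0// ltr0_norm; last by move: fy; rewrite r2m; move: dl0; clear; lra.
      by move: fy; rewrite r2m; clear; lra.
    rewrite -(subrK (h y ^+ m * W) (kap r2 y)) (le_trans (cmodD _ _))//.
    have hW : cmod (h y ^+ m * W : C) <= 16^-1 * 2 by rewrite cmodM ler_pM ?cmod_ge0.
    apply: le_trans (lerD (le_trans kW kk2) hW) _; clear; lra.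
  (* Here h is only known to be at most [H], so r1^N / |f|^N has to outweigh H^m; this is why [N]
     was chosen after [m]. *)
  have f1 : 2 * (H ^+ m + 1) * r1 ^+ N * 16 <= cmod (f y) ^+ N.
    apply: (@le_trans _ _ (rm ^+ N)); last by rewrite lerXn2r ?nnegrE ?cmod_ge0 ?(ltW rm0).
    have H1 : 0 < H ^+ m + 1 by rewrite ltr_wpDl.
    have X : r1 ^+ N * (H ^+ m + 1) <= 32^-1 * rm ^+ N.
      rewrite -ler_pdivlMr// mulrAC -ler_pdivrMr ?rN// -expr_div_n; exact: hN2.
    by move: X; move: (r1 ^+ N) (rm ^+ N) (H ^+ m + 1); clear => a b c; lra.
  have f2 : 32 * r1 ^+ N <= cmod (f y) ^+ N.
    apply: le_trans f1; have := rN _ r10; have := Hm0; move: (r1 ^+ N) (H ^+ m); clear => a b; nra.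
  have D : r1 ^+ N * (H ^+ m) * 16 <= cmod (f y ^+ N - (r1%:C)%C ^+ N : C).
    apply: le_trans (cN' _ _ r10); have := rN _ r10; have := Hm0; move: f1 f2.
    move: (r1 ^+ N) (H ^+ m) (cmod (f y) ^+ N); clear => a b c; nra.
  have D0 : 0 < cmod (f y ^+ N - (r1%:C)%C ^+ N : C).
    apply: lt_le_trans (cN' _ _ r10); have := rN _ r10; move: f2.
    move: (r1 ^+ N) (cmod (f y) ^+ N); clear => a b; lra.
  have fN : f y ^+ N != (r1%:C)%C ^+ N by rewrite -subr_eq0 -cmod_gt0.
  have ne : cmod (f y) != r1 by rewrite gt_eqF// (lt_le_trans _ fy)// r1m; move: dl0; clear; lra.
  rewrite -kap12; have := kapE r1 _ hy (or_introl erefl) ne fN.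
  set W : C := _ / _ => kW.
  have kk2 : r1 * eta / `|cmod (f y) - r1| <= 16^-1.
    rewrite -etaE ler_pM ?invr_ge0 ?mulr_ge0 ?(ltW r10) ?(ltW eta0)//.
      by rewrite ler_wpM2r ?(ltW eta0)// ltW.
    rewrite lef_pV2 ?posrE ?normr_gt0 ?subr_eq0// ger0_norm; last by rewrite r1m; move: fy dl0; clear; lra.
    by rewrite r1m; move: fy; clear; lra.
  have hW : cmod (h y ^+ m * W : C) <= 16^-1.
    rewrite /W !cmodM cmodV cr// cmodX mulrA ler_pdivrMr//.
    have : cmod (h y) ^+ m <= H ^+ m by rewrite lerXn2r ?nnegrE ?cmod_ge0//; exact: hH.
    have : 0 <= cmod (h y) ^+ m by rewrite exprn_ge0 ?cmod_ge0.
    have := rN _ r10; move: D.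
    move: (r1 ^+ N) (H ^+ m) (cmod (h y) ^+ m) (cmod _); clear => a b c d; nra.
  rewrite -(subrK (h y ^+ m * W) (kap r1 y)) (le_trans (cmodD _ _))//.
  apply: le_trans (lerD (le_trans kW kk2) hW) _; clear; lra.
have kap_p : cmod (kap r2 p) <= 3 / 16 by exact: hp.
have fpm : cmod (f p) < rm by rewrite (lt_trans fp)// r1m; move: dl0; clear; lra.
have [fN fN2] := farb _ hp fpm.
have ne : cmod (f p) != r2 by rewrite lt_eqF// r2m; move: fpm dl0; clear; lra.
have := kapE r2 _ hp (or_intror erefl) ne fN.
rewrite hp1 expr1n mul1r; set W : C := _ / _ => kW.
have cW : 2^-1 <= cmod W.
  rewrite /W cmodM cmodV cr// ler_pdivlMr ?cmod_gt0 ?subr_eq0//.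
  have := cmodB (f p ^+ N) ((r2%:C)%C ^+ N); rewrite cr// [X in _ <= X + _]cmodX.
  have := rN _ r20; move: fN2; move: (r2 ^+ N) (cmod (f p) ^+ N) (cmod _); clear => a b c; lra.
have kk2 : r2 * eta / `|cmod (f p) - r2| <= 16^-1.
  rewrite -etaE ler_wpM2l ?mulr_ge0 ?(ltW r20) ?(ltW eta0)//.
  rewrite lef_pV2 ?posrE ?normr_gt0 ?subr_eq0// ltr0_norm; last by rewrite r2m; move: fpm dl0; clear; lra.
  by rewrite r2m; move: fpm; clear; lra.
have := cmodB (kap r2 p) (kap r2 p - W); rewrite opprB addrC subrK.
apply/negP; rewrite -ltNge; apply: lt_le_trans cW.
apply: le_lt_trans (lerD kap_p (le_trans kW kk2)) _; clear; lra.
Qed.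

End LocalMaximum.

(** * Local maximum principle for polynomials *)

Section Peak.
Variable R : realType.
Local Notation C := (R[i]).
Local Notation env := (nat -> R[i]).
Implicit Types (K : set env) (q f g h : env -> C).

Lemma supported_hull n K : supported n K -> supported n (hull K).
Proof.
move=> sK y hy i ni; apply/eqP; rewrite -cmod_eq0 eq_le cmod_ge0 andbT.
by apply: (hy _ (pol_var R i)) => z Kz; rewrite (sK z Kz i ni) cmod0.
Qed.

(** [hull_shell] is applied to the coordinates y_i - p_i one after the other. Points of [K] are
    carried along in [Km] and drop out at the end, being too far from p in some coordinate. *)
Lemma hull_polydisc K n p (r1 r2 : R) : pol_bounded K -> supported n K ->
  hull K p -> 0 < r1 -> r1 < r2 ->
  (forall y, K y -> exists i, (i < n)%N /\ r2 < cmod (y i - p i : C)) ->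
  hull [set y | [/\ hull K y, forall i, (i < n)%N -> cmod (y i - p i : C) <= r2 &
    exists i, (i < n)%N /\ r1 <= cmod (y i - p i : C)]] p.
Proof.
move=> bK sK hp r10 r12 far.
pose Km m : set env := [set y | [/\ hull K y,
  forall i, (i < m)%N -> cmod (y i - p i : C) <= r2 &
  K y \/ exists i, (i < m)%N /\ r1 <= cmod (y i - p i : C)]].
have pcoord i : pol (fun y : env => y i - p i).
  by apply: pol_sub (pol_var _ _) (pol_cst _).
have KmK m : Km m `<=` hull K by move=> y [].
suff main m : hull (Km m) p.
  apply: hull_mono (main n) => y [hy yr [Ky|ex]]; apply: subset_hull => //.
  have [i [ilt hi]] := far _ Ky.
  by have := lt_le_trans hi (yr i ilt); rewrite ltxx.
elim: m => [|m IH].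
  by apply: hull_mono hp => y Ky; apply: subset_hull; split => //; [exact: subset_hull|left].
have bm : pol_bounded (Km m) := pol_bounded_sub (KmK m) (pol_bounded_hull bK).
have sm : supported n (Km m) by move=> y /KmK; exact: supported_hull.
have fp : cmod (p m - p m : C) < r1 by rewrite subrr cmod0.
apply: hull_mono (hull_shell bm sm (pcoord m) r10 r12 IH fp).
move=> y [[hy /andP[y1 y2]]|[[hy yr or] y2]]; apply: subset_hull; split.
- exact: (hull_mono (KmK m)).
- move=> i; rewrite ltnS leq_eqVlt => /orP[/eqP -> //|im].
  by apply: (hy _ (pcoord i)) => z [_ hz _]; exact: hz.
- by right; exists m.
- by [].
- by move=> i; rewrite ltnS leq_eqVlt => /orP[/eqP -> //|im]; exact: yr.
- case: or => [|[i [im hi]]]; first by left.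
  by right; exists i; split => //; exact: ltnW.
Qed.

(** p lies in the hull of a shell on which Re P <= -d. For small s > 0 the polynomial 1 + s P is
    below 1 in modulus on that shell, but equals 1 at p. *)
Lemma no_local_peak K n p (r c : R) P : pol_bounded K -> supported n K ->
  hull K p -> 0 < r -> 0 < c -> pol P -> P p = 0 ->
  (forall y, K y -> exists i, (i < n)%N /\ r < cmod (y i - p i : C)) ->
  (forall y, hull K y -> (forall i, (i < n)%N -> cmod (y i - p i : C) <= r) ->
    complex.Re (P y) <= - c * \sum_(i < n) cmod (y i - p i : C) ^+ 2) ->
  False.
Proof.
move=> bK sK hp r0 c0 pP Pp far peak.
have r20 : 0 < r / 2 by lra.
have r2r : r / 2 < r by lra.
have := hull_polydisc bK sK hp r20 r2r far; set S := [set y | _] => hS.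
have [M [M0 hM]] := pol_bounded_hull bK pP.
pose d := c * (r / 2) ^+ 2.
have d0 : 0 < d by rewrite mulr_gt0// exprn_gt0.
have Re_le y : S y -> complex.Re (P y) <= - d.
  move=> [hy yr [i [ilt hi]]]; apply: le_trans (peak y hy yr) _.
  rewrite mulNr lerN2 ler_wpM2l ?(ltW c0)// (bigD1 (Ordinal ilt)) //=.
  apply: le_trans (_ : cmod (y i - p i : C) ^+ 2 <= _).
    by rewrite lerXn2r ?nnegrE ?cmod_ge0 ?(ltW r20).
  by rewrite lerDl sumr_ge0// => j _; rewrite exprn_ge0 ?cmod_ge0.
have M1 : 0 < M ^+ 2 + 1 by rewrite ltr_wpDl// exprn_ge0.
(* Makes s^2 |P|^2 at most s d, half of the gain 2 s d in |1 + s P|^2. *)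
pose s := d / (M ^+ 2 + 1).
have s0 : 0 < s by rewrite divr_gt0.
pose be := 1 - s * d.
have be1 : be < 1 by rewrite gtrBl mulr_gt0.
have pq : pol (fun y => 1 + (s%:C)%C * P y).
  by apply: pol_add (pol_cst _) (pol_mul (pol_cst _) pP).
have sbe : Num.sqrt be < 1 by rewrite -[ltRHS]sqrtr1 ltr_sqrt.
suff bd y : S y -> cmod (1 + (s%:C)%C * P y : C) <= Num.sqrt be.
  have := hS _ pq (Num.sqrt be) bd; rewrite Pp mulr0 addr0 cmod1.
  by rewrite leNgt sbe.
move=> Sy.
have [hy _ _] := Sy.
rewrite -[leLHS]ger0_norm ?cmod_ge0// -sqrtr_sqr ler_wsqrtr//.
have E : cmod (1 + (s%:C)%C * P y : C) ^+ 2 =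
    1 + 2 * s * complex.Re (P y) + s ^+ 2 * cmod (P y) ^+ 2.
  by rewrite !cmod_sqr; case: (P y) => a b /=; ring.
rewrite E /be; have := Re_le _ Sy.
have : s ^+ 2 * cmod (P y) ^+ 2 <= s * d.
  rewrite {1}/s expr2 -mulrA ler_wpM2l ?(ltW s0)//.
  rewrite mulrAC ler_pdivrMr// ler_wpM2l ?(ltW d0)//.
  apply: le_trans (_ : M ^+ 2 <= _); last by rewrite lerDl.
  by rewrite lerXn2r ?nnegrE ?cmod_ge0//; exact: hM.
move: (cmod (P y) ^+ 2) (complex.Re (P y)) => a b h1 h2.
have : s * b <= s * - d by rewrite ler_wpM2l ?(ltW s0).
move: h1; have -> : 1 + 2 * s * b + s ^+ 2 * a = 1 + 2 * (s * b) + s ^+ 2 * a by ring.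
by rewrite mulrN; move: (s ^+ 2 * a) (s * b) (s * d); clear => x z w h1 h2; lra.
Qed.
End Peak.

(** * Upper semicontinuous functions and their integrals *)

Section Semicontinuous.
Variable R : realType.
Local Notation mu := (@lebesgue_measure R).

Definition usc1 (g : R -> R) := forall s c, g s < c ->
  exists2 d, 0 < d & forall t, `|t - s| < d -> g t < c.

Definition usc2 (g : R -> R -> R) := forall s t c, g s t < c ->
  exists2 d, 0 < d & forall s' t', `|s' - s| < d -> `|t' - t| < d -> g s' t' < c.

Lemma usc1_measurable (D : set R) (g : R -> R) : usc1 g -> measurable_fun D (EFin \o g).
Proof.
move=> ug; apply: measurable_funTS.
have -> : EFin \o g = (fun x => - (- g x)%:E)%E by apply/funext => x; rewrite EFinN oppeK.
apply: measurableT_comp => //; apply: lower_semicontinuous_measurable.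
move=> x a; rewrite lte_fin ltrNr => /ug[d d0 h]; exists (ball x d); first exact: nbhsx_ballx.
by move=> y; rewrite /ball/= distrC => /h; rewrite lte_fin ltrNr.
Qed.

(** A strict sublevel set is the union of the boxes with rational centre and radius 1/(k+1) that it
    contains, a countable family. *)
Lemma usc2_measurable g :
  usc2 g -> measurable_fun setT (fun st : R * R => (g st.1 st.2)%:E).
Proof.
move=> ug; apply/measurable_EFinP.
apply: (measurability _ (RGenInftyO.measurableE R)) => _ [_ [c ->] <-].
rewrite setTI.
pose box (abk : rat * rat * nat) : set (R * R) :=
  ball (ratr abk.1.1 : R) (abk.2.+1%:R^-1) `*` ball (ratr abk.1.2 : R) (abk.2.+1%:R^-1).
pose P abk := forall st, box abk st -> g st.1 st.2 < c.
have -> : (fun st : R * R => g st.1 st.2) @^-1` [set` `]-oo, c[] =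
    \bigcup_(abk in P) box abk.
  apply/seteqP; split => [[s t]|st [abk Pabk /Pabk]]; last by rewrite /= in_itv.
  rewrite /= in_itv /= => /ug[d d0 h].
  have [k hk] : exists k : nat, k.+1%:R^-1 < d / 2.
    have d20 : 0 < d / 2 by lra.
    exists (Num.truncn (d / 2)^-1); rewrite invf_plt ?posrE ?ltr0n//.
    exact: truncnS_gt.
  have kp : 0 < (k.+1%:R^-1 : R) by rewrite invr_gt0 ltr0n.
  pose e : R := k.+1%:R^-1; have eE : k.+1%:R^-1 = e by [].
  rewrite eE in kp hk; clearbody e.
  have [a /andP[a1 a2]] : exists a : rat, s - e < ratr a < s + e.
    have : s - e < s + e by lra.
    by move=> /rat_in_itvoo[q]; rewrite in_itv /= => ?; exists q.
  have [b /andP[b1 b2]] : exists b : rat, t - e < ratr b < t + e.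
    have : t - e < t + e by lra.
    by move=> /rat_in_itvoo[q]; rewrite in_itv /= => ?; exists q.
  exists (a, b, k); last first.
    by split; rewrite /ball /= eE ltr_norml; apply/andP; split; lra.
  move=> [s' t'] [/=]; rewrite /ball /= eE !ltr_norml => /andP[h1 h2] /andP[h3 h4].
  by apply: h; rewrite ltr_norml; apply/andP; split; lra.
rewrite bigcup_mkcond; apply: countable_bigcupT_measurable; first exact: countableP.
by move=> abk; case: ifP => _ //; apply: measurableX; exact: measurable_ball.
Qed.

Lemma usc2_r g s : usc2 g -> usc1 (g s).
Proof.
move=> ug t c /ug[d d0 h]; exists d => // s' hs; apply: h => //.
by rewrite subrr normr0.
Qed.

Lemma usc2_fubini g (A B : set R) : measurable A -> measurable B ->
  usc2 g -> (forall s t, 0 <= g s t) ->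
  (\int[mu]_(s in A) \int[mu]_(t in B) (g s t)%:E =
   \int[mu]_(t in B) \int[mu]_(s in A) (g s t)%:E)%E.
Proof.
move=> mA mB ug g0.
pose f := ((fun st : R * R => (g st.1 st.2)%:E) \_ (A `*` B)).
have mf : measurable_fun setT f.
  apply: (measurable_restrictT _ _).1; first exact: measurableX.
  by apply: measurable_funTS; exact: usc2_measurable.
have f0 st : (0 <= f st)%E by rewrite /f; apply: erestrict_ge0 => x _; rewrite lee_fin.
have fE s t : f (s, t) = if (s \in A) && (t \in B) then (g s t)%:E else 0%E.
  rewrite /f /patch; case: ifPn => [|/negP sAB].
    by rewrite inE => -[/= As Bt]; rewrite !mem_set.
  case: ifP => // /andP[]; rewrite !inE => As Bt; exfalso; apply: sAB.
  by rewrite inE; split.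
have := @fubini_tonelli _ _ _ _ R mu mu f mf f0.
have e1 : (\int[mu]_s \int[mu]_t f (s, t) = \int[mu]_(s in A) \int[mu]_(t in B) (g s t)%:E)%E.
  rewrite [RHS]integral_mkcond; apply: eq_integral => s _.
  rewrite /patch; case: ifP => sA.
    by rewrite [RHS]integral_mkcond; apply: eq_integral => t _; rewrite fE sA /patch.
  by rewrite integral0_eq// => t _; rewrite fE sA.
have e2 : (\int[mu]_t \int[mu]_s f (s, t) = \int[mu]_(t in B) \int[mu]_(s in A) (g s t)%:E)%E.
  rewrite [RHS]integral_mkcond; apply: eq_integral => t _.
  rewrite /patch; case: ifP => tB.
    by rewrite [RHS]integral_mkcond; apply: eq_integral => s _; rewrite fE tB andbT /patch.
  by rewrite integral0_eq// => s _; rewrite fE tB andbF.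
by rewrite e1 e2.
Qed.

Lemma integral_shift g (a b t : R) : usc1 g -> (forall s, 0 <= g s) ->
  (\int[mu]_(s in `]a, b]) (g (s + t)%R)%:E = \int[mu]_(s in `](a + t)%R, (b + t)%R]) (g s)%:E)%E.
Proof.
move=> ug g0; pose phi (s : measurableTypeR R) : measurableTypeR R := s + t.
have mphi : measurable_fun setT phi.
  by apply: continuous_measurable_fun => x; apply: cvgD; [exact: cvg_id|exact: cvg_cst].
have := @ge0_integral_pushforward _ _ _ _ R phi mphi mu `](a + t), (b + t)] (EFin \o g)
  (measurable_itv _) (usc1_measurable ug).
have pre : phi @^-1` [set` `](a + t), (b + t)]] = [set` `]a, b]].
  by apply/seteqP; split => x /=; rewrite !in_itv /= /phi ltrD2r lerD2r.
rewrite pre /= => <-; last by move=> y _; rewrite lee_fin.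
apply: eq_measure_integral => A mA _.
rewrite -[LHS]/(pushforward mu phi A).
apply/esym; apply: lebesgue_measure_unique => // X [[c d] _ <-] /=.
rewrite /pushforward.
have -> : phi @^-1` [set` `]c, d]] = [set` `](c - t), (d - t)]].
  by apply/seteqP; split => x /=; rewrite !in_itv /= /phi ltrBlDr lerBrDr.
by rewrite !lebesgue_measure_itv /= !lte_fin ltrD2r; case: ifP => // _; rewrite -!EFinB; congr EFin; ring.
Qed.

Lemma integral_itv_split g (a b c : R) : usc1 g -> (forall s, 0 <= g s) ->
  a <= b -> b <= c ->
  (\int[mu]_(s in `]a, c]) (g s)%:E =
   \int[mu]_(s in `]a, b]) (g s)%:E + \int[mu]_(s in `]b, c]) (g s)%:E)%E.
Proof.
move=> ug g0 ab bc.
have -> : `]a, c]%classic = `]a, b]%classic `|` `]b, c]%classic :> set R.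
  apply/seteqP; split => x /=; rewrite !in_itv /=.
    by move=> /andP[h1 h2]; have [xb|xb] := leP x b; [left; rewrite h1|right].
  by case=> /andP[h1 h2]; apply/andP; split => //; [exact: le_trans bc|exact: le_lt_trans h1].
rewrite ge0_integral_setU//; first exact: usc1_measurable.
  by move=> x _; rewrite lee_fin.
apply/disj_setPS => x /= [] ; rewrite !in_itv /= => /andP[_ h1] /andP[h2 _].
by have := lt_le_trans h2 h1; rewrite ltxx.
Qed.

End Semicontinuous.

(** * Averages over the unit interval and their dependence on parameters *)

Section Average.
Variable R : realType.
Local Notation mu := (@lebesgue_measure R).
Local Notation I01 := [set` (`]0%R, 1%R] : interval R)].

Definition avg (g : R -> R) : R := fine (\int[mu]_(s in I01) (g s)%:E)%E.

Lemma integral_I01_cst (r : R) : (\int[mu]_(s in I01) r%:E = r%:E)%E.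
Proof.
rewrite (integral_cst mu (measurable_itv _) r%:E) /=.
by rewrite lebesgue_measure_itv/= lte_fin ltr01 oppr0 adde0 mule1.
Qed.

Section Parametric.
(** [nb d x y] reads: y is within d of x. It is used for pairs of an angle and a sequence, the
    latter compared uniformly in all coordinates. *)
Variables (E : Type) (nb : R -> E -> E -> Prop).
Hypothesis nbxx : forall (d : R) x, 0 < d -> nb d x x.
Hypothesis nbW : forall d d' x y, d <= d' -> nb d x y -> nb d' x y.

Definition uscE (f : E -> R) := forall x c, f x < c ->
  exists2 d, 0 < d & forall y, nb d x y -> f y < c.

Definition uscER (phi : E -> R -> R) := forall x s c, phi x s < c ->
  exists2 d, 0 < d & forall y t, nb d x y -> `|t - s| < d -> phi y t < c.

Lemma uscER_r phi x : uscER phi -> usc1 (phi x).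
Proof.
move=> up s c /up[d d0 h]; exists d => // t; apply: h; exact: nbxx.
Qed.

Lemma uscER_bounded phi x : uscER phi -> exists B d, 0 < d /\
  forall y s, nb d x y -> 0 <= s <= 1 -> phi y s <= B.
Proof.
move=> up; have /compact_near_coveringP cov := @segment_compact R 0 1.
have := cov R (0^'+) (fun e s => forall y, nb e x y -> phi y s <= e^-1) _ _.
case.
  move=> s _; have [d d0 h] := up x s (phi x s + 1) (ltac:(lra)).
  pose e0 := Num.min d (`|phi x s + 1| + 1)^-1.
  have e00 : 0 < e0 by rewrite lt_min d0 invr_gt0 ltr_wpDl.
  exists (ball s d, [set e | 0 < e /\ e < e0]).
    split => /=; first exact: nbhsx_ballx.
    by near=> e; split; near: e; [exact: nbhs_right_gt|exact: nbhs_right_lt].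
  move=> [t e] /= [bt [e1 e2]] y ny.
  have ed : e <= d by rewrite ltW// (lt_le_trans e2)// ge_min lexx.
  have yt : phi y t < phi x s + 1.
    by apply: h; [exact: nbW ny|rewrite distrC].
  apply/ltW/(lt_le_trans yt); rewrite -[leLHS]invrK.
  apply: le_trans (_ : `|phi x s + 1| + 1 <= _).
    by rewrite invrK (le_trans (ler_norm _))// lerDl.
  rewrite -[leLHS]invrK lef_pV2 ?posrE ?invr_gt0 ?ltr_wpDl//.
  by rewrite ltW// (lt_le_trans e2)// ge_min lexx orbT.
move=> d /= d0 hd; exists (d / 2)^-1, (d / 2).
have d20 : 0 < d / 2 by lra.
split => // y s ny s01; apply: (hd (d / 2)) => //=.
by rewrite /ball /= sub0r normrN ger0_norm ?ltW// ltr_pdivrMr// ltr_pMr// ltr1n.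
Unshelve. all: by end_near. Qed.

Lemma integral_avgE phi x : uscER phi -> (forall y s, 0 <= phi y s) ->
  (\int[mu]_(s in I01) (phi x s)%:E = (avg (phi x))%:E)%E.
Proof.
move=> up p0; rewrite /avg fineK// ge0_fin_numE; last first.
  by apply: integral_ge0 => s _; rewrite lee_fin.
have [B [d [d0 h]]] := uscER_bounded x up.
apply: le_lt_trans (ltry B); rewrite -integral_I01_cst.
apply: ge0_le_integral => //.
- by move=> s _; rewrite lee_fin.
- apply: usc1_measurable; exact: uscER_r.
- move=> s; rewrite /= in_itv /= lee_fin => /andP[s0 s1]; apply: h; first exact: nbxx.
  by rewrite ltW.
Qed.

(** Otherwise the averages are at least c at points y_k tending to x. By semicontinuity max(phi y_k,
    phi x) tends to phi x, and dominated convergence gives c <= avg (phi x). *)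
Lemma usc_avg phi : uscER phi -> (forall y s, 0 <= phi y s) ->
  uscE (fun x => avg (phi x)).
Proof.
move=> up p0 x c hc; apply: contrapT => H.
have [B [d [d0 hB]]] := uscER_bounded x up.
have kp (k0 k : nat) : 0 < (k0.+1%:R + k%:R : R) by rewrite ltr_pwDl ?ltr0n ?ler0n.
have [k0 hk0] : exists k0 : nat, forall k, (k0.+1%:R + k%:R : R)^-1 < d.
  exists (Num.truncn d^-1) => k; rewrite invf_plt ?posrE//.
  by apply: lt_le_trans (truncnS_gt _) _; rewrite lerDl ler0n.
pose dk (k : nat) : R := (k0.+1%:R + k%:R)^-1.
have dk0 k : 0 < dk k by rewrite invr_gt0.
have /choice[y hy] : forall k, exists y, nb (dk k) x y /\ c <= avg (phi y).
  move=> k; apply: contrapT => H'; apply: H; exists (dk k) => // y ny.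
  by rewrite ltNge; apply/negP => cy; apply: H'; exists y.
have mp z : measurable_fun I01 (EFin \o phi z) by apply: usc1_measurable; exact: uscER_r.
pose f k s := (Num.max (phi (y k) s) (phi x s))%:E.
have mf k : measurable_fun I01 (f k).
  apply/measurable_EFinP; apply: measurable_maxr; apply/measurable_EFinP; exact: mp.
have cv s : I01 s -> f^~ s @ \oo --> (phi x s)%:E.
  move=> Is; apply/fine_cvgP; split; first exact: nearW.
  apply/cvgrPdist_lt => /= e e0.
  have [d1 d10 h1] := up x s (phi x s + e) (ltac:(lra)).
  have [n0 hn0] : exists n0 : nat, (n0%:R : R)^-1 < d1 /\ (0 < n0)%N.
    exists (Num.truncn d1^-1).+1; split => //.
    by rewrite invf_plt ?posrE ?ltr0n// truncnS_gt.
  exists n0 => // k /= nk; have [ny _] := hy k.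
  have ny1 : nb d1 x (y k).
    apply: nbW ny; apply/ltW; apply: le_lt_trans hn0.1; rewrite lef_pV2 ?posrE ?ltr0n ?hn0.2//.
    by apply: le_trans (_ : k%:R <= _); rewrite ?ler_nat// lerDr ler0n.
  have := h1 (y k) s ny1; rewrite subrr normr0 => /(_ d10) hlt.
  rewrite ltr_norml; case: (leP (phi (y k) s) (phi x s)) => h2; apply/andP; split; lra.
have iB : mu.-integrable I01 (cst B%:E).
  apply/integrableP; split => //.
  rewrite (_ : (fun s => _) = cst `|B|%:E)//.
  by rewrite integral_I01_cst ltry.
have := @dominated_convergence _ _ R mu I01 (measurable_itv _) f (EFin \o phi x) (cst B%:E) mf (mp x) _ iB _.
case.
- by apply: aeW => s Is; exact: cv.
- apply: aeW => s k Is /=; have [ny _] := hy k.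
  have s01 : 0 <= s <= 1 by move: Is; rewrite /= in_itv /= => /andP[/ltW -> ->].
  have b1 : phi (y k) s <= B by apply: hB => //; apply: nbW ny; exact/ltW/hk0.
  have b2 : phi x s <= B by apply: hB => //; exact: nbxx.
  by rewrite lee_fin ger0_norm ?ge_max ?b1// le_max p0.
move=> _ _ lim; suff : (c%:E <= \int[mu]_(s in I01) (phi x s)%:E)%E.
  by rewrite integral_avgE// lee_fin leNgt hc.
rewrite -(cvg_lim _ lim)//; apply: lime_ge; first by apply/cvg_ex; eexists; exact: lim.
apply: nearW => k; have [_ ck] := hy k.
apply: le_trans (_ : \int[mu]_(s in I01) (phi (y k) s)%:E <= _)%E.
  by rewrite integral_avgE// lee_fin.
apply: ge0_le_integral => //.
- by move=> s _; rewrite lee_fin.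
- exact: (mp (y k)).
- exact: (mf k).
- by move=> s _; rewrite lee_fin le_max lexx.
Qed.

End Parametric.

Lemma avg_ge0 g : (forall s, 0 <= g s) -> 0 <= avg g.
Proof. by move=> g0; apply: fine_ge0; apply: integral_ge0 => s _; rewrite lee_fin. Qed.

Lemma avgE g : usc1 g -> (forall s, 0 <= g s) ->
  (\int[mu]_(s in I01) (g s)%:E = (avg g)%:E)%E.
Proof.
move=> ug g0; apply: (@integral_avgE unit (fun _ _ _ => True) _ _ (fun _ => g) tt) => //.
by move=> x s c /ug[d d0 h]; exists d => // _ t _; exact: h.
Qed.

Lemma avg_le g B : usc1 g -> (forall s, 0 <= g s) ->
  (forall s, 0 < s <= 1 -> g s <= B) -> avg g <= B.
Proof.
move=> ug g0 gB; rewrite -lee_fin -avgE// -integral_I01_cst.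
apply: ge0_le_integral => //.
- by move=> s _; rewrite lee_fin.
- exact: usc1_measurable.
Qed.

Lemma avg_ge g B : usc1 g -> (forall s, 0 <= g s) ->
  (forall s, 0 < s <= 1 -> B <= g s) -> B <= avg g.
Proof.
move=> ug g0 gB; have [B0|/ltW B0] := leP B 0; first exact: le_trans (avg_ge0 g0).
rewrite -lee_fin -avgE// -integral_I01_cst.
apply: ge0_le_integral => //.
exact: usc1_measurable.
Qed.

(* Since the integral over a period telescopes, only the difference of the
   values of [g] at distance 1 matters. *)
Lemma avg_increment g (t t' c eta : R) : usc1 g -> (forall s, 0 <= g s) -> t <= t' ->
  (forall s, t <= s <= t' -> `|g (s + 1) - g s - c| <= eta) ->
  `|avg (fun s => g (s + t')) - avg (fun s => g (s + t)) - c * (t' - t)| <= eta * (t' - t).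
Proof.
move=> ug g0 tt' hg.
have ugs r : usc1 (fun s => g (s + r)).
  move=> s e /ug[d d0 h]; exists d => // s' hs; apply: h.
  by rewrite opprD addrACA subrr addr0.
have E r : (\int[mu]_(s in `]r, (r + 1)%R]) (g s)%:E = (avg (fun s => g (s + r)))%:E)%E.
  rewrite -avgE; [|exact: ugs|by []].
  by rewrite integral_shift// add0r addrC.
have t1 : t <= t + 1 by lra.
have tt1 : t + 1 <= t' + 1 by lra.
have t't1 : t' <= t' + 1 by lra.
have D := integral_itv_split ug g0 t1 tt1.
have := integral_itv_split ug g0 tt' t't1; rewrite D !E => /esym.
have -> : (\int[mu]_(s in `](t + 1)%R, (t' + 1)%R]) (g s)%:E =
    \int[mu]_(s in `]t, t']) (g (s + 1)%R)%:E)%E by rewrite -integral_shift.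
set P := (\int[mu]_(s in `]t, t']) (g s)%:E)%E.
set Q := (\int[mu]_(s in `]t, t']) (g (s + 1)%R)%:E)%E => eq.
pose l := t' - t.
have ml : mu [set` `]t, t']] = l%:E.
  rewrite lebesgue_measure_itv/= lte_fin; case: ltP => [_|tt]; first by rewrite -EFinB.
  by rewrite /l; congr EFin; apply/esym/eqP; rewrite subr_eq0 eq_le tt tt'.
have ic (r : R) : (\int[mu]_(s in `]t, t']) r%:E = (r * l)%:E)%E.
  by rewrite (integral_cst mu (measurable_itv _) r%:E) /= ml -EFinM.
have mg r : measurable_fun [set` `]t, t']] (fun s : R => (g (s + r))%:E).
  by have := @usc1_measurable R [set` `]t, t']] _ (ugs r).
have mg0 : measurable_fun [set` `]t, t']] (fun s : R => (g s)%:E).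
  by have := @usc1_measurable R [set` `]t, t']] _ ug.
(* Added on both sides so that all integrands compared below are nonnegative. *)
pose K := `|c| + `|eta|.
have K0 : 0 <= K by rewrite addr_ge0.
have [c1 c2] : - `|c| <= c /\ c <= `|c|.
  by split; [rewrite lerNl -normrN ler_norm|exact: ler_norm].
have [n1 n2] : - `|eta| <= eta /\ eta <= `|eta|.
  by split; [rewrite lerNl -normrN ler_norm|exact: ler_norm].
have madd (h : R -> R) (r : R) : measurable_fun [set` `]t, t']] (fun s : R => (h s)%:E) ->
    measurable_fun [set` `]t, t']] (fun s : R => (h s + r)%:E).
  move=> mh; have -> : (fun s : R => (h s + r)%:E) = (fun s : R => (h s)%:E + r%:E)%E.
    by apply/funext => s; rewrite EFinD.
  exact: emeasurable_funD.
have addc (h : R -> R) (r : R) :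
    measurable_fun [set` `]t, t']] (fun s : R => (h s)%:E) ->
    (forall s, 0 <= h s) -> 0 <= r ->
    (\int[mu]_(s in `]t, t']) (h s)%:E + (r * l)%:E = \int[mu]_(s in `]t, t']) (h s + r)%:E)%E.
  move=> mh h0 r0; rewrite -ic -ge0_integralD//.
  by move=> s _; rewrite lee_fin.
have mg1 := mg 1.
have U : (Q + (K * l)%:E <= P + ((c + eta + K) * l)%:E)%E.
  rewrite !addc//; last by rewrite /K; lra.
  apply: ge0_le_integral => //.
  - by move=> s _; rewrite lee_fin addr_ge0.
  - exact: (madd _ _ mg1).
  - exact: (madd _ _ mg0).
  - move=> s; rewrite /= in_itv /= => /andP[s0 s1]; rewrite lee_fin.
    have := hg s; rewrite (ltW s0) s1 => /(_ isT); rewrite ler_norml => /andP[h1 h2]; lra.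
have Lw : (P + ((c - eta + K) * l)%:E <= Q + (K * l)%:E)%E.
  have K' : 0 <= c - eta + K by rewrite /K; lra.
  rewrite !addc//; apply: ge0_le_integral => //.
  - by move=> s _; rewrite lee_fin addr_ge0.
  - exact: (madd _ _ mg0).
  - exact: (madd _ _ mg1).
  - move=> s; rewrite /= in_itv /= => /andP[s0 s1]; rewrite lee_fin.
    have := hg s; rewrite (ltW s0) s1 => /(_ isT); rewrite ler_norml => /andP[h1 h2]; lra.
move: eq U Lw.
have P0 : (0 <= P)%E by apply: integral_ge0 => s _; rewrite lee_fin.
have Q0 : (0 <= Q)%E by apply: integral_ge0 => s _; rewrite lee_fin.
have Pfin : (P < +oo)%E.
  have ur : usc1 (fun r => g (t + r * l)).
    move=> r e /ug[d d0 h]; have l1 : 0 < l + 1 by rewrite /l; lra.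
    exists (d / (l + 1)); first by rewrite divr_gt0.
    move=> r' hr; apply: h; rewrite opprD addrACA subrr add0r -mulrBl normrM.
    rewrite (ger0_norm (_ : 0 <= l)); last by rewrite /l; lra.
    move: hr; rewrite ltr_pdivlMr// => hr; apply: le_lt_trans hr.
    by rewrite ler_wpM2l// lerDl ler01.
  have [] := @uscER_bounded unit (fun _ _ _ => True) (fun _ _ _ _ _ _ => I) (fun _ => (fun r => g (t + r * l))) tt.
    by move=> x s c' /ur[d d0 h]; exists d => // _ r _; exact: h.
  move=> B [_ [_ hB]]; apply: le_lt_trans (ltry (B * l)); rewrite -ic.
  apply: ge0_le_integral => //; first by move=> s _; rewrite lee_fin.
  move=> s; rewrite /= in_itv /= lee_fin => /andP[s0 s1].
  have l0 : 0 < l by rewrite /l; lra.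
  have := hB tt ((s - t) / l) I; rewrite divfK ?gt_eqF// subrKC; apply.
  by rewrite divr_ge0 ?ler_pdivrMr ?(ltW l0)//= /l; lra.
set a := avg _; set a' := avg _.
clearbody P Q.
case: P P0 Pfin => [p| |] // _ _; case: Q Q0 => [q| |] // _.
rewrite -!EFinD !lee_fin => -[] eq U Lw.
rewrite ler_norml -/l; apply/andP; split; nra.
Qed.

End Average.

(** * Smoothing by averages along the real coordinates *)

Section Smoothing.
Variables (R : realType).
Local Notation mu := (@lebesgue_measure R).
Local Notation X := (nat -> R).
Local Notation I01 := [set` (`]0%R, 1%R] : interval R)].
Local Notation I2pi := [set` (`[0%R, (2 * pi)%R] : interval R)].
Implicit Types (x y z : X) (f : X -> R) (a b : nat) (L : seq nat).

Definition nbX (d : R) x y := forall k, `|y k - x k| < d.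

Lemma nbXxx d x : 0 < d -> nbX d x x.
Proof. by move=> d0 k; rewrite subrr normr0. Qed.

Lemma nbXW d d' x y : d <= d' -> nbX d x y -> nbX d' x y.
Proof. by move=> dd' h k; apply: lt_le_trans (h k) dd'. Qed.

Definition uscX f := forall x c, f x < c ->
  exists2 d, 0 < d & forall y, nbX d x y -> f y < c.

Definition usc3 (g : R -> X -> R) := forall th x c, g th x < c ->
  exists2 d, 0 < d & forall th' y, `|th' - th| < d -> nbX d x y -> g th' y < c.

Definition shiftX a x (s : R) : X := fun k => x k + (k == a)%:R * s.

Lemma shiftXD a x s t : shiftX a (shiftX a x s) t = shiftX a x (s + t).
Proof. by apply/funext => k; rewrite /shiftX; ring. Qed.

Lemma shiftXC a b x s t : shiftX a (shiftX b x s) t = shiftX b (shiftX a x t) s.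
Proof. by apply/funext => k; rewrite /shiftX; ring. Qed.

Lemma shiftX0 a x : shiftX a x 0 = x.
Proof. by apply/funext => k; rewrite /shiftX; ring. Qed.

Lemma nbX_shift a x y (s t d : R) : nbX (d / 2) x y ->
  `|t - s| < d / 2 -> nbX d (shiftX a x s) (shiftX a y t).
Proof.
move=> xy ts k; rewrite /shiftX.
have -> : y k + (k == a)%:R * t - (x k + (k == a)%:R * s) =
  (y k - x k) + (k == a)%:R * (t - s) by ring.
apply: le_lt_trans (ler_normD _ _) _; have := xy k.
have : `|(k == a)%:R * (t - s)| <= `|t - s|.
  by case: (k == a); rewrite ?mul1r// mul0r normr0.
by move: ts; lra.
Qed.

Lemma usc3_shift g a : usc3 g ->
  @uscER R (R * X) (fun d p q => `|q.1 - p.1| < d /\ nbX d p.2 q.2)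
    (fun p s => g p.1 (shiftX a p.2 s)).
Proof.
move=> ug [th w] s c /ug[d d0 h] /=; exists (d / 2); first by lra.
move=> [th' w'] t /= [h1 h2] h3; apply: h; first by move: h1; lra.
exact: nbX_shift.
Qed.

Definition smear a f x : R := avg (fun s => f (shiftX a x s)).

Lemma usc3_smear g a : usc3 g -> (forall th x, 0 <= g th x) ->
  usc3 (fun th => smear a (g th)).
Proof.
move=> ug g0 th w c hc.
have [||d d0 h] := @usc_avg R (R * X) (fun d p q => `|q.1 - p.1| < d /\ nbX d p.2 q.2)
  _ _ _ (@usc3_shift g a ug) (fun _ _ => g0 _ _) (th, w) c hc.
- by move=> d [x1 x2] d0; rewrite subrr normr0; split => //; exact: nbXxx.
- by move=> d d' x y dd' [h1 h2]; split; [exact: lt_le_trans dd'|exact: nbXW h2].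
by exists d => // th' w' h1 h2; exact: (h (th', w') (conj h1 h2)).
Qed.

Lemma smear_ge0 a f x : (forall y, 0 <= f y) -> 0 <= smear a f x.
Proof. by move=> f0; apply: avg_ge0. Qed.

Lemma uscX_usc3 f : uscX f -> usc3 (fun=> f).
Proof. by move=> uf th w c /uf[d d0 h]; exists d => // th' w' _; exact: h. Qed.

Lemma uscX_smear a f : uscX f -> (forall y, 0 <= f y) -> uscX (smear a f).
Proof.
move=> uf f0 w c hc; have [d d0 h] := @usc3_smear (fun=> f) a (uscX_usc3 uf) (fun _ => f0) 0 w c hc.
by exists d => // w' hw; apply: (h 0) => //; rewrite subrr normr0.
Qed.

Lemma usc3_usc2 g a x : usc3 g -> usc2 (fun th s => g th (shiftX a x s)).
Proof.
move=> /(@usc3_shift g a) ug th s c hc; have [d d0 h] := ug (th, x) s c hc.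
exists d => // th' s' h1 h2; exact: (h (th', x) s' (conj h1 (nbXxx x d0)) h2).
Qed.

Lemma uscX_shift f a x : uscX f -> usc1 (fun s => f (shiftX a x s)).
Proof.
by move=> uf; apply: (@usc2_r R (fun _ s => f (shiftX a x s)) 0); exact: (@usc3_usc2 (fun=> f) a x (uscX_usc3 uf)).
Qed.

Lemma usc3_fix g th : usc3 g -> uscX (g th).
Proof.
move=> ug w c /ug[d d0 h]; exists d => // w'; apply: h.
by rewrite subrr normr0.
Qed.

Lemma usc3_swap g x : usc3 g -> usc1 (fun th => g th x).
Proof.
move=> ug th c /ug[d d0 h]; exists d => // th' h1; apply: h => //; exact: nbXxx.
Qed.

Lemma smearE a f x : uscX f -> (forall y, 0 <= f y) ->
  (\int[mu]_(s in I01) (f (shiftX a x s))%:E = (smear a f x)%:E)%E.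
Proof. by move=> uf f0; apply: avgE => //; exact: uscX_shift. Qed.

Lemma smear_comm a b f : uscX f -> (forall y, 0 <= f y) -> smear a (smear b f) = smear b (smear a f).
Proof.
move=> uf f0; apply/funext => x; apply: EFin_inj.
have uT c : uscX (smear c f) by exact: uscX_smear.
have T0 c y : 0 <= smear c f y by exact: smear_ge0.
have E c d : ((smear c (smear d f) x)%:E =
    \int[mu]_(s in I01) \int[mu]_(t in I01) (f (shiftX d (shiftX c x s) t))%:E)%E.
  rewrite -(smearE c x (uT d) (T0 d)).
  by apply: eq_integral => s _; rewrite -smearE.
have u3 : usc3 (fun th y => f (shiftX a y th)).
  move=> th w e he.
  have [d d0 h] := @usc3_shift (fun=> f) a (uscX_usc3 uf) (0, w) th e he.
  exists d; first exact: d0.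
  move=> th' w' h1 h2; apply: (h (0, w') th'); last exact: h1.
  by split; [rewrite subrr normr0|exact: h2].
have u2 : usc2 (fun s t => f (shiftX b (shiftX a x s) t)).
  have := @usc3_usc2 _ b x u3.
  by congr usc2; apply/funext => s; apply/funext => t; rewrite shiftXC.
apply: etrans (E a b) (etrans _ (esym (E b a))).
rewrite (usc2_fubini (measurable_itv _) (measurable_itv _) u2 (fun _ _ => f0 _)).
by apply: eq_integral => s _; apply: eq_integral => t _; rewrite shiftXC.
Qed.

Definition smears L f := foldr smear f L.

Lemma smears_ge0 L f x : (forall y, 0 <= f y) -> 0 <= smears L f x.
Proof. by move=> f0; elim: L x => //= v L IH z; apply: smear_ge0. Qed.

Lemma uscX_smears L f : uscX f -> (forall y, 0 <= f y) -> uscX (smears L f).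
Proof.
by move=> uf f0; elim: L => //= v L IH; apply: uscX_smear => // w; exact: smears_ge0.
Qed.

Lemma usc3_smears L g : usc3 g -> (forall th x, 0 <= g th x) ->
  usc3 (fun th => smears L (g th)).
Proof.
by move=> ug g0; elim: L => //= v L IH; apply: usc3_smear => // th w; exact: smears_ge0.
Qed.

(** Averages commute, so any direction of the list can be made the outermost one; a partial
    derivative in that direction is then a difference of the inner function. *)
Lemma smears_rem L a f : uscX f -> (forall y, 0 <= f y) -> a \in L ->
  smears L f = smear a (smears (rem a L) f).
Proof.
move=> uf f0; elim: L => // b L IH; rewrite in_cons /= => /orP[/eqP <-|aL].
  by rewrite eqxx.
case: (eqVneq b a) => [-> //|_] /=.
by rewrite (IH aL) (smear_comm b a (@uscX_smears (rem a L) f uf f0) (fun y => smears_ge0 _ y f0)).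
Qed.

Lemma smear_le a f x B : uscX f -> (forall y, 0 <= f y) ->
  (forall s, 0 < s <= 1 -> f (shiftX a x s) <= B) -> smear a f x <= B.
Proof. by move=> uf f0 fB; apply: avg_le => //; exact: uscX_shift. Qed.

Lemma smear_ge a f x B : uscX f -> (forall y, 0 <= f y) ->
  (forall s, 0 < s <= 1 -> B <= f (shiftX a x s)) -> B <= smear a f x.
Proof. by move=> uf f0 fB; apply: avg_ge => //; exact: uscX_shift. Qed.

Lemma smear_increment a f x (t t' c eta : R) : uscX f -> (forall y, 0 <= f y) -> t <= t' ->
  (forall s, t <= s <= t' -> `|f (shiftX a x (s + 1)) - f (shiftX a x s) - c| <= eta) ->
  `|smear a f (shiftX a x t') - smear a f (shiftX a x t) - c * (t' - t)| <= eta * (t' - t).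
Proof.
move=> uf f0 tt' h.
have := avg_increment (@uscX_shift _ a x uf) (fun s => f0 _) tt' h.
have E r : avg (fun s => f (shiftX a x (s + r))) = smear a f (shiftX a x r).
  by congr avg; apply/funext => s; rewrite shiftXD addrC.
by rewrite !E.
Qed.

(* The real coordinates [0, 1, 2, 3, ...] are the real and imaginary parts of
   the complex ones. *)
Definition dir k : R[i] := if odd k then 'i%C else 1.

Definition rc (w : nat -> R[i]) : X := fun k => complex.Re (conjc (dir k) * w k./2).

Definition addX x y : X := fun k => x k + y k.

Definition turn th (w : nat -> R[i]) : nat -> R[i] := fun k => cis th * w k.

Definition bounded_env (w : nat -> R[i]) := exists B, forall k, cmod (w k) <= B.

(** Boundedness of w makes the circle traced by [turn th w] continuous for the uniform distance,
    hence the integrand semicontinuous in the angle. *)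
Definition subm f := forall x w, bounded_env w -> ((2 * pi * f x)%:E <=
  \int[mu]_(th in I2pi) (f (addX x (rc (turn th w))))%:E)%E.

Lemma cis_continuous th (e : R) : 0 < e ->
  exists2 d, 0 < d & forall th', `|th' - th| < d -> cmod (cis th' - cis th : R[i]) < e.
Proof.
move=> e0; have e20 : 0 < e / 2 by lra.
have /cvgrPdist_lt /(_ _ e20) /nbhs_ballP [d1 /= d10 h1] := @continuous_cos R th.
have /cvgrPdist_lt /(_ _ e20) /nbhs_ballP [d2 /= d20 h2] := @continuous_sin R th.
exists (Num.min d1 d2); first by rewrite lt_min d10.
move=> th' h; apply: le_lt_trans (cmod_le_ReIm _) _.
rewrite /cis /cexp /= expR0 !mul1r.
have := h1 th'; have := h2 th'; rewrite /ball /= [`|th - _|]distrC => h2' h1'.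
have {}h1' : `|cos th - cos th'| < e / 2 by apply: h1'; rewrite (lt_le_trans h)// ge_min lexx.
have {}h2' : `|sin th - sin th'| < e / 2.
  by apply: h2'; rewrite (lt_le_trans h)// ge_min lexx orbT.
by rewrite distrC in h1'; rewrite distrC in h2'; move: h1' h2'; lra.
Qed.

Lemma mu_I2pi : mu I2pi = (2 * pi)%:E.
Proof.
rewrite lebesgue_measure_itv/= lte_fin ifT; last by rewrite mulr_gt0// pi_gt0.
by rewrite oppr0 adde0.
Qed.

Lemma pi2_gt0 : 0 < 2 * pi :> R.
Proof. by rewrite mulr_gt0// pi_gt0. Qed.

Lemma Re_rc (w w' : nat -> R[i]) k e : cmod (w' k./2 - w k./2) < e ->
  `|rc w' k - rc w k| < e.
Proof.
apply: le_lt_trans.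
have -> : rc w' k - rc w k = complex.Re (conjc (dir k) * (w' k./2 - w k./2)).
  by rewrite /rc mulrBr raddfB.
apply: le_trans (Re_le_cmod _) _; rewrite cmodM.
suff -> : cmod (conjc (dir k)) = 1 by rewrite mul1r.
by rewrite /dir /cmod; case: (odd k) => /=; rewrite ?oppr0 ?expr0n ?expr1n/= ?sqrrN ?expr1n ?addr0 ?add0r sqrtr1.
Qed.

Lemma usc3_rot f w : bounded_env w -> uscX f ->
  usc3 (fun th x => f (addX x (rc (turn th w)))).
Proof.
move=> [B hB] uf th x c /uf[d d0 h].
have B1 : 0 < `|B| + 1 by rewrite ltr_wpDl.
have d2 : 0 < d / 2 by lra.
have [d1 d10 h1] := cis_continuous th (divr_gt0 d2 B1).
exists (Num.min d1 (d / 2)); first by rewrite lt_min d10.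
move=> th' y ht hy; apply: h => k; rewrite /addX opprD addrACA.
apply: le_lt_trans (ler_normD _ _) _.
have : `|rc (turn th' w) k - rc (turn th w) k| < d / 2.
  apply: Re_rc; rewrite /turn -mulrBl cmodM.
  have {}h1 : cmod (cis th' - cis th : R[i]) < d / 2 / (`|B| + 1).
    by apply: h1; apply: (lt_le_trans ht); rewrite ge_min lexx.
  move: h1.
  rewrite ltr_pdivlMr//; apply: le_lt_trans.
  apply: ler_wpM2l; first exact: cmod_ge0.
  by apply: le_trans (hB _) _; apply: le_trans (ler_norm _) _; rewrite lerDl.
have : `|y k - x k| < d / 2.
  by apply: (lt_le_trans (hy k)); rewrite ge_min lexx orbT.
by lra.
Qed.

Lemma usc2_measurable_integral (g : R -> R -> R) (A : set R) : measurable A -> usc2 g ->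
  (forall s t, 0 <= g s t) ->
  measurable_fun setT (fun s => \int[mu]_(t in A) (g s t)%:E)%E.
Proof.
move=> mA ug g0; pose f := ((fun st : R * R => (g st.1 st.2)%:E) \_ (setT `*` A)).
have mf : measurable_fun setT f.
  apply: (measurable_restrictT _ _).1; first exact: measurableX.
  by apply: measurable_funTS; exact: usc2_measurable.
have f0 st : (0 <= f st)%E by rewrite /f; apply: erestrict_ge0 => x _; rewrite lee_fin.
have := @measurable_fun_fubini_tonelli_F _ _ _ _ R mu f mf f0.
congr measurable_fun; apply/funext => s; rewrite [RHS]integral_mkcond.
apply: eq_integral => t _; rewrite /f /patch.
congr (if _ then _ else _).
by apply/idP/idP; rewrite !inE; [case|split].
Qed.

(** Tonelli's theorem for the angle and the averaging variable. With M = f it carries the submean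
    property over to averages; with M constant it serves the choice of a rotation. *)
Lemma smear_int g M a x : usc3 g -> (forall th y, 0 <= g th y) -> uscX M ->
  (forall y, 0 <= M y) ->
  (forall y, ((2 * pi * M y)%:E <= \int[mu]_(th in I2pi) (g th y)%:E)%E) ->
  ((2 * pi * smear a M x)%:E <= \int[mu]_(th in I2pi) (smear a (g th) x)%:E)%E.
Proof.
move=> ug g0 uM M0 h; have u2 := @usc3_usc2 _ a x ug.
have -> : (\int[mu]_(th in I2pi) (smear a (g th) x)%:E =
    \int[mu]_(th in I2pi) \int[mu]_(s in I01) (g th (shiftX a x s))%:E)%E.
  by apply: eq_integral => th _; rewrite -smearE//; exact: usc3_fix.
rewrite (@usc2_fubini R (fun th s => g th (shiftX a x s)))// EFinM -(smearE a x uM M0) -ge0_integralZl_EFin//.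
- apply: ge0_le_integral => //.
  + by move=> s _; apply: mule_ge0; rewrite lee_fin// ltW// pi2_gt0.
  + have := @usc1_measurable R I01 _ (@uscX_shift _ a x uM).
    by move=> mM; apply: measurable_funeM.
  + apply: measurable_funTS.
    apply: (@usc2_measurable_integral (fun s th => g th (shiftX a x s))) => //.
    by move=> s t c /u2[d d0 h']; exists d => // s' t' h1 h2; exact: h'.
  + by move=> s _; rewrite -EFinM.
- by move=> s _; rewrite lee_fin.
- exact: (@usc1_measurable R I01 _ (@uscX_shift _ a x uM)).
- by rewrite ltW// pi2_gt0.
Qed.

Lemma subm_smear a f : uscX f -> (forall y, 0 <= f y) -> subm f -> subm (smear a f).
Proof.
move=> uf f0 sf x w bw.
apply: le_trans (@smear_int _ f a x (usc3_rot bw uf) _ uf f0 _) _ => //.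
  by move=> y; exact: sf.
suff -> : (fun th => (smear a (fun y => f (addX y (rc (turn th w)))) x)%:E) =
  (fun th => (smear a f (addX x (rc (turn th w))))%:E) by [].
apply/funext => th; congr (EFin (avg _)); apply/funext => s; congr f.
by apply/funext => k; rewrite /addX /shiftX addrAC.
Qed.

Lemma subm_smears L f : uscX f -> (forall y, 0 <= f y) -> subm f -> subm (smears L f).
Proof.
move=> uf f0 sf; elim: L => //= a L IH; apply: subm_smear => //.
  exact: uscX_smears.
by move=> y; exact: smears_ge0.
Qed.

(* Over all rotations the averages of [g th] keep a mean value at least [M], so
   that some rotation can be fixed before differentiating. *)
Lemma smears_int g M L x : usc3 g -> (forall th y, 0 <= g th y) -> 0 <= M ->
  (forall y, ((2 * pi * M)%:E <= \int[mu]_(th in I2pi) (g th y)%:E)%E) ->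
  ((2 * pi * M)%:E <= \int[mu]_(th in I2pi) (smears L (g th) x)%:E)%E.
Proof.
move=> ug g0 M0 h; elim: L x => //= a L IH x.
have uM : uscX (fun=> M) by move=> y c hc; exists 1.
apply: le_trans (@smear_int (fun th => smears L (g th)) (fun=> M) a x _ _ uM _ _) => //.
- by rewrite lee_fin ler_wpM2l// ?(ltW pi2_gt0)//; exact: smear_ge.
- exact: usc3_smears.
- by move=> th y; exact: smears_ge0.
Qed.

Lemma smears_rotation g M L x eps : usc3 g -> (forall th y, 0 <= g th y) -> 0 <= M ->
  (forall y, ((2 * pi * M)%:E <= \int[mu]_(th in I2pi) (g th y)%:E)%E) ->
  0 < eps -> exists th, M - eps <= smears L (g th) x.
Proof.
move=> ug g0 M0 h e0; apply: contrapT => H.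
have {}H th : smears L (g th) x <= M - eps.
  by rewrite leNgt; apply/negP => lt; apply: H; exists th; exact: ltW.
have Me : 0 <= M - eps by apply: le_trans (H 0); exact: smears_ge0.
have := smears_int L x ug g0 M0 h; apply/negP; rewrite -ltNge.
apply: (@le_lt_trans _ _ (\int[mu]_(th in I2pi) (M - eps)%:E)%E).
  apply: ge0_le_integral => //.
  - by move=> s _; rewrite lee_fin smears_ge0.
  - by apply: (@usc1_measurable R I2pi); exact: (@usc3_swap (fun th => smears L (g th)) x (@usc3_smears L g ug g0)).
  - by move=> s _; rewrite lee_fin; exact: H.
rewrite (integral_cst mu (measurable_itv _) (M - eps)%:E).
rewrite [X in (_ * X)%E](_ : _ = (2 * pi)%:E); last exact: mu_I2pi.
by rewrite -EFinM lte_fin mulrC ltr_pM2l ?pi2_gt0//; lra.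
Qed.

End Smoothing.

(** * Second-order expansion of smoothed functions *)

Section Taylor.
Variables (R : realType) (N : nat).
Local Notation X := (nat -> R).
Implicit Types (x y z h p : X) (f : X -> R) (a b : nat) (L : seq nat).

Lemma le_of_le_div (x y z : R) : (forall k : nat, x <= y + z / k.+1%:R) -> x <= y.
Proof.
move=> H; rewrite leNgt; apply/negP => yx.
have xy0 : 0 < x - y by lra.
pose k := Num.truncn (`|z| / (x - y)).
have hk : `|z| / (x - y) < k.+1%:R by exact: truncnS_gt.
have k0 : 0 < (k.+1%:R : R) by rewrite ltr0n.
have := H k; move: hk k0; move: (k.+1%:R : R) => r; rewrite ltr_pdivrMr// => hk r0.
have : z / r <= `|z| / r by rewrite ler_pM2r ?invr_gt0// ler_norm.
have : `|z| / r < x - y by rewrite ltr_pdivrMr// mulrC.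
by lra.
Qed.

Lemma smear_increment_abs a f x (t t' c eta : R) : uscX f -> (forall y, 0 <= f y) ->
  (forall s, Num.min t t' <= s <= Num.max t t' ->
    `|f (shiftX a x (s + 1)) - f (shiftX a x s) - c| <= eta) ->
  `|smear a f (shiftX a x t') - smear a f (shiftX a x t) - c * (t' - t)| <= eta * `|t' - t|.
Proof.
move=> uf f0 h; have [tt'|/ltW t't] := leP t t'.
  rewrite [`|t' - t|]ger0_norm ?subr_ge0//; apply: smear_increment => // s hs.
  by apply: h; rewrite (min_idPl tt') (max_idPr tt').
rewrite [`|t' - t|]distrC [`|t - t'|]ger0_norm ?subr_ge0//.
have -> : `|smear a f (shiftX a x t') - smear a f (shiftX a x t) - c * (t' - t)| =
  `|smear a f (shiftX a x t) - smear a f (shiftX a x t') - c * (t - t')|.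
  by rewrite -normrN; congr Num.norm; ring.
apply: smear_increment => // s hs.
by apply: h; rewrite (min_idPr t't) (max_idPl t't).
Qed.

(** The segment from 0 to t is cut into k + 1 pieces on each of which the slope c + e s is almost
    constant; the excess error is of order 1/k and disappears in the limit. *)
Lemma smear_increment2 a f x (t c e eta : R) : uscX f -> (forall y, 0 <= f y) ->
  (forall s, `|s| <= `|t| ->
    `|f (shiftX a x (s + 1)) - f (shiftX a x s) - c - e * s| <= eta) ->
  `|smear a f (shiftX a x t) - smear a f x - c * t - e * t ^+ 2 / 2| <= eta * `|t|.
Proof.
move=> uf f0 h.
pose A s := smear a f (shiftX a x s) - c * s - e * s ^+ 2 / 2.
have hA s s' : `|s| <= `|t| -> `|s'| <= `|t| ->
    `|A s' - A s| <= (eta + 2 * `|e| * `|s' - s|) * `|s' - s|.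
  move=> hs hs'.
  have := @smear_increment_abs a f x s s' (c + e * s) (eta + `|e| * `|s' - s|) uf f0 _.
  set D := smear a f _ - smear a f _ => H.
  have -> : A s' - A s = (D - (c + e * s) * (s' - s)) - e * (s' - s) * ((s' - s) / 2).
    by rewrite /A /D; field.
  apply: le_trans (ler_normB _ _) _.
  have -> : `|e * (s' - s) * ((s' - s) / 2)| = `|e| * `|s' - s| * (`|s' - s| / 2).
    by rewrite !normrM normfV (@ger0_norm _ 2).
  have {}H : `|D - (c + e * s) * (s' - s)| <= (eta + `|e| * `|s' - s|) * `|s' - s|.
    apply: H => r hr.
    have [hr1 hr2] : `|r| <= `|t| /\ `|r - s| <= `|s' - s|.
      have [h1 h2] := andP hr; move: hs hs'.
      rewrite !ler_norml => /andP[a1 a2] /andP[b1 b2]; move: h1 h2.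
      have [ss|ss] := leP s s' => h1 h2; split.
      - by apply/andP; split; lra.
      - by rewrite !ger0_norm; lra.
      - by apply/andP; split; lra.
      - by rewrite (@ler0_norm _ (s' - s)); [apply/andP; split|]; lra.
    have -> : f (shiftX a x (r + 1)) - f (shiftX a x r) - (c + e * s) =
      (f (shiftX a x (r + 1)) - f (shiftX a x r) - c - e * r) + e * (r - s) by ring.
    apply: le_trans (ler_normD _ _) _; apply: lerD; first exact: h.
    by rewrite normrM ler_wpM2l.
  have : 0 <= `|e| * `|s' - s| * (`|s' - s| / 2) by rewrite !mulr_ge0// divr_ge0.
  by move: H; move: (`|e|) (`|s' - s|) => E S; nra.
rewrite [X in `|X| <= _](_ : _ = A t - A 0); last by rewrite /A shiftX0; field.
apply: (@le_of_le_div _ _ (2 * `|e| * `|t| ^+ 2)) => k.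
pose s (i : nat) := t * (i%:R / k.+1%:R).
have k0 : (k.+1%:R : R) != 0 by rewrite pnatr_eq0.
have -> : A t - A 0 = \sum_(0 <= i < k.+1) (A (s i.+1) - A (s i)).
  by rewrite telescope_sumr// /s divff// mulr1 mul0r mulr0.
apply: le_trans (ler_norm_sum _ _ _) _.
have ds i : `|s i.+1 - s i| = `|t| / k.+1%:R.
  rewrite /s -mulrBr -mulrBl -natr1 addrAC subrr add0r mul1r normrM normfV.
  by rewrite [`|k.+1%:R|]ger0_norm.
have sle i : (i <= k.+1)%N -> `|s i| <= `|t|.
  move=> ik; rewrite /s normrM ler_piMr// ger0_norm ?divr_ge0//.
  by rewrite ler_pdivrMr ?ltr0n// mul1r ler_nat.
rewrite big_nat; apply: le_trans (_ : \sum_(0 <= i < k.+1 | (0 <= i < k.+1)%N)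
   (eta + 2 * `|e| * (`|t| / k.+1%:R)) * (`|t| / k.+1%:R) <= _).
  apply: ler_sum => i /andP[_ ik]; rewrite -(ds i).
  by apply: hA; apply: sle => //; exact: ltnW.
rewrite -big_nat big_const_nat subn0 iter_addr_0 -mulr_natl.
rewrite le_eqVlt; apply/orP; left; apply/eqP; field; by rewrite addrC natr1.
Qed.

Definition addp x h m : X := fun k => x k + (if (k < m)%N then h k else 0).

Definition supp h := forall k, (N <= k)%N -> h k = 0.

Definition n1 h : R := \sum_(k < N) `|h k|.

Lemma addp0 x h : addp x h 0 = x.
Proof. by apply/funext => k; rewrite /addp addr0. Qed.

Lemma addpS x h m : addp x h m.+1 = shiftX m (addp x h m) (h m).
Proof.
apply/funext => k; rewrite /addp /shiftX ltnS leq_eqVlt.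
by case: (ltngtP k m) => [_|_|->]/=; ring.
Qed.

Lemma addpN x h : supp h -> addp x h N = addX x h.
Proof.
by move=> sh; apply/funext => k; rewrite /addp /addX; case: ltnP => // /sh ->.
Qed.

Lemma n1_ge0 h : 0 <= n1 h.
Proof. by apply: sumr_ge0. Qed.

Lemma le_n1 h k : supp h -> `|h k| <= n1 h.
Proof.
move=> sh; have [kN|/sh->] := ltnP k N; last by rewrite normr0 n1_ge0.
by rewrite /n1 (bigD1 (Ordinal kN))//= lerDl sumr_ge0.
Qed.

(* The intermediate points of the path from [x] to [x + h] that changes one coordinate at a time. *)
Lemma shift_addp x h m s : supp h -> (m < N)%N -> `|s| <= `|h m| ->
  exists2 h', supp h' /\ n1 h' <= n1 h &
    forall x, shiftX m (addp x h m) s = addX x h'.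
Proof.
move=> sh mN sm.
exists (fun k => if (k < m)%N then h k else if k == m then s else 0); last first.
  move=> y; apply/funext => k; rewrite /addX /shiftX /addp.
  by case: (ltngtP k m) => _ /=; ring.
split.
  by move=> k Nk; rewrite ltnNge (leq_trans (ltnW mN) Nk)/= gtn_eqF// (leq_trans mN).
by apply: ler_sum => k _; case: (ltngtP k m) => [||->]//; rewrite normr0.
Qed.

Lemma telescope_bound f x h (c e : nat -> R) : supp h ->
  (forall m, (m < N)%N -> `|f (addp x h m.+1) - f (addp x h m) - c m| <= e m) ->
  `|f (addX x h) - f x - \sum_(m < N) c m| <= \sum_(m < N) e m.
Proof.
move=> sh H; rewrite -(addpN x sh) -{2}(addp0 x h).
rewrite -(big_mkord xpredT (fun m => c m)) -(telescope_sumr (fun m => f (addp x h m)))//.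
rewrite -sumrB (big_mkord xpredT); apply: le_trans (ler_norm_sum _ _ _) _.
by apply: ler_sum => m _; exact: H.
Qed.

(** * Expansions of repeatedly averaged functions *)

Definition bddX f := forall M, exists B, forall x, (forall k, `|x k| <= M) -> f x <= B.

(* [f] has been averaged at least [m] times in each of the [N] directions. *)
Fixpoint smooth m f := match m with
  | 0 => [/\ uscX f, (forall x, 0 <= f x) & bddX f]
  | m'.+1 => smooth m' f /\
      forall a, (a < N)%N -> exists2 f', smooth m' f' & f = smear a f'
  end.

Lemma smooth_class m f : smooth m f -> [/\ uscX f, (forall x, 0 <= f x) & bddX f].
Proof. by elim: m => //= m IH [/IH]. Qed.

Lemma smoothW m f : smooth m.+1 f -> smooth m f.
Proof. by case. Qed.

Lemma bdd_shift M x a s : (forall k, `|x k| <= M) -> forall k, `|shiftX a x s k| <= M + `|s|.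
Proof.
move=> xM k; apply: le_trans (ler_normD _ _) (lerD (xM k) _).
by case: (k == a); rewrite ?mul1r// mul0r normr0.
Qed.

Lemma bddX_smear a f : uscX f -> (forall x, 0 <= f x) -> bddX f -> bddX (smear a f).
Proof.
move=> uf f0 bf M; have [B hB] := bf (M + 1); exists B => x xM.
apply: smear_le => // s /andP[s0 s1]; apply: hB => k.
by apply: le_trans (bdd_shift a s xM k) _; rewrite lerD2l ger0_norm// ltW.
Qed.

Lemma smooth_smears m L f : uscX f -> (forall x, 0 <= f x) -> bddX f ->
  (forall a, (a < N)%N -> (m <= count_mem a L)%N) -> smooth m (smears L f).
Proof.
move=> uf f0 bf; elim: m L => [|m IH] L hL /=.
  split; [exact: uscX_smears|by move=> x; exact: smears_ge0|].
  by elim: L {hL} => //= a L IH; apply: bddX_smear => //; [exact: uscX_smears|move=> x; exact: smears_ge0].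
split; first by apply: IH => a /hL; exact: ltnW.
move=> a aN; have aL : a \in L by rewrite -has_pred1 has_count (leq_trans _ (hL a aN)).
exists (smears (rem a L) f); last exact: smears_rem.
apply: IH => b /hL; rewrite (permP (perm_to_rem aL)) /=.
by case: (a == b) => /= hb; lia.
Qed.

Lemma smooth_lipschitz f M : smooth 1 f -> exists2 B, 0 <= B & forall x h,
  (forall k, `|x k| <= M) -> supp h -> n1 h <= 1 -> `|f (addX x h) - f x| <= B * n1 h.
Proof.
move=> [_ sf].
have /choice[B hB] : forall a, exists B, 0 <= B /\ ((a < N)%N -> forall x t,
    (forall k, `|x k| <= M + 1) -> `|t| <= 1 -> `|f (shiftX a x t) - f x| <= B * `|t|).
  move=> a; have [aN|_] := ltnP a N; last by exists 0.
  (* M + 1 for the base point, 1 for the displacement and 1 for the unit shift in the difference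
     quotient. *)
  have [f' [uf f0 bf] fE] := sf a aN; have [B hB] := bf (M + 3).
  exists `|B|; split => // _ x t xM t1.
  have := @smear_increment2 a f' x t 0 0 `|B| uf f0 _; rewrite -fE !mul0r !subr0; apply.
  move=> s st; rewrite mul0r !subr0.
  have b1 : f' (shiftX a x (s + 1)) <= B.
    apply: hB => k; apply: le_trans (bdd_shift a _ xM k) _.
    have := ler_normD s 1; rewrite normr1; lra.
  have b2 : f' (shiftX a x s) <= B.
    apply: hB => k; apply: le_trans (bdd_shift a _ xM k) _; lra.
  have := ler_norm B; have := f0 (shiftX a x s); have := f0 (shiftX a x (s + 1)).
  by rewrite ler_norml => *; apply/andP; split; lra.
exists (\sum_(a < N) B a); first by apply: sumr_ge0 => a _; have [] := hB a.
move=> x h xM sh h1.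
have := @telescope_bound f x h (fun=> 0) (fun m => B m * `|h m|) sh.
rewrite big1// subr0 => /(_ _) H; apply: le_trans (H _) _.
  move=> m mN; rewrite subr0 addpS; have [_ /(_ mN)] := hB m; apply.
    move=> k; rewrite /addp; case: ifP => _; last by rewrite addr0; have := xM k; lra.
    apply: le_trans (ler_normD _ _) (lerD (xM k) _).
    exact: le_trans (le_n1 k sh) h1.
  exact: le_trans (le_n1 m sh) h1.
rewrite mulr_suml; apply: ler_sum => a _; apply: ler_wpM2l; first by have [] := hB a.
exact: le_n1.
Qed.

(** If f averages f' in direction a, its partial derivative is f'(x + e_a) - f'(x). The Lipschitz
    bounds of f' at both points give the quadratic error. *)
Lemma smooth_taylor1 f p M : (forall k, `|p k| <= M) -> smooth 2 f ->
  exists (l : nat -> R) (C : R), 0 <= C /\ forall h, supp h -> n1 h <= 1 ->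
    `|f (addX p h) - f p - \sum_(a < N) l a * h a| <= C * n1 h ^+ 2.
Proof.
move=> pM [_ sf].
have /choice[l hl] : forall a, exists lC : R * R, 0 <= lC.2 /\ ((a < N)%N -> forall h,
    supp h -> n1 h <= 1 ->
    `|f (addp p h a.+1) - f (addp p h a) - lC.1 * h a| <= lC.2 * n1 h * `|h a|).
  move=> a; have [aN|_] := ltnP a N; last by exists (0, 0).
  have [f' sf' fE] := sf a aN; have [uf f0 _] := @smooth_class 1 _ sf'.
  have [B B0 hB] := smooth_lipschitz (M + 1) sf'.
  exists (f' (shiftX a p 1) - f' p, 2 * B); split => /=; first by rewrite mulr_ge0.
  move=> _ h sh h1.
  have := @smear_increment2 a f' (addp p h a) (h a) (f' (shiftX a p 1) - f' p) 0 (2 * B * n1 h) uf f0.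
  rewrite -fE -addpS !mul0r subr0; apply => s hs.
  have [h' [sh' nh'] E] := shift_addp p sh aN hs.
  have E1 : shiftX a (addp p h a) (s + 1) = addX (shiftX a p 1) h'.
    by rewrite -E; apply/funext => k; rewrite /shiftX /addp; ring.
  rewrite mul0r subr0 E1 E.
  have b1 : `|f' (addX (shiftX a p 1) h') - f' (shiftX a p 1)| <= B * n1 h'.
    by apply: hB => //; [move=> k; have := bdd_shift a 1 pM k; rewrite normr1|lra].
  have b2 : `|f' (addX p h') - f' p| <= B * n1 h'.
    by apply: hB => //; [move=> k; have := pM k; lra|lra].
  have b3 : B * n1 h' <= B * n1 h by rewrite ler_wpM2l.
  have -> : f' (addX (shiftX a p 1) h') - f' (addX p h') - (f' (shiftX a p 1) - f' p) =
    (f' (addX (shiftX a p 1) h') - f' (shiftX a p 1)) - (f' (addX p h') - f' p) by ring.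
  apply: le_trans (ler_normB _ _) _; lra.
exists (fun a => (l a).1), (\sum_(a < N) (l a).2); split.
  by apply: sumr_ge0 => a _; have [] := hl a.
move=> h sh h1.
have := @telescope_bound f p h (fun a => (l a).1 * h a) (fun a => (l a).2 * n1 h * `|h a|) sh.
move=> /(_ _) H; apply: le_trans (H _) _.
  by move=> m mN; have [_ /(_ mN)] := hl m; exact.
rewrite mulr_suml; apply: ler_sum => a _; rewrite -mulrA expr2.
apply: ler_wpM2l; first by have [] := hl a.
by rewrite ler_wpM2l ?n1_ge0 ?le_n1.
Qed.

Lemma smooth_taylor2 f p M : (forall k, `|p k| <= M) -> smooth 3 f ->
  exists (l : nat -> R) (q : nat -> nat -> R) (C : R), 0 <= C /\
  forall h, supp h -> n1 h <= 1 ->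
    `|f (addX p h) - f p - \sum_(a < N) l a * h a -
      \sum_(a < N) \sum_(b < N) q a b * (h a * h b)| <= C * n1 h ^+ 3.
Proof.
move=> pM [_ sf].
have /choice[l hl] : forall a, exists lqC : R * (nat -> R) * R, 0 <= lqC.2 /\
   ((a < N)%N -> forall h, supp h -> n1 h <= 1 ->
    `|f (addp p h a.+1) - f (addp p h a) - 
       (lqC.1.1 * h a + \sum_(b < N) lqC.1.2 b * (h a * h b))| <= lqC.2 * n1 h ^+ 2 * `|h a|).
  move=> a; have [aN|_] := ltnP a N; last by exists (0, fun=> 0, 0).
  have [f' sf' fE] := sf a aN; have [uf f0 _] := @smooth_class 2 _ sf'.
  have [l [C [C0 hC]]] := smooth_taylor1 pM sf'.
  have [l' [C' [C0' hC']]] := smooth_taylor1 (bdd_shift a 1 pM) sf'.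
  pose be b := l' b - l b.
  (* When coordinate a moves, those below a have already moved and those above have not: hence a
     triangular matrix, with the half on the diagonal coming from the integral of s. *)
  pose q b := if (b < a)%N then be b else if b == a then be b / 2 else 0.
  exists (f' (shiftX a p 1) - f' p, q, C + C'); split => /=; first by rewrite addr_ge0.
  move=> _ h sh h1.
  pose S := \sum_(b < N | (b < a)%N) be b * h b.
  have := @smear_increment2 a f' (addp p h a) (h a) (f' (shiftX a p 1) - f' p + S)
    (be a) ((C + C') * n1 h ^+ 2) uf f0.
  rewrite -fE -addpS.
  have -> : \sum_(b < N) q b * (h a * h b) = S * h a + be a * h a ^+ 2 / 2.
    rewrite (bigID (fun b : 'I_N => (b < a)%N))/=; congr (_ + _).
      rewrite /S mulr_suml; apply: eq_bigr => b ba; rewrite /q ba; ring.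
    rewrite (bigD1 (Ordinal aN))/= ?ltnn// big1 => [|b /andP[ba /negP bb]].
      by rewrite /q ltnn eqxx addr0; field.
    by rewrite /q (negbTE ba); case: eqP => [E|]; [exfalso; apply: bb; exact/eqP/val_inj|rewrite mul0r].
  move=> H; have {}H := H _.
  rewrite [X in `|X| <= _](_ : _ = f (addp p h a.+1) - f (addp p h a) -
    (f' (shiftX a p 1) - f' p + S) * h a - be a * h a ^+ 2 / 2); last by ring.
  apply: H => s hs.
  have [h' [sh' nh'] E] := shift_addp p sh aN hs.
  have E1 : shiftX a (addp p h a) (s + 1) = addX (shiftX a p 1) h'.
    by rewrite -E; apply/funext => k; rewrite /shiftX /addp; ring.
  have Eh b : h' b = if (b < a)%N then h b else if b == a then s else 0.
    have := congr1 (fun g => g b - p b) (E p); rewrite /addX /shiftX /addp.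
    rewrite [RHS]addrAC subrr add0r => <-.
    by case: (ltngtP b a) => _ /=; ring.
  have Eb : S + be a * s = \sum_(b < N) be b * h' b.
    rewrite [RHS](bigID (fun b : 'I_N => (b < a)%N))/=; congr (_ + _).
      by apply: eq_bigr => b ba; rewrite Eh ba.
    rewrite (bigD1 (Ordinal aN))/= ?ltnn// big1 => [|b /andP[ba /negP bb]].
      by rewrite Eh ltnn eqxx addr0.
    by rewrite Eh (negbTE ba); case: eqP => [E'|]; [exfalso; apply: bb; exact/eqP/val_inj|rewrite mulr0].
  have h1' : n1 h' <= 1 by lra.
  have b1 := hC' h' sh' h1'; have b2 := hC h' sh' h1'.
  have n2 : n1 h' ^+ 2 <= n1 h ^+ 2 by rewrite lerXn2r ?nnegrE ?n1_ge0.
  have b3 : C * n1 h' ^+ 2 <= C * n1 h ^+ 2 by rewrite ler_wpM2l.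
  have b4 : C' * n1 h' ^+ 2 <= C' * n1 h ^+ 2 by rewrite ler_wpM2l.
  rewrite E1 E.
  have -> : f' (addX (shiftX a p 1) h') - f' (addX p h') - (f' (shiftX a p 1) - f' p + S) - be a * s =
    (f' (addX (shiftX a p 1) h') - f' (shiftX a p 1) - \sum_(b < N) l' b * h' b) -
    (f' (addX p h') - f' p - \sum_(b < N) l b * h' b).
    suff -> : \sum_(b < N) l' b * h' b = \sum_(b < N) l b * h' b + (S + be a * s) by ring.
    by rewrite Eb -big_split/=; apply: eq_bigr => b _; rewrite /be; ring.
  apply: le_trans (ler_normB _ _) _; rewrite mulrDl; move: b1 b2 b3 b4; lra.
exists (fun a => (l a).1.1), (fun a => (l a).1.2), (\sum_(a < N) (l a).2); split.
  by apply: sumr_ge0 => a _; have [] := hl a.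
move=> h sh h1.
have := @telescope_bound f p h (fun a => (l a).1.1 * h a + \sum_(b < N) (l a).1.2 b * (h a * h b))
   (fun a => (l a).2 * n1 h ^+ 2 * `|h a|) sh.
move=> /(_ _) H; rewrite big_split/= opprD addrA in H; apply: le_trans (H _) _.
  by move=> m mN; have [_ /(_ mN)] := hl m; exact.
rewrite mulr_suml; apply: ler_sum => a _; rewrite -mulrA [n1 h ^+ 3]exprSr.
apply: ler_wpM2l; first by have [] := hl a.
by rewrite ler_wpM2l ?le_n1// exprn_ge0 ?n1_ge0.
Qed.

End Taylor.

(** * The Levi form *)

Section Levi.
Variables (R : realType) (N : nat).
Local Notation mu := (@lebesgue_measure R).
Local Notation X := (nat -> R).
Local Notation I2pi := [set` (`[0%R, (2 * pi)%R] : interval R)].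
Implicit Types (x y z h p : X) (f : X -> R) (a b : nat) (w : nat -> R[i]).

Definition toX (v : 'rV[R]_N) : X := fun k => if insub k is Some i then v ord0 i else 0.

Lemma toX_nb (d : R) (v v' : 'rV[R]_N) : 0 < d -> ball v d v' -> nbX d (toX v) (toX v').
Proof.
move=> d0 [_ vv'] k; rewrite /toX; case: insubP => [i _ _|_]; last by rewrite subrr normr0.
by have := vv' ord0 i; rewrite /ball /= distrC.
Qed.

Lemma supp_toX v : supp N (toX v).
Proof. by move=> k Nk; rewrite /toX insubN// -leqNgt. Qed.

Lemma toX_surj x : supp N x -> exists v, toX v = x.
Proof.
move=> sx; exists (\row_i x i); apply/funext => k; rewrite /toX.
by case: insubP => [i _ <-|]; rewrite ?mxE// -leqNgt => /sx.
Qed.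

(** Sequences supported below [N] are identified with row vectors, where a closed bounded set is
    compact. *)
Lemma attains_max (S : set X) f M : S !=set0 -> (forall x, S x -> supp N x) ->
  (forall x k, S x -> `|x k| <= M) ->
  (forall x, supp N x -> ~ S x -> exists2 d, 0 < d & forall y, supp N y -> nbX d x y -> ~ S y) ->
  (forall x e, supp N x -> 0 < e ->
    exists2 d, 0 < d & forall y, supp N y -> nbX d x y -> `|f y - f x| < e) ->
  exists2 p, S p & forall x, S x -> f x <= f p.
Proof.
move=> [x0 Sx0] Ss SM Sc cf; pose A := [set v | S (toX v)].
have cA : compact A.
  have cB := @rV_compact R N (fun=> `[- M, M]%classic) (fun=> @segment_compact R _ _).
  apply: (subclosed_compact _ cB).
    rewrite -[A]setCK; apply: open_closedC; rewrite openE => v /= Av.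
    have [d d0 hd] := Sc (toX v) (supp_toX v) Av.
    apply/nbhs_ballP; exists d => //= v' vv' /=.
    by apply: hd; [exact: supp_toX|exact: toX_nb].
  move=> v /= Av i; have := SM _ i Av; rewrite /toX valK /= in_itv /=.
  by rewrite ler_norml.
have A0 : A !=set0 by have [v v0] := toX_surj (Ss _ Sx0); exists v; rewrite /A /= v0.
have cfA : {within A, continuous (f \o toX)}.
  apply: continuous_subspaceT => v U /nbhs_ballP[e /= e0 hA].
  have [d d0 hd] := cf (toX v) e (supp_toX v) e0.
  apply/nbhs_ballP; exists d => //= v' vv'; apply: hA; rewrite /ball /= distrC.
  by apply: hd; [exact: supp_toX|exact: toX_nb].
have [v /set_mem Av hv] := compact_EVT_max A0 cA cfA.
exists (toX v) => // x Sx; have [v' E] := toX_surj (Ss x Sx).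
by rewrite -E; apply: hv; rewrite inE /A /= E.
Qed.

Lemma smooth_continuous f : smooth N 1 f -> forall x e, (exists M, forall k, `|x k| <= M) -> 0 < e ->
    exists2 d, 0 < d & forall y, supp N (fun k => y k - x k) -> nbX d x y -> `|f y - f x| < e.
Proof.
move=> sf x e [M xM] e0; have [B B0 hB] := smooth_lipschitz M sf.
have D0 : 0 < N%:R + 1 :> R by rewrite ltr_wpDl.
have B1 : 0 < B + 1 by lra.
exists (Num.min 1 (e / (B + 1)) / (N%:R + 1)); first by rewrite divr_gt0// lt_min ltr01 divr_gt0.
move=> y sy xy; have E : y = addX x (fun k => y k - x k) by apply/funext => k; rewrite /addX subrKC.
have n1lt : n1 N (fun k => y k - x k) < Num.min 1 (e / (B + 1)).
  apply: (@le_lt_trans _ _ (N%:R * (Num.min 1 (e / (B + 1)) / (N%:R + 1)))).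
    rewrite -[X in X%:R * _]card_ord mulr_natl -sumr_const; apply: ler_sum => k _.
    exact/ltW/xy.
  have : 0 < Num.min 1 (e / (B + 1)) by rewrite lt_min ltr01 divr_gt0.
  move: (Num.min _ _) => m m0; rewrite mulrA ltr_pdivrMr// mulrC ltr_pM2l//; lra.
rewrite {1}E; apply: le_lt_trans (hB x _ xM sy _) _.
  by apply/ltW/(lt_le_trans n1lt); rewrite ge_min lexx.
have : n1 N (fun k => y k - x k) < e / (B + 1).
  by apply/(lt_le_trans n1lt); rewrite ge_min lexx orbT.
have := n1_ge0 N (fun k => y k - x k).
rewrite ltr_pdivlMr//; move: (n1 _ _) => t t0; nra.
Qed.

(** Complex-linear in w, with the a-th real coordinate as its real part; it converts real Taylor
    coefficients into a holomorphic polynomial. *)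
Definition zcoord a w : R[i] := conjc (dir R a) * w a./2.

Lemma rcE w a : rc w a = complex.Re (zcoord a w). Proof. by []. Qed.

Definition quad (q : nat -> nat -> R) x := \sum_(a < N) \sum_(b < N) q a b * (x a * x b).

(* Twice the Levi form of [quad q] at [w]. *)
Definition levi q w := quad q (rc w) + quad q (rc (fun k => 'i%C * w k)).

Lemma zcoord_scale (c : R[i]) w a : zcoord a (fun k => c * w k) = c * zcoord a w.
Proof. by rewrite /zcoord mulrCA. Qed.

Lemma quad_sum q (g : nat -> nat -> R) x y :
  (forall a b, x a * x b + y a * y b = g a b) ->
  quad q x + quad q y = \sum_(a < N) \sum_(b < N) q a b * g a b.
Proof.
move=> E; rewrite /quad -big_split/=; apply: eq_bigr => a _.
by rewrite -big_split/=; apply: eq_bigr => b _; rewrite -mulrDr E.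
Qed.

(** Re(cX) Re(cY) + Re(icX) Re(icY) equals Re(X conj(Y)) whenever |c| = 1, so only the Hermitian
    part of [q] is seen. *)
Lemma levi_rot q th w : levi q (turn th w) = levi q w.
Proof.
pose g a b := complex.Re (zcoord a w * conjc (zcoord b w)).
have H c : c * conjc c = 1 ->
    levi q (fun k => c * w k) = \sum_(a < N) \sum_(b < N) q a b * g a b.
  move=> cc; apply: quad_sum => a b; rewrite !rcE !zcoord_scale.
  have -> : g a b = complex.Re ((c * conjc c) * (zcoord a w * conjc (zcoord b w))) by rewrite cc mul1r.
  move: (zcoord a w) (zcoord b w) c {cc} => [x x'] [y y'] [s t] /=; ring.
rewrite [LHS]H; last first.
  have := cmod_cis (R := R) th; rewrite -[cis th]/(cis th).
  move=> h; apply/eqP; rewrite eq_complex; move: h; rewrite /cmod.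
  case: (cis th) => s t /= h; apply/andP; split; apply/eqP; last by ring.
  have : s ^+ 2 + t ^+ 2 = 1.
    rewrite -[LHS]sqr_sqrtr ?h ?expr1n// addr_ge0 ?sqr_ge0//.
  move=> <-; ring.
have := H 1; rewrite conjc1 mulr1 => /(_ erefl) <-; congr levi.
by apply/funext => k; rewrite mul1r.
Qed.

Lemma quad_scale q (r : R) x : quad q (fun k => r * x k) = r ^+ 2 * quad q x.
Proof.
rewrite /quad mulr_sumr; apply: eq_bigr => a _; rewrite mulr_sumr.
by apply: eq_bigr => b _; ring.
Qed.

Lemma rc_scale (r : R) w k : rc (fun k => (r%:C)%C * w k) k = r * rc w k.
Proof. by rewrite !rcE zcoord_scale; case: (zcoord k w) => s t /=; ring. Qed.

Lemma levi_scale q (r : R) w : levi q (fun k => (r%:C)%C * w k) = r ^+ 2 * levi q w.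
Proof.
rewrite /levi mulrDr -!quad_scale; congr (_ + _); congr quad; apply/funext => k.
  exact: rc_scale.
rewrite -rc_scale; congr rc; apply/funext => j; ring.
Qed.

Lemma abs_rc w a : `|rc w a| <= cmod (w a./2).
Proof.
rewrite rcE; apply: le_trans (Re_le_cmod _) _; rewrite /zcoord cmodM.
suff -> : cmod (conjc (dir R a)) = 1 by rewrite mul1r.
by rewrite /dir /cmod; case: (odd a) => /=; rewrite ?oppr0 ?expr0n ?expr1n/= ?sqrrN ?expr1n ?addr0 ?add0r sqrtr1.
Qed.

(** Summing the expansions at the four points p + i^k r w cancels the linear part and leaves 2 r^2
    levi, whatever the rotation. The upper bound is thus pointwise in the angle, and four submean
    inequalities give levi >= -O(r). *)
Lemma levi_ge0 f p (l : nat -> R) q C w : uscX f -> (forall x, 0 <= f x) -> subm f ->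
  0 <= C -> (forall k, (N <= k)%N -> w k./2 = 0) -> bounded_env w ->
  (forall h, supp N h -> n1 N h <= 1 ->
    `|f (addX p h) - f p - \sum_(a < N) l a * h a - quad q h| <= C * n1 N h ^+ 3) ->
  0 <= levi q w.
Proof.
move=> uf f0 sf C0 sw [B wB] hT.
pose S := \sum_(a < N) cmod (w a./2).
have S0 : 0 <= S by apply: sumr_ge0 => a _; exact: cmod_ge0.
suff H (r : R) : 0 < r -> r * (S + 1) <= 1 -> 0 <= levi q w + 2 * C * S ^+ 3 * r.
  apply: (@le_of_le_div _ _ _ (2 * C * S ^+ 3 / (S + 1))) => k.
  have S1 : 0 < S + 1 by lra.
  have k0 : 0 < (k.+1%:R : R) by rewrite ltr0n.
  have := H ((S + 1)^-1 / k.+1%:R); rewrite mulrA; apply.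
    by rewrite divr_gt0// invr_gt0.
  rewrite mulrAC mulVf ?gt_eqF// mul1r invf_le1// ler1n//.
move=> r0 r1.
pose c (k : 'I_4) : R[i] := 'i%C ^+ k.
pose wk k : nat -> R[i] := fun j => c k * ((r%:C)%C * w j).
have c1 k : cmod (c k) = 1.
  rewrite /c cmodX [cmod _](_ : _ = 1) ?expr1n//.
  by rewrite /cmod /= expr0n expr1n add0r sqrtr1.
have bk k : bounded_env (wk k).
  by exists (`|r| * B) => j; rewrite /wk !cmodM c1 mul1r cmod_real ler_wpM2l.
have hs k th : supp N (rc (turn th (wk k))) /\ n1 N (rc (turn th (wk k))) <= r * S.
  split.
    by move=> j Nj; rewrite /rc /turn /wk (sw _ Nj) !mulr0 /= .
  rewrite /S mulr_sumr; apply: ler_sum => a _; apply: le_trans (abs_rc _ _) _.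
  by rewrite /turn /wk !cmodM cmod_cis c1 !mul1r cmod_real ger0_norm// ltW.
have rS : r * S <= 1 by lra.
pose E := C * (r * S) ^+ 3.
have pt th : \sum_(k < 4) f (addX p (rc (turn th (wk k)))) <=
    4 * f p + 2 * (r ^+ 2 * levi q w) + 4 * E.
  pose x k := rc (turn th (wk k)).
  have bk' k : f (addX p (x k)) <= f p + \sum_(a < N) l a * x k a + quad q (x k) + E.
    have [h1 h2] := hs k th; have := hT _ h1 (le_trans h2 rS).
    have : C * n1 N (x k) ^+ 3 <= E.
      by rewrite ler_wpM2l// lerXn2r// ?nnegrE ?n1_ge0// mulr_ge0// ltW.
    rewrite -/(x k) ler_norml => e1 /andP[e2 e3]; move: e1 e3; lra.
  apply: le_trans (ler_sum _ (fun k _ => bk' k)) _.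
  rewrite !big_split/= !sumr_const !card_ord.
  have xE k a : x k a = complex.Re (c k * zcoord a (turn th (fun j => (r%:C)%C * w j))).
    by rewrite /x rcE -zcoord_scale; congr (complex.Re (zcoord a _)); apply/funext => j; rewrite /turn /wk; ring.
  have l0 : \sum_(k < 4) \sum_(a < N) l a * x k a = 0.
    rewrite exchange_big/= big1// => a _; rewrite -mulr_sumr.
    rewrite !big_ord_recl big_ord0 !xE /c /=.
    move: (zcoord a _) => [s t] /=; ring.
  have q0 : \sum_(k < 4) quad q (x k) = 2 * (r ^+ 2 * levi q w).
    have e02 : quad q (x ord0) = quad q (x (inord 2)).
      rewrite /quad; apply: eq_bigr => a _; apply: eq_bigr => b _; congr (_ * _).
      rewrite !xE /c inordK//= !exprS !expr0; move: (zcoord a _) (zcoord b _) => [s t] [s' t'] /=; ring.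
    have e13 : quad q (x (inord 1)) = quad q (x (inord 3)).
      rewrite /quad; apply: eq_bigr => a _; apply: eq_bigr => b _; congr (_ * _).
      rewrite !xE /c !inordK//= !exprS !expr0; move: (zcoord a _) (zcoord b _) => [s t] [s' t'] /=; ring.
    rewrite -levi_scale -(levi_rot _ th) /levi.
    have <- : x ord0 = rc (turn th (fun k => (r%:C)%C * w k)).
      by apply/funext => a; rewrite xE /c expr0 mul1r.
    have <- : x (inord 1) = rc (fun k => 'i%C * turn th (fun k => (r%:C)%C * w k) k).
      by apply/funext => a; rewrite xE /c inordK// expr1 rcE zcoord_scale.
    rewrite !big_ord_recl big_ord0.
    have -> : lift ord0 (ord0 : 'I_3) = inord 1 by apply/val_inj; rewrite /= inordK.
    have -> : lift ord0 (lift ord0 (ord0 : 'I_2)) = inord 2 by apply/val_inj; rewrite /= inordK.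
    have -> : lift ord0 (lift ord0 (lift ord0 (ord0 : 'I_1))) = inord 3 by apply/val_inj; rewrite /= inordK.
    rewrite -e02 -e13; ring.
  by rewrite l0 q0; lra.
have I4 : ((4 * (2 * pi * f p))%:E <= \int[mu]_(th in I2pi) (\sum_(k < 4) f (addX p (rc (turn th (wk k)))))%:E)%E.
  under eq_integral do rewrite -sumEFin.
  rewrite ge0_integral_sum//; last 2 first.
  - move=> k; apply: (@usc1_measurable R I2pi).
    exact: (@usc3_swap R (fun th y => f (addX y (rc (turn th (wk k))))) p (usc3_rot (bk k) uf)).
  - by move=> k th _; rewrite lee_fin.
  have -> : (4 * (2 * pi * f p))%:E = (\sum_(k < 4) (2 * pi * f p)%:E)%E.
    by rewrite sumEFin; congr EFin; rewrite sumr_const card_ord mulr_natl.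
  by apply: lee_sum => k _; exact: sf.
have : ((4 * (2 * pi * f p))%:E <= (2 * pi * (4 * f p + 2 * (r ^+ 2 * levi q w) + 4 * E))%:E)%E.
  apply: le_trans I4 _.
  have -> : ((2 * pi * (4 * f p + 2 * (r ^+ 2 * levi q w) + 4 * E))%:E =
      \int[mu]_(th in I2pi) (4 * f p + 2 * (r ^+ 2 * levi q w) + 4 * E)%:E)%E.
    rewrite (integral_cst mu (measurable_itv _) (4 * f p + 2 * (r ^+ 2 * levi q w) + 4 * E)%:E).
    rewrite [X in (_ * X)%E](_ : _ = (2 * pi)%:E); last exact: mu_I2pi.
    by rewrite -EFinM mulrC.
  apply: ge0_le_integral => //.
  - by move=> th _; rewrite lee_fin; apply: sumr_ge0.
  - apply/measurable_EFinP; apply: measurable_sum => k; apply/measurable_EFinP.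
    apply: (@usc1_measurable R I2pi).
    exact: (@usc3_swap R (fun th y => f (addX y (rc (turn th (wk k))))) p (usc3_rot (bk k) uf)).
  - by move=> th _; rewrite lee_fin; exact: pt.
rewrite lee_fin mulrCA ler_pM2l ?pi2_gt0// => h.
have {h} : 0 <= r ^+ 2 * (levi q w + 2 * C * S ^+ 3 * r).
  by rewrite (_ : _ * _ = r ^+ 2 * levi q w + 2 * E); [lra|rewrite /E; ring].
by rewrite pmulr_rge0// exprn_gt0.
Qed.

End Levi.

(** * Maximum principle on polynomially convex hulls *)

Section MaximumPrinciple.
Variables (R : realType).
Local Notation mu := (@lebesgue_measure R).
Local Notation X := (nat -> R).
Local Notation env := (nat -> R[i]).
Local Notation I2pi := [set` (`[0%R, (2 * pi)%R] : interval R)].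
Implicit Types (x y z h m : X) (a b i k n : nat) (w : env) (K : set env).

Definition toC x : env := fun k => (x k.*2 +i* x k.*2.+1)%C.

Lemma rc_toC x : rc (toC x) = x.
Proof.
apply/funext => k; rewrite /rc /toC /dir -[in RHS](odd_double_half k).
by case: (odd k) => /=; rewrite ?add0n ?add1n ?oppr0; ring.
Qed.

Lemma toC_rc w : toC (rc w) = w.
Proof.
apply/funext => k; rewrite /rc /toC /dir /= odd_double uphalf_double doubleK /=.
by case: (w k) => s t /=; congr Complex; rewrite ?oppr0; ring.
Qed.

Lemma toC_add x w k : toC (addX x (rc w)) k = toC x k + w k.
Proof. by rewrite -{2}(toC_rc w). Qed.

Lemma rcB w w' k : rc (fun j => w j - w' j) k = rc w k - rc w' k.
Proof. by rewrite /rc mulrBr raddfB. Qed.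

Lemma supp_rc n w : (forall k, (n <= k)%N -> w k = 0) -> supp n.*2 (rc w).
Proof. by move=> sw k nk; rewrite /rc sw ?mulr0//; lia. Qed.

Lemma supp_toC n x : supp n.*2 x -> forall k, (n <= k)%N -> toC x k = 0.
Proof.
move=> sx k nk; rewrite /toC !sx//; first by rewrite ltnW// ltnS leq_double.
by rewrite leq_double.
Qed.

Lemma sum_double n (G : nat -> R) :
  \sum_(a < n.*2) G a = \sum_(i < n) (G i.*2 + G i.*2.+1).
Proof. by elim: n => [|n IH]; rewrite ?big_ord0// doubleS !big_ord_recr/= IH addrA. Qed.

Lemma sqr_rc n w : \sum_(a < n.*2) rc w a ^+ 2 = \sum_(i < n) cmod (w i) ^+ 2.
Proof.
rewrite (sum_double n (fun a => rc w a ^+ 2)); apply: eq_bigr => i _; rewrite cmod_sqr -{3 4}(toC_rc w).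
by rewrite /toC.
Qed.

Lemma n1_sqr N h : n1 N h ^+ 2 <= N%:R * \sum_(a < N) h a ^+ 2.
Proof.
have -> : n1 N h ^+ 2 = \sum_(a < N) \sum_(b < N) `|h a| * `|h b|.
  by rewrite expr2 {1}/n1 mulr_suml; apply: eq_bigr => a _; rewrite mulr_sumr.
apply: le_trans (_ : \sum_(a < N) \sum_(b < N) (h a ^+ 2 / 2 + h b ^+ 2 / 2) <= _).
  apply: ler_sum => a _; apply: ler_sum => b _.
  rewrite -(real_normK (num_real (h a))) -(real_normK (num_real (h b))).
  have := sqr_ge0 (`|h a| - `|h b|); rewrite sqrrB; lra.
under eq_bigr do rewrite big_split/= sumr_const card_ord.
rewrite big_split/= sumr_const card_ord sumrMnl.
have -> : \sum_(a < N) h a ^+ 2 / 2 = (\sum_(a < N) h a ^+ 2) / 2 by rewrite mulr_suml.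
by rewrite -mulrnDl -splitr mulr_natl.
Qed.

Lemma pol_zcoord a w : pol (fun y : env => zcoord a (fun k => y k - w k)).
Proof.
apply: pol_mul; first exact: pol_cst.
by apply: pol_sub; [exact: pol_var|exact: pol_cst].
Qed.

Lemma pol_continuous (q : env -> R[i]) w (e : R) : pol q -> 0 < e ->
  exists2 d, 0 < d & forall w', (forall k, cmod (w' k - w k) < d) -> cmod (q w' - q w) < e.
Proof.
move=> [p ->]; elim: p e => [c|i|p IHp p' IHp'|p IHp p' IHp'] e e0 /=.
- by exists 1 => // w' _; rewrite subrr cmod0.
- by exists e.
- have e2 : 0 < e / 2 by lra.
  have [d d0 h] := IHp _ e2; have [d' d0' h'] := IHp' _ e2.
  have hd : Num.min d d' <= d by rewrite ge_min lexx.
  have hd' : Num.min d d' <= d' by rewrite ge_min lexx orbT.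
  exists (Num.min d d'); first by rewrite lt_min d0.
  move=> w' hw; rewrite opprD addrACA; apply: le_lt_trans (cmodD _ _) _.
  have := h w' (fun k => lt_le_trans (hw k) hd).
  have := h' w' (fun k => lt_le_trans (hw k) hd').
  lra.
- pose A := cmod (pev p w); pose B := cmod (pev p' w).
  have A0 : 0 <= A by exact: cmod_ge0.
  have B0 : 0 <= B by exact: cmod_ge0.
  pose t := Num.min 1 (e / (A + B + 2)).
  have AB : 0 < A + B + 2 by lra.
  have t0 : 0 < t by rewrite lt_min ltr01 divr_gt0.
  have [d d0 h] := IHp _ t0; have [d' d0' h'] := IHp' _ t0.
  have hd : Num.min d d' <= d by rewrite ge_min lexx.
  have hd' : Num.min d d' <= d' by rewrite ge_min lexx orbT.
  exists (Num.min d d'); first by rewrite lt_min d0.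
  move=> w' hw.
  have := h w' (fun k => lt_le_trans (hw k) hd).
  have := h' w' (fun k => lt_le_trans (hw k) hd').
  have -> : pev p w' * pev p' w' - pev p w * pev p' w =
    (pev p w' - pev p w) * (pev p' w' - pev p' w) +
    ((pev p w' - pev p w) * pev p' w + pev p w * (pev p' w' - pev p' w)) by ring.
  move=> h1 h2; apply: le_lt_trans (cmodD _ _) _.
  apply: le_lt_trans (lerD (lexx _) (cmodD _ _)) _; rewrite !cmodM -/A -/B.
  have t1 : t <= 1 by rewrite ge_min lexx.
  have te : t * (A + B + 2) <= e by rewrite -ler_pdivlMr// ge_min lexx orbT.
  have := cmod_ge0 (pev p w' - pev p w); have := cmod_ge0 (pev p' w' - pev p' w).
  move: h1 h2 t0 t1 te A0 B0; move: (cmod _) (cmod _) (t) (A) (B); clear => u v t A B.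
  nra.
Qed.

(* With [Q] the quadratic part of the expansion of [F], the polynomial [P] below
   has real part l(h) + (Q(h) - Q(i h)) / 2, i.e. the expansion minus
   (Q(h) + Q(i h)) / 2 >= 0. *)
Lemma subharmonic_no_peak K n m F (e0 d1 : R) : pol_bounded K -> supported n K ->
  hull K (toC m) -> supp n.*2 m -> 0 < e0 -> 0 < d1 -> smooth n.*2 3 F -> subm F ->
  (forall x, supp n.*2 x -> hull K (toC x) ->
    F x + e0 * \sum_(a < n.*2) x a ^+ 2 <= F m + e0 * \sum_(a < n.*2) m a ^+ 2) ->
  (forall y : env, K y -> exists i, (i < n)%N /\ d1 < cmod (y i - toC m i)) -> False.
Proof.
move=> bK sK hm sm e00 d10 sF subF hmax hK; pose N := n.*2.
have [uF F0 _] := smooth_class sF.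
have mM : exists M, forall k, `|m k| <= M.
  exists (n1 N m) => k; exact: le_n1.
have [M {}mM] := mM.
have [l [q [C [C0 hT]]]] := smooth_taylor2 mM sF.
have lev w : (forall k, (n <= k)%N -> w k = 0) -> 0 <= levi N q w.
  move=> sw; apply: (@levi_ge0 R N F m l q C w) => //.
    by move=> k Nk; apply: sw; rewrite /N in Nk; lia.
  exists (\sum_(k < n) cmod (w k)) => k; have [kn|/sw ->] := ltnP k n.
    by rewrite (bigD1 (Ordinal kn))//= lerDl sumr_ge0// => j _; exact: cmod_ge0.
  by rewrite cmod0 sumr_ge0// => j _; exact: cmod_ge0.
pose P (y : env) : R[i] := let g a := zcoord a (fun k => y k - toC m k) in
  \sum_(a < N) ((l a + 2 * e0 * m a)%:C)%C * g a +
  \sum_(a < N) \sum_(b < N) ((q a b / 2)%:C)%C * (g a * g b).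
have pP : pol P.
  apply: pol_add; first by apply: pol_sum => a; apply: pol_mul; [exact: pol_cst|exact: pol_zcoord].
  apply: pol_sum => a; apply: pol_sum => b; apply: pol_mul; first exact: pol_cst.
  by apply: pol_mul; exact: pol_zcoord.
have P0 : P (toC m) = 0.
  have W0 a : zcoord a (fun k => toC m k - toC m k) = 0 by rewrite /zcoord subrr mulr0.
  rewrite /P big1 => [|a _]; last by rewrite W0 mulr0.
  by rewrite add0r big1// => a _; rewrite big1// => b _; rewrite W0 mul0r mulr0.
(* Since [n1] squared is at most N times the sum of squares, the cubic remainder then uses up at
   most half of the term e0 |x|^2; the other half is the peak constant e0 / 2. *)
pose rho := Num.min 1 (e0 / (2 * (C * N%:R + 1))).
have D0 : 0 < 2 * (C * N%:R + 1) by rewrite mulr_gt0// ltr_wpDl// mulr_ge0.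
have rho0 : 0 < rho by rewrite lt_min ltr01 divr_gt0.
have N1 : 0 < N%:R + 1 :> R by rewrite ltr_wpDl.
pose r := Num.min d1 (rho / (N%:R + 1)).
have r0 : 0 < r by rewrite lt_min d10 divr_gt0.
apply: (@no_local_peak R K n (toC m) r (e0 / 2) P) => //; first by rewrite divr_gt0.
  move=> y /hK[i [ni hi]]; exists i; split => //; apply: le_lt_trans hi.
  by rewrite ge_min lexx.
move=> y hy yr; have sy := supported_hull sK hy.
pose w k := y k - toC m k; pose x := rc w.
have sw k : (n <= k)%N -> w k = 0 by move=> nk; rewrite /w sy// (supp_toC sm nk) subrr.
have sx : supp N x by exact: supp_rc.
have yE : y = toC (addX m x) by apply/funext => k; rewrite toC_add /w subrKC.
have nx : n1 N x <= rho.
  apply: (@le_trans _ _ (N%:R * r)).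
    rewrite -[X in X%:R * _]card_ord mulr_natl -sumr_const; apply: ler_sum => a _.
    apply: le_trans (abs_rc _ _) _; apply: yr; have := ltn_ord a; rewrite /N; lia.
  have : r <= rho / (N%:R + 1) by rewrite ge_min lexx orbT.
  rewrite ler_pdivlMr//; have : 0 <= N%:R :> R by []; move: r0; clear; move: (N%:R) => t; nra.
have n0 := n1_ge0 N x.
have rho1 : rho <= 1 by rewrite ge_min lexx.
have h1 := hT x sx (le_trans nx rho1).
have h2 : F (addX m x) + e0 * \sum_(a < N) addX m x a ^+ 2 <= F m + e0 * \sum_(a < N) m a ^+ 2.
  apply: hmax; last by rewrite -yE.
  by move=> k Nk; rewrite /addX sm// sx// addr0.
have E1 : \sum_(a < N) addX m x a ^+ 2 =
   \sum_(a < N) m a ^+ 2 + 2 * (\sum_(a < N) m a * x a) + \sum_(a < N) x a ^+ 2.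
  rewrite mulr_sumr -!big_split/=; apply: eq_bigr => a _; rewrite /addX; ring.
have E2 : \sum_(i < n) cmod (y i - toC m i) ^+ 2 = \sum_(a < N) x a ^+ 2.
  by rewrite sqr_rc.
have E3 : complex.Re (P y) = \sum_(a < N) l a * x a + 2 * e0 * (\sum_(a < N) m a * x a) +
    quad N q x - levi N q w / 2.
  rewrite /P raddfD /= !raddf_sum /=.
  have -> : \sum_(a < N) complex.Re (((l a + 2 * e0 * m a)%:C)%C * zcoord a w) =
    \sum_(a < N) l a * x a + 2 * e0 * (\sum_(a < N) m a * x a).
    rewrite mulr_sumr -big_split/=; apply: eq_bigr => a _.
    by rewrite /x rcE; case: (zcoord a w) => s t /=; ring.
  rewrite -!addrA; do 2 congr (_ + _).
  rewrite /levi mulrDl opprD addrA -[X in X - _ - _]/(quad N q x).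
  have -> : quad N q x - quad N q (rc w) / 2 - quad N q (rc (fun k => 'i%C * w k)) / 2 =
    (quad N q (rc w) - quad N q (rc (fun k => 'i%C * w k))) / 2 by rewrite /x; field.
  rewrite /quad -sumrB mulr_suml; apply: eq_bigr => a _.
  rewrite raddf_sum /= -sumrB mulr_suml; apply: eq_bigr => b _.
  by rewrite !rcE !zcoord_scale -/w; case: (zcoord a w) (zcoord b w) => [s t] [s' t'] /=; field.
rewrite [X in - (e0 / 2) * X](_ : _ = \sum_(a < N) x a ^+ 2); last exact: E2.
rewrite E3; have lw := lev w sw.
have n3 : C * n1 N x ^+ 3 <= e0 / 2 * \sum_(a < N) x a ^+ 2.
  have := n1_sqr N x; set s2 := \sum_(a < N) _ => hs.
  have s20 : 0 <= s2 by apply: sumr_ge0 => a _; exact: sqr_ge0.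
  have nr : n1 N x * (2 * (C * N%:R + 1)) <= e0.
    by rewrite -ler_pdivlMr// (le_trans nx)// ge_min lexx orbT.
  rewrite exprS mulrA; apply: (@le_trans _ _ (C * n1 N x * (N%:R * s2))).
    by rewrite ler_wpM2l// mulr_ge0.
  rewrite mulrA ler_wpM2r//; move: nr n0; move: (n1 N x) (N%:R) => t u; nra.
move: h1; rewrite -/(quad N q x) ler_norml => /andP[h1 _].
move: h1 h2 E1 n3 lw; rewrite -/N.
set s1 := \sum_(a < N) l a * x a; set s2 := \sum_(a < N) m a * x a.
set s3 := \sum_(a < N) x a ^+ 2; set s4 := \sum_(a < N) addX m x a ^+ 2.
set s5 := \sum_(a < N) m a ^+ 2.
move: (C * _) (quad N q x) (levi N q w) (F _) (F _) s1 s2 s3 s4 s5.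
clear => c3 Q lv f1 f2 s1 s2 s3 s4 s5 a1 a2 a3 a4 a5; rewrite a3 in a2.
nra.
Qed.

Lemma smears_le (L : seq nat) (f : X -> R) x c : uscX f -> (forall y, 0 <= f y) ->
  (forall y, (forall k, `|y k - x k| <= (count_mem k L)%:R) -> f y <= c) -> smears L f x <= c.
Proof.
move=> uf f0; elim: L x => [|a L IH] x h /=; first by apply: h => k; rewrite subrr normr0.
apply: smear_le; [exact: uscX_smears|by move=> y; exact: smears_ge0|].
move=> s /andP[s0 s1]; apply: IH => y hy; apply: h => k.
have -> : y k - x k = (y k - shiftX a x s k) + (k == a)%:R * s by rewrite /shiftX; ring.
apply: le_trans (ler_normD _ _) _; rewrite /= natrD addrC; apply: lerD => //.
by rewrite eq_sym; case: (a == k); rewrite ?mul1r ?mul0r ?normr0// ger0_norm// ltW.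
Qed.

Definition usc_env n (u : env -> R) := forall w c, u w < c ->
  exists2 d, 0 < d & forall w', (forall k, (k < n)%N -> cmod (w' k - w k) < d) -> u w' < c.

Definition bdd_env n (u : env -> R) := forall M, exists B, forall w,
  (forall k, (k < n)%N -> cmod (w k) <= M) -> u w <= B.

Definition subm_env (u : env -> R) := forall w w', ((2 * pi * u w)%:E <=
  \int[mu]_(th in I2pi) (u (fun k => (w k + cis th * w' k)%R))%:E)%E.

(** The factor z carries both the rotation about p and the length of the averaging segments, which
    is 1 in the variable w. *)
Definition aff (p : env) (z : R[i]) w : env := fun k => p k + z * w k.

Lemma cmod_toC_sub x y k d : (forall j, `|y j - x j| <= d) ->
  cmod (toC y k - toC x k) <= 2 * d.
Proof.
move=> h; apply: le_trans (cmod_le_ReIm _) _; rewrite /toC /=.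
by have := h k.*2; have := h k.*2.+1; lra.
Qed.

Lemma usc3_aff n u (p : env) (d : R) : usc_env n u ->
  usc3 (fun th x => u (aff p ((d%:C)%C * cis th) (toC x))).
Proof.
move=> uu th x c /uu[e e0 h].
pose S := \sum_(k < n) cmod (toC x k).
have S0 : 0 <= S by apply: sumr_ge0 => k _; exact: cmod_ge0.
have D0 : 0 < (`|d| + 1) * (S + 1) by rewrite mulr_gt0// ltr_wpDl.
have e2 : 0 < e / 2 / ((`|d| + 1) * (S + 1)) by rewrite divr_gt0// divr_gt0.
have [d1 d10 h1] := cis_continuous th e2.
have D1 : 0 < `|d| + 1 by rewrite ltr_wpDl.
exists (Num.min d1 (e / 4 / (`|d| + 1))); first by rewrite lt_min d10 !divr_gt0.
move=> th' y hth hy; apply: h => k kn.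
have {}h1 : cmod (cis th' - cis th : R[i]) < e / 2 / ((`|d| + 1) * (S + 1)).
  by apply: h1; apply: lt_le_trans hth _; rewrite ge_min lexx.
have h2 : cmod (toC y k - toC x k) <= 2 * (e / 4 / (`|d| + 1)).
  apply: cmod_toC_sub => j; apply/ltW/(lt_le_trans (hy j)).
  by rewrite ge_min lexx orbT.
have h3 : cmod (toC x k) <= S.
  by rewrite /S (bigD1 (Ordinal kn))//= lerDl sumr_ge0// => j _; exact: cmod_ge0.
have -> : aff p ((d%:C)%C * cis th') (toC y) k - aff p ((d%:C)%C * cis th) (toC x) k =
  (d%:C)%C * (cis th' * (toC y k - toC x k) + (cis th' - cis th) * toC x k).
  by rewrite /aff; ring.
rewrite cmodM cmod_real.
have h4 := cmodD (cis th' * (toC y k - toC x k)) ((cis th' - cis th) * toC x k).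
rewrite !cmodM cmod_cis mul1r in h4.
move: h1; rewrite ltr_pdivlMr// => h1.
have h5 : 2 * (e / 4 / (`|d| + 1)) * (`|d| + 1) = e / 2 by field; rewrite gt_eqF.
have h6 := cmod_ge0 (cis th' - cis th); have h7 := cmod_ge0 (toC x k).
have h8 : 0 <= `|d| by [].
have h9 : `|d| * cmod (toC y k - toC x k) <= e / 2.
  rewrite -h5; apply: le_trans (ler_wpM2l h8 h2) _; rewrite mulrC.
  by rewrite ler_wpM2l ?lerDl// (le_trans (cmod_ge0 _) h2).
have h10 : `|d| * (cmod (cis th' - cis th) * cmod (toC x k)) < e / 2.
  apply: le_lt_trans h1; rewrite mulrCA ler_wpM2l// ler_pM//; lra.
apply: le_lt_trans (ler_wpM2l h8 h4) _; rewrite mulrDr; lra.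
Qed.

Lemma hull_aff K (p w : env) (z : R[i]) : z != 0 ->
  hull K (aff p z w) -> hull [set w | K (aff p z w)] w.
Proof.
move=> z0 hw q pq B hB.
pose inv (y : env) : env := fun k => z^-1 * (y k - p k).
have pi : pol (q \o inv).
  apply: (pol_comp pq) => k; apply: pol_mul; first exact: pol_cst.
  by apply: pol_sub; [exact: pol_var|exact: pol_cst].
have affK (y : env) : aff p z (inv y) = y by apply/funext => k; rewrite /aff /inv mulVKf// subrKC.
have invK (y : env) : inv (aff p z y) = y by apply/funext => k; rewrite /aff /inv addrAC subrr add0r mulKf.
rewrite -(invK w); apply: (hw _ pi) => y Ky /=; apply: hB.
by rewrite /= affK.
Qed.

(** Averaging mixes nearby values, hence the bound on a neighbourhood of [K]. With eps = (u p - c) /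
    2 the function F + e0 |x|^2 is at least c + eps at the origin, which represents p, and at most c
    + eps / 2 on the transformed set, so a maximum point over the hull stays away from that set. *)
Theorem max_principle n (u : env -> R) K p c (d0 : R) :
  usc_env n u -> (forall w, 0 <= u w) -> bdd_env n u -> subm_env u ->
  pol_bounded K -> supported n K -> hull K p -> 0 < d0 ->
  (forall (y w : env), K y -> (forall k, (k < n)%N -> cmod (w k - y k) < d0) -> u w <= c) ->
  u p <= c.
Proof.
move=> uu u0 bu su bK sK hp d00 huc; rewrite leNgt; apply/negP => cu.
pose eps := (u p - c) / 2; have eps0 : 0 < eps by rewrite /eps; lra.
(* Three averagings in each real direction, as the cubic remainder requires. *)
pose N := n.*2; pose L := iota 0 N ++ iota 0 N ++ iota 0 N.
have cL a : count_mem a L = (3 * (a < N))%N.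
  rewrite !count_cat count_uniq_mem ?iota_uniq// mem_iota add0n /=; lia.
(* Three unit averages move a real coordinate by at most 3 and a complex one by at most 6; 6 d stays
   below d0. *)
pose d := d0 / 20; have dp : 0 < d by rewrite /d; lra.
pose g th x := u (aff p ((d%:C)%C * cis th) (toC x)).
have ug : usc3 g by exact: (@usc3_aff n u p d uu).
have g0 th x : 0 <= g th x by exact: u0.
have [th hth] := @smears_rotation R g (u p) L (fun=> 0) eps ug g0 (u0 p) (ltac:(
  move=> y; apply: le_trans (su p (fun k => (d%:C)%C * toC y k)) _;
  rewrite le_eqVlt; apply/orP; left; apply/eqP; apply: eq_integral => th _; congr (EFin (u _));
  apply/funext => k; rewrite /aff; ring)) eps0.
pose z := (d%:C)%C * cis th : R[i].
have z0 : z != 0 by rewrite -cmod_gt0 cmodM cmod_cis mulr1 cmod_real normr_gt0 gt_eqF.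
pose K' := [set w | K (aff p z w)]; pose F := smears L (g th).
have sp := supported_hull sK hp.
have sK' : supported n K'.
  move=> w Kw k nk; have := sK _ Kw k nk; rewrite /aff sp// add0r => /eqP.
  by rewrite mulf_eq0 (negbTE z0) => /eqP.
have bK' : pol_bounded K'.
  apply: pol_bounded_coord => k; have [B [_ hB]] := bK _ (pol_var R k).
  exists ((B + cmod (p k)) / cmod z) => w /hB hw; rewrite ler_pdivlMr ?cmod_gt0//.
  rewrite mulrC -cmodM (_ : z * w k = aff p z w k - p k); last by rewrite /aff; ring.
  by apply: le_trans (cmodB _ _) _; rewrite lerD2r.
have hK'0 : hull K' (toC (fun=> 0)).
  apply: hull_aff => //; congr (hull K _): hp; apply/funext => k.
  by rewrite /aff (_ : toC _ k = 0) ?mulr0 ?addr0//.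
have uF := @usc3_fix _ g th ug.
have bg : bddX (g th).
  move=> M; have [B hB] := bu (\sum_(k < n) cmod (p k) + d * (2 * M)); exists B => x xM.
  apply: hB => k kn; rewrite /aff; apply: le_trans (cmodD _ _) _; apply: lerD.
    by rewrite (bigD1 (Ordinal kn))//= lerDl sumr_ge0// => j _; exact: cmod_ge0.
  rewrite !cmodM cmod_cis mulr1 cmod_real (ger0_norm (ltW dp)) ler_wpM2l ?(ltW dp)//.
  apply: le_trans (cmod_le_ReIm _) _; rewrite /toC /=.
  by have := xM k.*2; have := xM k.*2.+1; lra.
have sg : subm (g th).
  move=> x w _; have := su (aff p z (toC x)) (fun k => z * w k).
  congr (_ <= _)%E; apply: eq_integral => t _; congr (EFin (u _)); apply/funext => k.
  by rewrite /aff toC_add /turn /z; ring.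
have sF : smooth N 3 F.
  by apply: smooth_smears => // a aN; rewrite cL aN.
have subF : subm F by exact: subm_smears.
have FK x : K' (toC x) -> F x <= c.
  move=> Kx; apply: smears_le => // y hy; apply: (huc (aff p z (toC x))) => // k kn.
  have -> : aff p z (toC y) k - aff p z (toC x) k = z * (toC y k - toC x k) by rewrite /aff; ring.
  rewrite cmodM cmodM cmod_cis mulr1 cmod_real (ger0_norm (ltW dp)).
  have : cmod (toC y k - toC x k) <= 2 * 3.
    apply: cmod_toC_sub => j; apply: le_trans (hy j) _; rewrite cL ler_nat; lia.
  by rewrite /d; move: d00; clear; move: (cmod _) => t; nra.
have [M [M0 hM]] : exists M, 0 <= M /\ forall w, hull K' w -> \sum_(k < n) cmod (w k) ^+ 2 <= M.
  have /choice[B hB] : forall k, exists B : R, 0 <= B /\ forall w, hull K' w -> cmod (w k) <= B.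
    by move=> k; exact: (pol_bounded_hull bK' (pol_var R k)).
  exists (\sum_(k < n) B k ^+ 2); split; first by apply: sumr_ge0 => k _; exact: sqr_ge0.
  move=> w hw; apply: ler_sum => k _; have [B0 hk] := hB k.
  by rewrite lerXn2r ?nnegrE ?cmod_ge0// hk.
(* On the hull, where the squared norm is at most [M], the added term is then at most eps / 2. *)
pose e0 := eps / (2 * (M + 1)).
have e00 : 0 < e0 by rewrite divr_gt0// mulr_gt0// ltr_wpDl.
have e0M : e0 * M <= eps / 2.
  rewrite /e0 mulrAC ler_pdivrMr; last by rewrite mulr_gt0// ltr_wpDl.
  by move: eps0 M0; clear; move: eps M => s t; nra.
clearbody e0.
pose f x := F x + e0 * \sum_(a < N) x a ^+ 2.
have sqE x : \sum_(a < N) x a ^+ 2 = \sum_(k < n) cmod (toC x k) ^+ 2.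
  by rewrite -sqr_rc rc_toC.
pose S := [set x | supp N x /\ hull K' (toC x)].
have S0 : S (fun=> 0) by split.
have cf x e : supp N x -> 0 < e ->
    exists2 dl, 0 < dl & forall y, supp N y -> nbX dl x y -> `|f y - f x| < e.
  move=> sx e_gt0; have e2 : 0 < e / 2 by lra.
  have sF1 : smooth N 1 F by exact: (smoothW (smoothW sF)).
  have mx : exists M, forall k, `|x k| <= M by exists (n1 N x) => k; exact: le_n1.
  have [d1 d10 h1] := @smooth_continuous R N F sF1 x _ mx e2.
  pose Q (w : env) := (e0%:C)%C * \sum_(a < N) w a ^+ 2 : R[i].
  have pQ : pol Q.
    apply: pol_mul; first exact: pol_cst.
    by apply: pol_sum => a; apply: pol_exp; exact: pol_var.
  pose em y : env := fun k => ((y k)%:C)%C.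
  have QE y : Q (em y) = ((e0 * \sum_(a < N) y a ^+ 2)%:C)%C.
    rewrite /Q (rmorphM (real_complex R)) (rmorph_sum (real_complex R)).
    by congr (_ * _); apply: eq_bigr => a _; rewrite (rmorphXn (real_complex R)).
  have [d2 d20 h2] := pol_continuous (em x) pQ e2.
  exists (Num.min d1 d2); first by rewrite lt_min d10.
  move=> y sy hy.
  have a1 : `|F y - F x| < e / 2.
    apply: h1; first by move=> k Nk; rewrite sx// sy// subrr.
    by apply: nbXW hy; rewrite ge_min lexx.
  have a2 : cmod (Q (em y) - Q (em x)) < e / 2.
    apply: h2 => k; rewrite -rmorphB cmod_real; apply: lt_le_trans (hy k) _.
    by rewrite ge_min lexx orbT.
  rewrite !QE -rmorphB cmod_real in a2.
  rewrite /f opprD addrACA; apply: le_lt_trans (ler_normD _ _) _; lra.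
have [||||m [sm hm] fm] := @attains_max R N S f (Num.sqrt M) _ _ _ _ cf.
- by exists (fun=> 0).
- by move=> x [].
- move=> x k [sx hx]; have [kN|/sx->] := ltnP k N; last by rewrite normr0 sqrtr_ge0.
  rewrite -sqrtr_sqr ler_wsqrtr//; apply: le_trans (hM _ hx); rewrite -sqE.
  by rewrite (bigD1 (Ordinal kN))//= lerDl sumr_ge0// => j _; exact: sqr_ge0.
- move=> x sx nS; have nh : ~ hull K' (toC x) by move=> hx; apply: nS.
  have [q [pq [B [hB qB]]]] : exists q, pol q /\ exists B : R,
      (forall y : env, K' y -> cmod (q y) <= B) /\ B < cmod (q (toC x)).
    apply: contrapT => H; apply: nh => q pq B hB; rewrite leNgt; apply/negP => lt.
    by apply: H; exists q; split => //; exists B.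
  have qe : 0 < cmod (q (toC x)) - B by lra.
  have [d1 d10 h1] := pol_continuous (toC x) pq qe.
  exists (d1 / 3); first by lra.
  move=> y sy hy [_ /(_ q pq B hB)].
  have := h1 (toC y) (fun k => le_lt_trans (cmod_toC_sub k (fun j => ltW (hy j))) _).
  move=> /(_ ltac:(lra)); rewrite cmod_distrC => h2 h3.
  have := le_lt_trans (cmod_lower _ _) h2; lra.
have fm0 := fm _ S0.
have F0 x : 0 <= F x by exact: smears_ge0.
have fmc : c + eps <= f m.
  apply: le_trans fm0; apply: (@le_trans _ _ (F (fun=> 0))).
    by apply: le_trans hth; rewrite /eps; lra.
  by rewrite lerDl mulr_ge0 ?(ltW e00)// sumr_ge0// => a _; exact: sqr_ge0.
have e4 : 0 < eps / 2 by lra.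
have [d1 d10 h1] := cf m _ sm e4.
apply: (@subharmonic_no_peak K' n m F e0 (d1 / 2)) => //; first by lra.
  by move=> x sx hx; exact: fm.
move=> y Ky; apply: contrapT => H.
have hy k : cmod (y k - toC m k) <= d1 / 2.
  have [kn|nk] := ltnP k n; last by rewrite (sK' y Ky)// (supp_toC sm nk) subrr cmod0; lra.
  by rewrite leNgt; apply/negP => lt; apply: H; exists k.
have sy : supp N (rc y) by apply: supp_rc; exact: sK'.
have : `|f (rc y) - f m| < eps / 2.
  apply: h1 => // k; rewrite -(rc_toC m) -rcB.
  by apply: le_lt_trans (abs_rc _ _) _; apply: le_lt_trans (hy _) _; lra.
have : f (rc y) <= c + eps / 2.
  apply: lerD; first by apply: FK; rewrite toC_rc.
  apply: le_trans e0M; rewrite ler_wpM2l ?(ltW e00)// sqE toC_rc; apply: hM.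
  exact: subset_hull.
rewrite ltr_norml => h2 /andP[h3 _]; lra.
Qed.

End MaximumPrinciple.

(** * Powers of moduli of polynomials are subharmonic *)

Section SubmeanPolynomial.
Variables (R : realType).
Local Notation mu := (@lebesgue_measure R).
Local Notation C := (R[i]).
Local Notation I2pi := [set` (`[0%R, (2 * pi)%R] : interval R)].

Lemma powR_le (al a b : R) : 0 <= al -> 0 <= a -> a <= b -> a `^ al <= b `^ al.
Proof. by move=> al0 a0 ab; apply: ge0_ler_powR => //; rewrite nnegrE// (le_trans a0). Qed.

(** For a <= eta one has b <= 2 eta, whose power is exactly e. For larger a, enlarging a by the
    factor (1 + e1)^(1/al) multiplies its power by 1 + e1. *)
Lemma powR_unif_continuous (al M e : R) : 0 < al -> 0 < e -> exists2 d, 0 < d &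
  forall a b, 0 <= a <= M -> 0 <= b <= a + d -> b `^ al <= a `^ al + e.
Proof.
move=> al0 e0; have al1 : al^-1 * al = 1 by rewrite mulVf// gt_eqF.
have P (t : R) : 0 <= t -> (t `^ al^-1) `^ al = t by move=> t0; rewrite -powRrM al1 powRr1.
pose eta := e `^ al^-1 / 2.
have eta0 : 0 < eta by rewrite divr_gt0// powR_gt0.
pose e1 := e / (M `^ al + 1).
have M1 : 0 < M `^ al + 1 by rewrite ltr_wpDl// powR_ge0.
have e10 : 0 < e1 by rewrite divr_gt0.
have b1 : 1 < (1 + e1) `^ al^-1.
  have E1 : (1 : R) `^ al^-1 = 1 by rewrite powR1.
  by rewrite -E1; apply: gt0_ltr_powR; rewrite ?invr_gt0 ?nnegrE//; lra.
pose d1 := eta * ((1 + e1) `^ al^-1 - 1).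
have d10 : 0 < d1 by rewrite mulr_gt0// subr_gt0.
exists (Num.min eta d1); first by rewrite lt_min eta0.
move=> a b /andP[a0 aM] /andP[b0 bd].
have [ae|ea] := leP a eta.
  apply: (@le_trans _ _ ((2 * eta) `^ al)).
    apply: powR_le => //; first exact: ltW.
    apply: le_trans bd _; have : Num.min eta d1 <= eta by rewrite ge_min lexx.
    by move: ae; move: (Num.min _ _) => t; lra.
  by rewrite /eta mulrCA divff// mulr1 P ?(ltW e0)// lerDr powR_ge0.
apply: (@le_trans _ _ ((a * (1 + e1) `^ al^-1) `^ al)).
  apply: powR_le => //; first exact: ltW.
  apply: le_trans bd _; have : Num.min eta d1 <= d1 by rewrite ge_min lexx orbT.
  have : d1 <= a * ((1 + e1) `^ al^-1 - 1) by rewrite ler_wpM2r ?(ltW ea)// subr_ge0 ltW.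
  by move: (Num.min _ _) => t; lra.
rewrite powRM ?powR_ge0// P; last by lra.
rewrite mulrDr mulr1 lerD2l; apply: (@le_trans _ _ (M `^ al * e1)).
  by rewrite ler_wpM2r ?(ltW e10)// powR_le// ltW.
rewrite /e1 mulrCA ler_piMr ?(ltW e0)// ler_pdivrMr// mul1r lerDl ler01//.
Qed.

Lemma poly_lipschitz (p : {poly C}) : exists L : R, 0 <= L /\ forall z w : C,
  cmod z <= 1 -> cmod w <= 1 -> cmod p.[z] <= L /\ cmod (p.[z] - p.[w]) <= L * cmod (z - w).
Proof.
elim/poly_ind: p => [|p c [L [L0 IH]]].
  by exists 0; split => // z w _ _; rewrite !horner0 subrr cmod0 mul0r lexx.
exists (2 * L + cmod c); split; first by rewrite addr_ge0 ?cmod_ge0// mulr_ge0.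
move=> z w z1 w1; have [h1 h2] := IH z w z1 w1; rewrite !hornerMXaddC; split.
  apply: le_trans (cmodD _ _) _; rewrite lerD2r cmodM.
  have := cmod_ge0 z; have := cmod_ge0 p.[z]; nra.
have -> : p.[z] * z + c - (p.[w] * w + c) = p.[z] * (z - w) + (p.[z] - p.[w]) * w by ring.
apply: le_trans (cmodD _ _) _; rewrite !cmodM.
have := cmod_ge0 (z - w); have := cmod_ge0 c; have := cmod_ge0 p.[z].
have := cmod_ge0 w; have := cmod_ge0 (p.[z] - p.[w]).
move: h1 h2 w1 L0; clear.
move: (cmod p.[z]) (cmod (z - w)) (cmod (_ - _)) (cmod w) (cmod c) => s t v y u.
move=> h1 h2 w1 L0 v0 y0 s0 u0 t0.
have : s * t <= L * t by rewrite ler_wpM2r.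
have : v * y <= L * t * 1 by rewrite ler_pM.
have : 0 <= u * t by rewrite mulr_ge0.
lra.
Qed.

Lemma avoid_seq (s : seq R) (a b : R) : a < b -> exists x, a < x < b /\ x \notin s.
Proof.
move=> ab; suff [a' [b' [h1 h2 h3 h4]]] : exists a' b', [/\ a <= a', a' < b', b' <= b &
    forall x, x \in s -> ~~ (a' < x < b')].
  exists ((a' + b') / 2); split; first by apply/andP; split; lra.
  by apply/negP => /h4 /negP; apply; apply/andP; split; lra.
elim: s => [|r s [a' [b' [h1 h2 h3 h4]]]]; first by exists a, b; split.
have [/andP[r1 r2]|nr] := boolP (a' < r < b').
  exists r, b'; split => //; first lra.
  move=> x; rewrite in_cons => /orP[/eqP ->|/h4]; first by rewrite ltxx.
  by apply: contra => /andP[x1 x2]; rewrite x2 (lt_trans r1).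
by exists a', b'; split => // x; rewrite in_cons => /orP[/eqP ->|/h4].
Qed.

Lemma pow_gap (r x : R) : 0 <= r -> 0 < x -> r != x ->
  exists N0 : nat, forall N, (N0 <= N)%N -> r ^+ N / 2 <= `|r ^+ N - x ^+ N|.
Proof.
move=> r0 x0 rx; have half : 0 < 2^-1 :> R by rewrite invr_gt0.
have [xr|rx'] := ltP x r.
  have rp : 0 < r by lra.
  have q1 : 0 <= x / r < 1 by rewrite divr_ge0 ?(ltW x0)//= ltr_pdivrMr// mul1r.
  have [N0 h] := small_expr q1 half; exists N0 => N /h.
  rewrite expr_div_n ler_pdivrMr ?exprn_gt0// => hN.
  have rN : 0 <= r ^+ N by rewrite exprn_ge0.
  by rewrite ger0_norm; lra.
have {rx'} rx' : r < x by rewrite lt_neqAle rx.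
have q1 : 0 <= r / x < 1 by rewrite divr_ge0 ?(ltW x0)//= ltr_pdivrMr// mul1r.
have [N0 h] := small_expr q1 half; exists N0 => N /h.
rewrite expr_div_n ler_pdivrMr ?exprn_gt0// => hN.
have rN : 0 <= r ^+ N by rewrite exprn_ge0.
by rewrite ler0_norm; lra.
Qed.

Lemma pow_gap_seq (s : seq R) (x : R) : (forall r, r \in s -> 0 <= r) -> 0 < x -> x \notin s ->
  exists N0 : nat, forall N, (N0 <= N)%N -> forall r, r \in s -> r ^+ N / 2 <= `|r ^+ N - x ^+ N|.
Proof.
move=> s0 x0; elim: s s0 => [|r s IH] s0; first by exists 0%N.
rewrite in_cons negb_or => /andP[xr xs].
have [|N1 h1] := IH _ xs; first by move=> t ts; apply: s0; rewrite in_cons ts orbT.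
have r0 : 0 <= r by apply: s0; rewrite in_cons eqxx.
rewrite eq_sym in xr; have [N2 h2] := pow_gap r0 x0 xr.
exists (maxn N1 N2) => N; rewrite geq_max => /andP[n1 n2] t.
by rewrite in_cons => /orP[/eqP ->|]; [exact: h2|exact: h1].
Qed.

Lemma prod_wroot N (x r : C) : (0 < N)%N -> x != 0 ->
  cmod (\prod_(k < N) (x * wroot R N ^+ k - r)) = cmod (r ^+ N - x ^+ N).
Proof.
move=> N0 x0.
have h : (r / x) ^+ N - 1 = \prod_(k < N) (r / x - wroot R N ^+ k).
  rewrite -(hornerXn (r / x)) -[X in _ - X](hornerC 1 (r / x)) -hornerN -hornerD.
  rewrite -(factor_Xn_sub_1 (prim_wroot R N0)) big_mkord horner_prod.
  by apply: eq_bigr => k _; rewrite hornerXsubC.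
have -> : r ^+ N - x ^+ N = x ^+ N * ((r / x) ^+ N - 1).
  by rewrite mulrBr -exprMn mulrCA divff// !mulr1.
rewrite h -[X in x ^+ X](card_ord N) -prodr_const -big_split/=.
rewrite !cmod_prod; apply: eq_bigr => k _.
by rewrite mulrBr mulrCA divff// mulr1 cmod_distrC.
Qed.

(** Discrete Jensen inequality: over N equidistant points of radius x, the product of |p| is
    |lead|^N times the factors |r^N - x^N| for the roots r, and each of these is eventually at least
    |r|^N / 2 if x is not |r|. The freedom in ]a, b[ serves to avoid the moduli of the roots. *)
Lemma discrete_jensen (p : {poly C}) (a b : R) : 0 <= a -> a < b ->
  exists x, a < x < b /\ exists (d N0 : nat), forall N, (N0 <= N)%N -> (0 < N)%N ->
    cmod p.[0] ^+ N / 2 ^+ d <= \prod_(k < N) cmod (p.[(x%:C)%C * wroot R N ^+ k] : C).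
Proof.
move=> a0 ab; have [rs pE] := closed_field_poly_normal p.
have [x [/andP[ax xb] xs]] := @avoid_seq (map (@cmod R) rs) a b ab.
have x0 : 0 < x by lra.
exists x; split; first by rewrite ax.
have [|N0 h] := @pow_gap_seq (map (@cmod R) rs) x _ x0 xs.
  by move=> _ /mapP[r _ ->]; exact: cmod_ge0.
exists (size rs), N0 => N N0N N1.
have xC : (x%:C)%C != 0 :> C by rewrite -cmod_gt0 cmod_real normr_gt0 gt_eqF.
have pz (z : C) : p.[z] = lead_coef p * \prod_(r <- rs) (z - r).
  rewrite {1}pE hornerZ horner_prod; congr (_ * _); apply: eq_bigr => r _.
  by rewrite hornerXsubC.
have -> : \prod_(k < N) cmod (p.[(x%:C)%C * wroot R N ^+ k] : C) =
    cmod (lead_coef p) ^+ N * \prod_(r <- rs) cmod (r ^+ N - (x%:C)%C ^+ N).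
  transitivity (cmod (\prod_(k < N) (lead_coef p * \prod_(r <- rs) ((x%:C)%C * wroot R N ^+ k - r)) : C)).
    by rewrite cmod_prod; apply: eq_bigr => k _; rewrite pz.
  rewrite big_split/= prodr_const card_ord exchange_big/= cmodM cmodX cmod_prod.
  by congr (_ * _); apply: eq_bigr => r _; rewrite prod_wroot.
rewrite pz cmodM cmod_prod exprMn -mulrA ler_wpM2l ?exprn_ge0 ?cmod_ge0//.
rewrite -prodrXl.
have -> : (2 ^+ size rs)^-1 = \prod_(r <- rs) 2^-1 :> R.
  by rewrite big_const_seq count_predT iter_mulr_1 exprVn.
rewrite -big_split/= big_seq [leRHS]big_seq; apply: ler_prod => r rrs; rewrite sub0r cmodN.
rewrite mulr_ge0 ?exprn_ge0 ?cmod_ge0 ?invr_ge0//=.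
apply: le_trans (h N N0N _ (map_f _ rrs)) _.
rewrite ler_norml; apply/andP; split.
  have := cmod_lower ((x%:C)%C ^+ N) (r ^+ N); rewrite cmod_distrC !cmodX cmod_real ger0_norm ?(ltW x0)//; lra.
by have := cmod_lower (r ^+ N) ((x%:C)%C ^+ N); rewrite !cmodX cmod_real ger0_norm ?(ltW x0).
Qed.

Lemma prod_powR (I : finType) (F : I -> R) al : (forall i, 0 <= F i) ->
  \prod_i (F i `^ al) = (\prod_i F i) `^ al.
Proof.
move=> F0; suff [] : \prod_i (F i `^ al) = (\prod_i F i) `^ al /\ 0 <= \prod_i F i by [].
apply: (big_rec2 (fun a b => a = b `^ al /\ 0 <= b)); first by rewrite powR1.
by move=> i a b _ [-> b0]; rewrite powRM// mulr_ge0.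
Qed.

(** AM-GM turns the product bound into one for the mean of |p|^al; the fixed factor 2^(-d al) is
    harmless because its N-th root tends to 1. *)
Lemma discrete_submean (p : {poly C}) (a b al e : R) : 0 < al -> 0 <= a -> a < b -> 0 < e ->
  exists x, a < x < b /\ exists N0 : nat, forall N, (N0 <= N)%N -> (0 < N)%N ->
    cmod p.[0] `^ al - e <=
    N%:R^-1 * \sum_(k < N) cmod (p.[(x%:C)%C * wroot R N ^+ k] : C) `^ al.
Proof.
move=> al0 a0 ab e0; have [x [xab [d [N0 h]]]] := discrete_jensen p a0 ab.
exists x; split => //; pose v := cmod p.[0] `^ al.
have [ve|ev] := leP v e.
  exists 0%N => N _ _; apply: (@le_trans _ _ 0); first by rewrite -/v; lra.
  by rewrite mulr_ge0 ?invr_ge0// sumr_ge0// => k _; exact: powR_ge0.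
have v0 : 0 < v by lra.
have q1 : 0 <= (v - e) / v < 1.
  by rewrite divr_ge0/= ?ltr_pdivrMr ?mul1r//; lra.
have t0 : 0 < (2 ^+ d)^-1 `^ al / 2 :> R by rewrite divr_gt0// powR_gt0// invr_gt0 exprn_gt0.
have [N1 h1] := small_expr q1 t0.
exists (maxn N0 N1) => N; rewrite geq_max => /andP[n0 n1] N0'.
rewrite -/v leNgt; apply/negP => lt.
set S := \sum_(k < N) _ in lt.
have S0 : 0 <= S by apply: sumr_ge0 => k _; exact: powR_ge0.
have := @leif_AGM R 'I_N predT (fun k => cmod (p.[(x%:C)%C * wroot R N ^+ k] : C) `^ al)
  (fun k _ => powR_ge0 _ _).
move=> [+ _]; rewrite cardT size_enum_ord -/S prod_powR; last by move=> k; exact: cmod_ge0.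
apply/negP; rewrite -ltNge.
apply: (@lt_le_trans _ _ ((v - e) ^+ N)).
  rewrite ltr_pXn2r ?nnegrE ?divr_ge0//; [by rewrite mulrC|lra].
apply: (@le_trans _ _ ((cmod p.[0] ^+ N / 2 ^+ d) `^ al)); last first.
  by apply: powR_le; [exact: ltW| |exact: h]; rewrite divr_ge0 ?exprn_ge0 ?cmod_ge0.
rewrite powRM ?invr_ge0 ?exprn_ge0 ?cmod_ge0//.
have -> : (cmod p.[0] ^+ N) `^ al = v ^+ N.
  rewrite -(powR_mulrn N (cmod_ge0 p.[0])) -(powR_mulrn N (powR_ge0 (cmod p.[0]) al)).
  by rewrite -!powRrM [al * _]mulrC.
have := h1 N n1; rewrite expr_div_n ler_pdivrMr ?exprn_gt0// => h2.
apply: le_trans h2 _; rewrite mulrC ler_wpM2l ?exprn_ge0 ?(ltW v0)//.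
by move: t0; clear; lra.
Qed.

Lemma cis_lipschitz (e : R) : 0 < e -> exists2 d, 0 < d & forall t t' : R,
  `|t' - t| < d -> cmod (cis t' - cis t) < e.
Proof.
move=> e0; have [d d0 h] := cis_continuous 0 e0; exists d => // t t' tt.
have -> : cis t' - cis t = cis t * (cis (t' - t) - cis 0).
  by rewrite cis0 mulrBr mulr1 -cisD [t + _]addrC subrK.
by rewrite cmodM cmod_cis mul1r; apply: h; rewrite subr0.
Qed.

Lemma integral_ge_steps (g : R -> R) (h : R) (c : nat -> R) N : usc1 g -> (forall s, 0 <= g s) ->
  0 <= h -> (forall k t, (k < N)%N -> k%:R * h < t <= k.+1%:R * h -> c k <= g t) ->
  ((h * \sum_(k < N) c k)%:E <= \int[mu]_(t in `]0%R, (N%:R * h)%R]) (g t)%:E)%E.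
Proof.
move=> ug g0 h0; elim: N => [|N IH] hc.
  by rewrite big_ord0 mulr0; apply: integral_ge0 => t _; rewrite lee_fin.
rewrite (@integral_itv_split R g 0 (N%:R * h) (N.+1%:R * h) ug g0); last 2 first.
- by rewrite mulr_ge0.
- by rewrite ler_wpM2r// ler_nat.
rewrite big_ord_recr/= mulrDr EFinD; apply: leeD; first by apply: IH => k t kN; apply: hc; exact: ltnW.
have ml : mu [set` `](N%:R * h), (N.+1%:R * h)]] = h%:E.
  rewrite lebesgue_measure_itv/= lte_fin -natr1 mulrDl mul1r; case: ltP => [_|hh].
    by rewrite -EFinB; congr EFin; ring.
  by congr EFin; lra.
have mg := @usc1_measurable R [set` `](N%:R * h), (N.+1%:R * h)]] g ug.
have [c0|/ltW c0] := leP (c N) 0.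
  apply: (@le_trans _ _ 0%E); first by rewrite lee_fin mulr_ge0_le0.
  by apply: integral_ge0 => t _; rewrite lee_fin.
apply: (@le_trans _ _ (\int[mu]_(t in `](N%:R * h)%R, (N.+1%:R * h)%R]) (c N)%:E)%E).
  rewrite (integral_cst mu (measurable_itv _) (c N)%:E).
  by rewrite [X in (_ <= _ * X)%E](_ : _ = h%:E); [rewrite -EFinM mulrC|exact: ml].
apply: ge0_le_integral => //.
by move=> t; rewrite /= in_itv /= lee_fin; exact: hc.
Qed.

Lemma usc1_poly_circle (p : {poly C}) al : 0 < al -> usc1 (fun t => cmod (p.[cis t] : C) `^ al).
Proof.
move=> al0 t c hc; have [L [L0 hL]] := poly_lipschitz p.
have e0 : 0 < (c - cmod (p.[cis t] : C) `^ al) / 2 by lra.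
have [d1 d10 h1] := powR_unif_continuous (cmod (p.[cis t] : C)) al0 e0.
have e1 : 0 < d1 / (L + 1) by rewrite divr_gt0// ltr_wpDl.
have [d d0 h] := cis_lipschitz e1; exists d => // s /h hs.
have cs u : cmod (cis u : C) <= 1 by rewrite cmod_cis.
apply: (@le_lt_trans _ _ (cmod (p.[cis t] : C) `^ al + (c - cmod (p.[cis t] : C) `^ al) / 2)); last by lra.
apply: h1; rewrite cmod_ge0 ?lexx//=.
have [_ h2] := hL _ _ (cs s) (cs t); have := cmod_lower (p.[cis s] : C) (p.[cis t] : C).
move: hs; rewrite ltr_pdivlMr ?ltr_wpDl// => hs.
have := cmod_ge0 (cis s - cis t : C); move: hs h2 L0; clear.
by move: (cmod _) (cmod _) (cmod _) (cmod _) => u v w y; nra.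
Qed.

Theorem submean_poly (p : {poly C}) (al : R) : 0 < al ->
  ((2 * pi * cmod p.[0] `^ al)%:E <= \int[mu]_(t in I2pi) (cmod (p.[cis t] : C) `^ al)%:E)%E.
Proof.
move=> al0; pose g t := cmod (p.[cis t] : C) `^ al.
have ug : usc1 g by exact: (@usc1_poly_circle p al al0).
have g0 t : 0 <= g t by exact: powR_ge0.
apply: (@le_trans _ _ (\int[mu]_(t in `]0%R, (2 * pi)%R]) (g t)%:E)%E); last first.
  apply: ge0_subset_integral => //.
  - exact: (@usc1_measurable R I2pi g ug).
  - by move=> t _; rewrite lee_fin.
  - by move=> t; rewrite /= !in_itv /= => /andP[/ltW -> ->].
have pi0 := @pi2_gt0 R.
apply/lee_addgt0Pr => e e0; pose e1 := e / (2 * pi) / 2.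
have e10 : 0 < e1 by rewrite !divr_gt0.
have [L [L0 hL]] := poly_lipschitz p.
have [d d0 hd] := powR_unif_continuous L al0 e10.
have L1 : 0 < L + 1 by lra.
have d20 : 0 < d / (L + 1) / 2 by rewrite !divr_gt0.
have [d' d'0 hd'] := cis_lipschitz d20.
(* The radius 1 may be the modulus of a root, so points of radius x < 1 are sampled. Half of the
   tolerance d / (L + 1) pays for 1 - x, the other half for the angular step. *)
have a1 : Num.max 0 (1 - d / (L + 1) / 2) < 1 by rewrite gt_max ltr01/=; lra.
have a0 : 0 <= Num.max 0 (1 - d / (L + 1) / 2) by rewrite le_max lexx.
have [x [/andP[xa x1] [N0 hN]]] := discrete_submean p al0 a0 a1 e10.
have {xa} [x0 xd] : 0 < x /\ 1 - d / (L + 1) / 2 < x by move: xa; rewrite gt_max => /andP[].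
pose N := (maxn N0 (Num.truncn (2 * pi / d'))).+1.
have Nh : 2 * pi / N%:R < d'.
  rewrite ltr_pdivrMr ?ltr0n// [d' * _]mulrC -ltr_pdivrMr//; apply: lt_le_trans (truncnS_gt _) _.
  by rewrite ler_nat /N ltnS leq_maxr.
have {}hN := hN N (leqW (leq_maxl _ _)) isT.
pose h : R := 2 * pi / N%:R; have h0 : 0 < h by rewrite divr_gt0// ltr0n.
have Nh1 : N%:R * h = 2 * pi by rewrite mulrC divfK// pnatr_eq0.
pose c k := cmod (p.[(x%:C)%C * wroot R N ^+ k] : C) `^ al - e1.
have := @integral_ge_steps g h c N ug g0 (ltW h0) _; rewrite Nh1 => step.
have {step} : ((h * \sum_(k < N) c k)%:E <= \int[mu]_(t in `]0%R, (2 * pi)%R]) (g t)%:E)%E.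
  apply: step => k t kN /andP[t1 t2].
  rewrite /c; have -> : wroot R N ^+ k = cis (k%:R * h) by rewrite /wroot cisXn -[pi *+ 2]mulr_natl.
  have b1 : cmod (cis t : C) <= 1 by rewrite cmod_cis.
  have b2 : cmod ((x%:C)%C * cis (k%:R * h) : C) <= 1.
    by rewrite cmodM cmod_cis mulr1 cmod_real ger0_norm ltW.
  rewrite lerBlDr; apply: hd.
    by rewrite cmod_ge0; have [] := hL _ _ b1 b1.
  rewrite cmod_ge0/=; have [_] := hL _ _ b2 b1.
  have := cmod_lower (p.[(x%:C)%C * cis (k%:R * h)] : C) (p.[cis t] : C).
  have : cmod ((x%:C)%C * cis (k%:R * h) - cis t : C) <= d / (L + 1).
    have -> : (x%:C)%C * cis (k%:R * h) - cis t = - (((1 - x)%:C)%C * cis (k%:R * h)) + (cis (k%:R * h) - cis t) :> C.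
      by rewrite rmorphB rmorph1; ring.
    apply: le_trans (cmodD _ _) _; rewrite cmodN cmodM cmod_cis mulr1 cmod_real ger0_norm; last by lra.
    have : cmod (cis (k%:R * h) - cis t : C) < d / (L + 1) / 2.
      by apply: hd'; rewrite distrC ger0_norm; move: t1 t2 Nh; rewrite -natr1 mulrDl mul1r -/h; lra.
    by lra.
  rewrite ler_pdivlMr//; have := cmod_ge0 ((x%:C)%C * cis (k%:R * h) - cis t : C); move: L0; clear.
  by move: (cmod _) (cmod _) (cmod _) (cmod _) => u v w y; nra.
move=> H; apply: le_trans (leeD H (lexx e%:E)); rewrite -EFinD lee_fin.
rewrite /c sumrB sumr_const card_ord -[e1 *+ N]mulr_natl mulrBr.
have -> : h * (N%:R * e1) = e / 2.
  by rewrite mulrA [h * _]mulrC Nh1 /e1; field; rewrite gt_eqF//; move: pi0; lra.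
move: hN; rewrite mulrC ler_pdivlMr ?ltr0n// => hN.
have : h * ((cmod p.[0] `^ al - e1) * N%:R) <= h * \sum_(k < N) cmod (p.[(x%:C)%C * wroot R N ^+ k] : C) `^ al.
  by rewrite ler_wpM2l// ltW.
have -> : h * ((cmod p.[0] `^ al - e1) * N%:R) = 2 * pi * cmod p.[0] `^ al - e / 2.
  rewrite mulrCA [h * _]mulrC Nh1 /e1; field; rewrite gt_eqF//; move: pi0; lra.
lra.
Qed.

End SubmeanPolynomial.

(** * Quasi-homogeneous polynomials *)

Section QuasiHomogeneous.
Variables (R : realType) (n : nat).
Local Notation C := (R[i]).
Local Notation V := (Cn R n).
Implicit Types (lam : 'I_n -> R) (z w : V).

(** Balls of [Cn] have their radii in C; a positive element of C is real, which allows the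
    translation to real radii. *)
Lemma nbhs_Cn z (A : set V) :
  nbhs z A <-> exists2 d : R, 0 < d & forall w, (forall k, cmod (w ord0 k - z ord0 k : C) < d) -> A w.
Proof.
split.
  move=> /nbhs_ballP[e /= e0 h]; have eR : e = ((complex.Re e)%:C)%C.
    by apply/esym/RRe_real; rewrite gtr0_real.
  exists (complex.Re e); first by move: e0; rewrite {1}eR ltcR.
  move=> w hw; apply: h; split; first exact: e0.
  move=> i j; rewrite (ord1 i) /ball /= -cmodC [X in _ < X]eR ltcR cmod_distrC.
  exact: hw.
move=> [d d0 h]; apply/nbhs_ballP; exists (d%:C)%C => /=; first by rewrite ltcR.
move=> w [_ hw]; apply: h => k; have := hw ord0 k.
by rewrite /ball /= -cmodC ltcR cmod_distrC.
Qed.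

Lemma compact_uniform (K : set V) (P : R -> V -> Prop) : compact K ->
  (forall d d' z, d' <= d -> P d z -> P d' z) ->
  (forall z, K z -> exists d, 0 < d /\
     forall w, (forall k, cmod (w ord0 k - z ord0 k : C) < d) -> P d w) ->
  exists d, 0 < d /\ forall z, K z -> P d z.
Proof.
move=> /compact_near_coveringP cov Pd hP.
have := cov R (0^'+) (fun e z => P e z) _ _; case.
  move=> z /hP[d [d0 h]]; exists ([set w | P d w], [set e | 0 < e /\ e < d]).
    split => /=; first by apply/nbhs_Cn; exists d.
    by near=> e; split; near: e; [exact: nbhs_right_gt|exact: nbhs_right_lt].
  by move=> [w e] /= [Pw [e0 ed]]; exact: Pd (ltW ed) Pw.
move=> d /= d0 hd; exists (d / 2); have d20 : 0 < d / 2 by lra.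
split => // z Kz; apply: (hd (d / 2)) => //=.
by rewrite /ball /= sub0r normrN ger0_norm ?ltW// ltr_pdivrMr// ltr_pMr// ltr1n.
Unshelve. all: by end_near. Qed.

Lemma compact_bounded_coord (K : set V) : compact K ->
  exists2 B : R, 0 < B & forall z k, K z -> cmod (z ord0 k) <= B.
Proof.
move=> cK.
have [|z _|d [d0 hd]] := @compact_uniform K (fun d z => forall k, cmod (z ord0 k) * d <= 1) cK.
- by move=> d d' z dd' h k; apply: le_trans (h k); rewrite ler_wpM2l// cmod_ge0.
- pose S := \sum_k cmod (z ord0 k).
  have S0 : 0 <= S by apply: sumr_ge0 => k _; exact: cmod_ge0.
  have S2 : 0 < S + 2 by lra.
  exists (S + 2)^-1; split => [|w hw k]; first by rewrite invr_gt0.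
  rewrite ler_pdivrMr// mul1r.
  have : cmod (z ord0 k) <= S.
    by rewrite /S (bigD1 k)//= lerDl sumr_ge0// => j _; exact: cmod_ge0.
  have := cmod_lower (w ord0 k) (z ord0 k); have := hw k.
  have : (S + 2)^-1 <= 1 by rewrite invf_le1//; lra.
  lra.
exists d^-1; first by rewrite invr_gt0.
by move=> z k /hd/(_ k); rewrite -ler_pdivlMr// mul1r.
Qed.

(** The frequencies are arbitrary reals. The sum is multiplied by the conjugate character of t0 and
    averaged over T + 1 equidistant angles; the other frequencies contribute geometric sums bounded
    independently of T. *)
Lemma trig_coef (J : finType) (x : J -> C) (tau : J -> R) (M t0 : R) :
  (forall th, cmod (\sum_j x j * cis (tau j * th)) <= M) ->
  cmod (\sum_(j | tau j == t0) x j) <= M.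
Proof.
move=> hM; pose s := \sum_j `|tau j - t0| + 1.
have s0 : 0 < s by rewrite ltr_wpDl// sumr_ge0.
have pi0 := @pi_gt0 R.
(* Every |tau_j - t0| h is below pi, so no other frequency is confused with t0 on this grid of
   angles. *)
pose h := pi / s; have h0 : 0 < h by rewrite divr_gt0.
pose om j : C := cis ((tau j - t0) * h).
have om1 j : tau j != t0 -> om j != 1.
  move=> tj; have ts : `|tau j - t0| < s.
    by rewrite /s (bigD1 j)//= -addrA ltrDl ltr_wpDl// sumr_ge0.
  have lt : `|tau j - t0| * h < pi *+ 2.
    rewrite /h mulrCA mulr2n; apply: (@lt_le_trans _ _ (pi * 1)); last by lra.
    by rewrite ltr_pM2l// ltr_pdivrMr// mul1r.
  rewrite /om; have [pos|neg] := leP 0 (tau j - t0).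
    have p0 : 0 < tau j - t0 by rewrite lt_def subr_eq0 tj pos.
    apply: cis_eq1; rewrite mulr_gt0//=.
    by move: lt; rewrite ger0_norm.
  have : cis (- (tau j - t0) * h) != 1.
    by apply: cis_eq1; rewrite mulr_gt0 ?oppr_gt0//= -(ltr0_norm neg).
  apply: contra => /eqP E; rewrite mulNr; apply/eqP.
  have := cisD ((tau j - t0) * h) (- ((tau j - t0) * h)).
  by rewrite subrr cis0 E mul1r.
pose K := \sum_(j | tau j != t0) cmod (x j) * (2 / cmod (om j - 1)).
apply: (@le_of_le_div _ _ _ K) => T.
have T0 : 0 < T.+1%:R :> R by rewrite ltr0n.
have geo j : om j != 1 -> cmod (\sum_(k < T.+1) om j ^+ k) <= 2 / cmod (om j - 1).
  move=> oj; have d0 : 0 < cmod (om j - 1) by rewrite cmod_gt0 subr_eq0.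
  rewrite ler_pdivlMr// mulrC -cmodM -subrX1; apply: le_trans (cmodB _ _) _.
  by rewrite cmodX cmod1 /om cmod_cis expr1n.
have E : T.+1%:R * (\sum_(j | tau j == t0) x j) + \sum_(j | tau j != t0) x j * \sum_(k < T.+1) om j ^+ k =
    \sum_(k < T.+1) cis (- t0 * (k%:R * h)) * \sum_j x j * cis (tau j * (k%:R * h)) :> C.
  transitivity (\sum_j x j * \sum_(k < T.+1) om j ^+ k).
    rewrite [RHS](bigID (fun j => tau j == t0))/=; congr (_ + _).
    rewrite mulr_sumr; apply: eq_bigr => j /eqP tj; rewrite mulrC; congr (_ * _).
    rewrite (eq_bigr (fun=> 1)) => [|k _]; first by rewrite sumr_const card_ord.
    by rewrite /om tj subrr mul0r cis0 expr1n.
  under [RHS]eq_bigr do rewrite mulr_sumr.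
  rewrite exchange_big/=; apply: eq_bigr => j _; rewrite mulr_sumr; apply: eq_bigr => k _.
  by rewrite mulrCA -cisD /om cisXn; congr (_ * cis _); ring.
have B1 : cmod (T.+1%:R * (\sum_(j | tau j == t0) x j) + \sum_(j | tau j != t0) x j * \sum_(k < T.+1) om j ^+ k : C) <= T.+1%:R * M.
  rewrite E; apply: le_trans (cmod_sum _ _ _) _.
  rewrite mulr_natl -[X in M *+ X]card_ord -sumr_const; apply: ler_sum => k _.
  by rewrite cmodM cmod_cis mul1r.
have B2 : cmod (\sum_(j | tau j != t0) x j * \sum_(k < T.+1) om j ^+ k : C) <= K.
  apply: le_trans (cmod_sum _ _ _) _; apply: ler_sum => j tj; rewrite cmodM.
  by rewrite ler_wpM2l ?cmod_ge0//; apply: geo; exact: om1.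
have := cmod_lower (T.+1%:R * (\sum_(j | tau j == t0) x j)) (- \sum_(j | tau j != t0) x j * \sum_(k < T.+1) om j ^+ k : C).
rewrite opprK cmodN cmodM cmod_nat => B3.
rewrite -(ler_pM2l T0) mulrDr [T.+1%:R * (K / _)]mulrC divfK ?gt_eqF//.
by move: B1 B2 B3; lra.
Qed.

Lemma cexp_sum (I : Type) (r : seq I) (P : pred I) (F : I -> C) :
  cexp (\sum_(i <- r | P i) F i : C) = \prod_(i <- r | P i) (cexp (F i) : C).
Proof.
by elim/big_rec2: _ => [|i y x _ <-]; rewrite ?cexp0 ?cexpD.
Qed.

Definition wt lam (a : 'I_n -> nat) : R := \sum_k lam k * (a k)%:R.

Lemma cexp_flow lam (a : 'I_n -> nat) (t : C) :
  \prod_k (cexp (- ((lam k)%:C * t))%C : C) ^+ a k = cexp (- ((wt lam a)%:C * t))%C.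
Proof.
have -> : (- ((wt lam a)%:C * t))%C = \sum_k (a k)%:R * (- ((lam k)%:C * t))%C :> C.
  rewrite /wt (rmorph_sum (real_complex R)) mulr_suml -sumrN; apply: eq_bigr => k _.
  by rewrite (rmorphM (real_complex R)) (rmorph_nat (real_complex R)); ring.
by rewrite cexp_sum; apply: eq_bigr => k _; rewrite cexpXn.
Qed.

Lemma conj_cexp (w : C) : conjc (cexp w) = cexp (conjc w).
Proof. by case: w => s t; rewrite /cexp /= cosN sinN mulrN. Qed.

Lemma conjcM (x y : C) : conjc (x * y) = conjc x * conjc y.
Proof. by case: x y => [s t] [s' t'] /=; congr Complex; ring. Qed.

Lemma cexp_cis (s t : R) : cexp (s +i* t)%C = ((expR s)%:C)%C * cis t :> C.
Proof.
rewrite /cis /cexp /= expR0 !mul1r; apply/eqP; rewrite eq_complex /=.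
by apply/andP; split; apply/eqP; ring.
Qed.

Lemma monomial_flow lam (a b : 'I_n -> nat) z (s th : R) :
  \prod_k ((PhiX lam z (s +i* th)%C ord0 k) ^+ a k * (conjc (PhiX lam z (s +i* th)%C ord0 k)) ^+ b k) =
  (\prod_k ((z ord0 k) ^+ a k * (conjc (z ord0 k)) ^+ b k)) *
  ((expR (- (s * (wt lam a + wt lam b))))%:C)%C * cis (- (wt lam a - wt lam b) * th) :> C.
Proof.
have -> : \prod_k ((PhiX lam z (s +i* th)%C ord0 k) ^+ a k * (conjc (PhiX lam z (s +i* th)%C ord0 k)) ^+ b k) =
  \prod_k (((z ord0 k) ^+ a k * (conjc (z ord0 k)) ^+ b k) *
   ((cexp (- ((lam k)%:C * (s +i* th)))%C : C) ^+ a k * (cexp (- ((lam k)%:C * (s -i* th)))%C : C) ^+ b k)) :> C.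
  apply: eq_bigr => k _; rewrite !mxE.
  have -> : conjc (z ord0 k * cexp (- ((lam k)%:C * (s +i* th)))%C : C) =
    conjc (z ord0 k : C) * cexp (- ((lam k)%:C * (s -i* th)))%C :> C.
    rewrite conjcM conj_cexp; congr (_ * cexp _).
    by apply/eqP; rewrite eq_complex /=; apply/andP; split; apply/eqP; ring.
  by rewrite !exprMn; ring.
rewrite !big_split/= !cexp_flow -!mulrA; do 2 congr (_ * _).
rewrite -cexpD.
have -> : (- ((wt lam a)%:C * (s +i* th)) + - ((wt lam b)%:C * (s -i* th)))%C =
  ((- (s * (wt lam a + wt lam b))) +i* (- (wt lam a - wt lam b) * th))%C :> C.
  by apply/eqP; rewrite eq_complex /=; apply/andP; split; apply/eqP; ring.
exact: cexp_cis.
Qed.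

(** Terms are discarded by setting their coefficient to 0, hence a weight condition on nonzero
    coefficients only. *)
Definition monomials (q : V -> C) lam (rho : R) := exists (N : nat) (c : 'I_N -> C) (a : 'I_N -> 'I_n -> nat),
  (forall j, c j != 0 -> wt lam (a j) = rho) /\
  forall z, q z = \sum_(j < N) c j * \prod_k (z ord0 k) ^+ a j k.

(* Averaging over the imaginary flow kills the terms whose weights do not
   differ by [rho], and letting the real time tend to infinity kills those
   containing a conjugate variable. *)
Lemma quasi_hom_monomials lam (rho : R) (q : V -> C) : (forall k, 0 < lam k) ->
  quasi_hom lam rho 0 q -> monomials q lam rho.
Proof.
move=> lam0 [[N [c [a [b qE]]]] qh].
pose al j := wt lam (a j); pose be j := wt lam (b j).
exists N, (fun j => if (al j == rho) && [forall k, b j k == 0%N] then c j else 0), a.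
split; first by move=> j; case: ifP => [/andP[/eqP]//|_]; rewrite eqxx.
move=> z; pose m j : C := c j * \prod_k ((z ord0 k) ^+ a j k * (conjc (z ord0 k)) ^+ b j k).
have be0 j : 0 <= be j by apply: sumr_ge0 => k _; rewrite mulr_ge0// ltW.
have st (s : R) : 0 < s -> q z = \sum_(j | al j - be j == rho) m j * ((expR (- (2 * s * be j)))%:C)%C.
  move=> s0.
  (* [None] indexes the right-hand side of the homogeneity relation: the difference of both sides is
     a trigonometric sum that vanishes for all angles, so [trig_coef] applies with bound 0. *)
  pose x (o : option 'I_N) : C := if o is Some j then m j * ((expR (- (s * (al j + be j))))%:C)%C
    else - (((expR (- (s * rho)))%:C)%C * q z).
  pose tau (o : option 'I_N) : R := if o is Some j then - (al j - be j) else - rho.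
  have := @trig_coef _ x tau 0 (- rho) _.
  rewrite (bigD1 None)/= ?eqxx// (reindex_omap Some id)/=; last by case=> [//|]; rewrite ?eqxx ?andbF.
  move=> H; have {H} : cmod (x None + \sum_(j | al j - be j == rho) x (Some j)) <= 0.
    move: H => /(_ _); rewrite (eq_bigl (fun j => al j - be j == rho)); last first.
      by move=> j; rewrite /= eqxx andbT eqr_opp andbT.
    apply => th; rewrite (bigD1 None)/= ?eqxx// (reindex_omap Some id)/=; last by case=> [//|]; rewrite ?eqxx ?andbF.
    rewrite (eq_bigl xpredT); last by move=> j; rewrite /= eqxx.
    have Q : q (PhiX lam z (s +i* th)%C) = \sum_j m j * ((expR (- (s * (al j + be j))))%:C)%C *
        cis (- (al j - be j) * th) :> C.
      rewrite qE; apply: eq_bigr => j _; rewrite /m -!mulrA; congr (_ * _); rewrite mulrA.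
      exact: monomial_flow.
    have := qh (s +i* th)%C z s0; rewrite Q.
    have -> : cexp (- (rho%:C * (s +i* th)))%C = ((expR (- (s * rho)))%:C)%C * cis (- rho * th) :> C.
      rewrite -cexp_cis; congr cexp.
      by apply/eqP; rewrite eq_complex /=; apply/andP; split; apply/eqP; ring.
    have -> : cexp (- (0%:C * (s -i* th)))%C = 1 :> C by rewrite mul0r oppr0 cexp0.
    rewrite mulr1 => E.
    rewrite (_ : _ + _ = 0) ?cmod0//; apply/eqP; rewrite mulNr addrC subr_eq0; apply/eqP.
    by rewrite [RHS]mulrAC -E.
  move=> h; have {h} : x None + \sum_(j | al j - be j == rho) x (Some j) = 0.
    by apply/eqP; rewrite -cmod_eq0 eq_le h cmod_ge0.
  move=> /eqP; rewrite /x addrC subr_eq0 => /eqP E.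
  have e0 : ((expR (- (s * rho)))%:C)%C != 0 :> C.
    by rewrite -cmod_gt0 cmod_real normr_gt0 gt_eqF// expR_gt0.
  apply: (mulfI e0); rewrite -E mulr_sumr; apply: eq_bigr => j /eqP <-.
  rewrite mulrCA; congr (_ * _); rewrite -(rmorphM (real_complex R)) -expRD; congr (((expR _)%:C)%C).
  ring.
apply/eqP; rewrite -subr_eq0 -cmod_eq0 eq_le cmod_ge0 andbT.
(* From exp(-y) <= 1/y at y = 2 (T+1) be_j; positive weights make be_j > 0 as soon as a conjugate
   variable occurs. *)
pose K := \sum_(j | (al j - be j == rho) && ~~ [forall k, b j k == 0%N]) cmod (m j) / (2 * be j).
apply: (@le_of_le_div _ _ _ K) => T; rewrite add0r.
have T0 : 0 < T.+1%:R :> R by rewrite ltr0n.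
rewrite (st _ T0) (bigID (fun j => [forall k, b j k == 0%N]))/=.
rewrite addrAC [X in X - _ + _](_ : _ = \sum_j (if (al j == rho) && [forall k, b j k == 0%N] then c j else 0) *
   \prod_k z ord0 k ^+ a j k); last first.
  rewrite big_mkcond/=; apply: eq_bigr => j _.
  have [/forallP bj|_] := boolP [forall k, b j k == 0%N]; last by rewrite !andbF mul0r.
  have -> : be j = 0 by rewrite /be /wt big1// => k _; rewrite (eqP (bj k)) mulr0.
  rewrite subr0 !andbT; case: ifP => _; last by rewrite mul0r.
  rewrite mulr0 oppr0 expR0 mulr1 /m; congr (_ * _); apply: eq_bigr => k _.
  by rewrite (eqP (bj k)) expr0 mulr1.
rewrite subrr add0r; apply: le_trans (cmod_sum _ _ _) _.
rewrite /K mulr_suml; apply: ler_sum => j /andP[_ /forallPn[k bk]].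
have bj : 0 < be j.
  rewrite /be /wt (bigD1 k)//= ltr_pwDl//; first by rewrite mulr_gt0// ltr0n lt0n.
  by apply: sumr_ge0 => i _; rewrite mulr_ge0// ltW.
rewrite cmodM -!mulrA ler_wpM2l ?cmod_ge0// cmod_real ger0_norm ?expR_ge0//.
rewrite expRN -invfM lef_pV2 ?posrE ?expR_gt0 ?mulr_gt0//.
have r1 : 1 <= T.+1%:R :> R by rewrite ler1n.
apply: le_trans (expR_ge1Dx _); move: bj r1; move: (T.+1%:R : R) (be j) => r y; clear; nra.
Qed.

Lemma monomials_flow q lam rho : monomials q lam rho -> forall (t : C) z,
  q (PhiX lam z t) = cexp (- (rho%:C * t))%C * q z.
Proof.
move=> [N [c [a [cw qE]]]] t z; rewrite !qE mulr_sumr; apply: eq_bigr => j _.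
have [->|/cw E] := eqVneq (c j) 0; first by rewrite !mul0r mulr0.
rewrite mulrCA; congr (_ * _); rewrite -E -cexp_flow -big_split/=.
by apply: eq_bigr => k _; rewrite mxE exprMn mulrC.
Qed.

Definition toEnv z : nat -> C := fun k => if insub k is Some i then z ord0 i else 0.

Definition ofEnv (w : nat -> C) : V := \row_i w i.

Lemma toEnvE z (k : 'I_n) : toEnv z k = z ord0 k.
Proof. by rewrite /toEnv valK. Qed.

Lemma toEnvK z : ofEnv (toEnv z) = z.
Proof. by apply/rowP => k; rewrite mxE toEnvE. Qed.

Lemma monomials_pol q lam rho : monomials q lam rho -> pol (fun w : nat -> C => q (ofEnv w)).
Proof.
move=> [N [c [a [_ qE]]]]; under eq_fun do rewrite qE.
apply: pol_sum => j; apply: pol_mul; first exact: pol_cst.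
apply: pol_prod => k; under eq_fun do rewrite mxE.
by apply: pol_exp; exact: pol_var.
Qed.

Lemma monomials_line q lam rho z w : monomials q lam rho ->
  exists p : {poly C}, forall t : C, q (z + (t : CC R) *: w) = p.[t].
Proof.
move=> [N [c [a [_ qE]]]].
exists (\sum_(j < N) (c j)%:P * \prod_k ((z ord0 k : C)%:P + (w ord0 k : C) *: 'X) ^+ a j k) => t.
rewrite qE horner_sum; apply: eq_bigr => j _; rewrite hornerM hornerC horner_prod; congr (_ * _).
apply: eq_bigr => k _; rewrite horner_exp hornerD hornerC hornerZ hornerX !mxE.
by rewrite [t * _]mulrC.
Qed.

Lemma monomials_continuous q lam rho z (e : R) : monomials q lam rho -> 0 < e ->
  exists2 d : R, 0 < d & forall w, (forall k, cmod (w ord0 k - z ord0 k : C) < d) ->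
    cmod (q w - q z : C) < e.
Proof.
move=> mq e0; have [d d0 h] := pol_continuous (toEnv z) (monomials_pol mq) e0.
exists d => // w hw; have := h (toEnv w); rewrite !toEnvK; apply => k.
by rewrite /toEnv; case: insubP => [i _ _|_]; rewrite ?subrr ?cmod0.
Qed.

(** The submean inequality is that of a one-variable polynomial on each complex line. The point [z0]
    provides nonconstancy, since homogeneity of positive weight forces q(0) = 0. *)
Lemma H_lam_root lam (rho : R) (q : V -> C) z0 : 0 < rho -> monomials q lam rho ->
  q z0 != 0 -> H_lam lam (fun z => cmod (q z) `^ rho^-1).
Proof.
move=> rho0 mq qz0; have ir0 : 0 < rho^-1 by rewrite invr_gt0.
have hom := monomials_flow mq.
have v t z : cmod (q (PhiX lam z t)) `^ rho^-1 = expR (- complex.Re t) * cmod (q z) `^ rho^-1.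
  rewrite hom cmodM powRM ?cmod_ge0// cmod_cexp; congr (_ * _).
  rewrite -expRM; congr expR; case: t => x y /=; field; rewrite gt_eqF//.
split; first split.
- move=> z c hc; have e0 : 0 < (c - cmod (q z) `^ rho^-1) / 2 by lra.
  have [d d0 h] := powR_unif_continuous (cmod (q z)) ir0 e0.
  have [d' d'0 h'] := monomials_continuous z mq d0.
  apply/nbhs_Cn; exists d' => // w /h' hw.
  have := h (cmod (q z)) (cmod (q w)); rewrite !cmod_ge0 lexx /= => /(_ isT).
  have := cmod_lower (q w) (q z) => l1 l2.
  have := l2 _; rewrite (_ : _ <= _) ?(le_trans _ (ltW hw))//; last by lra.
  by move=> /(_ isT); lra.
- move=> a b; have [p pE] := monomials_line a b mq.
  have := submean_poly p ir0.
  have -> : cmod p.[0] = cmod (q a) by rewrite -pE scale0r addr0.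
  have -> : (fun th : R => (cmod (p.[cis th] : C) `^ rho^-1)%:E) =
      (fun th : R => (cmod (q (a + cexp (0 +i* th)%C *: b)) `^ rho^-1)%:E).
    by apply/funext => th; rewrite -pE.
  move=> h; have i2 : 0 < (2 * pi)^-1 :> R by rewrite invr_gt0 pi2_gt0.
  have := lee_wpmul2l (_ : (0 <= ((2 * pi)^-1)%:E)%E) h; rewrite lee_fin (ltW i2) => /(_ isT).
  by apply: le_trans; rewrite -EFinM mulrA mulVf ?mul1r// gt_eqF// pi2_gt0.
- by move=> z; exact: powR_ge0.
- exists z0, 0; rewrite gt_eqF//.
  have -> : q 0 = 0.
    have := hom 1 0; rewrite (_ : PhiX lam 0 1 = 0); last by apply/rowP => k; rewrite !mxE mul0r.
    move=> /eqP; rewrite -subr_eq0 -[X in X - _]mul1r -mulrBl mulf_eq0 => /orP[|/eqP//].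
    rewrite subr_eq0 => /eqP E; have := congr1 (@cmod R) E; rewrite cmod1 cmod_cexp mulr1 /=.
    move=> /esym/eqP; rewrite -[X in _ == X]expR0 (inj_eq (@expR_inj R)) oppr_eq0 => /eqP r0.
    by move: rho0; rewrite r0 ltxx.
  by rewrite cmod0 powR0 ?gt_eqF//; apply: powR_gt0; rewrite cmod_gt0.
- by move=> z t; exact: v.
Qed.

End QuasiHomogeneous.

(** * Separation by quasi-homogeneous components *)

Section Separation.
Variables (R : realType) (n : nat).
Local Notation C := (R[i]).
Local Notation V := (Cn R n).
Local Notation env := (nat -> R[i]).
Implicit Types (lam : 'I_n -> R) (z w p : V) (K : set V).

Lemma monomial_expansion (e : env -> C) : pol e ->
  exists (N : nat) (c : 'I_N -> C) (a : 'I_N -> 'I_n -> nat),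
    forall z, e (toEnv z) = \sum_(j < N) c j * \prod_k (z ord0 k : C) ^+ a j k.
Proof.
move=> [q ->]; pose mon (t : C * ('I_n -> nat)) z : C := t.1 * \prod_k (z ord0 k : C) ^+ t.2 k.
suff [s hs] : exists s : seq (C * ('I_n -> nat)), forall z, pev q (toEnv z) = \sum_(t <- s) mon t z.
  exists (size s), (fun j => (tnth (in_tuple s) j).1), (fun j => (tnth (in_tuple s) j).2) => z.
  by rewrite hs big_tnth.
elim: q => [c|i|q [s hs] q' [s' hs']|q [s hs] q' [s' hs']] /=.
- by exists [:: (c, fun=> 0%N)] => z; rewrite big_seq1 /mon /= big1 ?mulr1// => k _; rewrite expr0.
- have [lt|le] := ltnP i n; last first.
    by exists [::] => z; rewrite big_nil /toEnv insubN// -leqNgt.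
  exists [:: (1, fun k => nat_of_bool (k == Ordinal lt))] => z.
  rewrite big_seq1 /mon /= mul1r (bigD1 (Ordinal lt))//= eqxx expr1 big1 ?mulr1.
    exact: (toEnvE z (Ordinal lt)).
  by move=> k /negbTE ->; rewrite expr0.
- by exists (s ++ s') => z; rewrite big_cat/= hs hs'.
- exists [seq (t.1 * t'.1, fun k => (t.2 k + t'.2 k)%N) | t <- s, t' <- s'] => z.
  rewrite hs hs' big_distrl/= big_allpairs_dep; apply: eq_bigr => t _.
  rewrite big_distrr/=; apply: eq_bigr => t' _; rewrite /mon /=.
  have -> : \prod_k (z ord0 k : C) ^+ (t.2 k + t'.2 k) =
    (\prod_k (z ord0 k : C) ^+ t.2 k) * \prod_k (z ord0 k : C) ^+ t'.2 k.
    by rewrite -big_split/=; apply: eq_bigr => k _; rewrite exprD.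
  by ring.
Qed.

Lemma monomials_fin lam rho (I : finType) (P : pred I) (c : I -> C) (a : I -> 'I_n -> nat) :
  (forall i, P i -> wt lam (a i) = rho) ->
  monomials (fun z => \sum_(i | P i) c i * \prod_k (z ord0 k : C) ^+ a i k) lam rho.
Proof.
move=> h; exists #|I|, (fun j => if P (enum_val j) then c (enum_val j) else 0), (fun j => a (enum_val j)).
split; first by move=> j; case: ifP => [/h//|]; rewrite eqxx.
move=> z; rewrite big_mkcond/= (reindex (@enum_val I I))/=; last first.
  by apply: onW_bij; exact: enum_val_bij.
by apply: eq_big => [j|j _]; rewrite ?enum_valP//; case: ifP => // _; rewrite mul0r.
Qed.

Lemma wt_ge0 lam (a : 'I_n -> nat) : (forall k, 0 < lam k) -> 0 <= wt lam a.
Proof. by move=> l0; apply: sumr_ge0 => k _; rewrite mulr_ge0// ltW. Qed.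

Lemma monomials0 q lam z : (forall k, 0 < lam k) -> monomials q lam 0 -> q z = q 0.
Proof.
move=> l0 [N [c [a [cw qE]]]]; rewrite !qE; apply: eq_bigr => j _.
have [->|/cw/eqP E] := eqVneq (c j) 0; first by rewrite !mul0r.
congr (_ * _); apply: eq_bigr => k _; suff -> : a j k = 0%N by rewrite !expr0.
move: E; rewrite psumr_eq0 => [/allP/(_ k)|i _]; last by rewrite mulr_ge0// ltW.
rewrite mem_index_enum => /(_ isT) /=; rewrite mulf_eq0 gt_eqF//= pnatr_eq0.
by move/eqP.
Qed.

Lemma monomials_scale q lam rho (b : C) : monomials q lam rho -> monomials (fun z => b * q z) lam rho.
Proof.
move=> [N [c [a [cw qE]]]]; exists N, (fun j => b * c j), a; split.
  by move=> j bc; apply: cw; apply: contraNneq bc => ->; rewrite mulr0.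
by move=> z; rewrite qE mulr_sumr; apply: eq_bigr => j _; rewrite mulrA.
Qed.

Lemma monomials_quasi_hom q lam rho : monomials q lam rho -> quasi_hom lam rho 0 q.
Proof.
move=> mq; split; last first.
  by move=> t z _; rewrite (monomials_flow mq) mul0r oppr0 cexp0 mulr1.
have [N [c [a [_ qE]]]] := mq; exists N, c, a, (fun _ _ => 0%N) => z; rewrite qE.
by apply: eq_bigr => j _; congr (_ * _); apply: eq_bigr => k _; rewrite expr0 mulr1.
Qed.

Lemma pow_exp_bound N (r : R) : 0 <= r < 1 -> exists D : R, forall m, m.+1%:R ^+ N * r ^+ m <= D.
Proof.
elim: N r => [|N IH] r /andP[r0 r1].
  by exists 1 => m; rewrite expr0 mul1r exprn_ile1// ltW.
pose t := Num.sqrt r.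
have t0 : 0 <= t by exact: sqrtr_ge0.
have tt : t ^+ 2 = r by rewrite sqr_sqrtr.
have t1 : t < 1 by rewrite -sqrtr1 ltr_sqrt.
have [|D hD] := IH t; first by rewrite t0.
exists (D * (1 - t)^-1) => m.
have -> : m.+1%:R ^+ N.+1 * r ^+ m = (m.+1%:R ^+ N * t ^+ m) * (m.+1%:R * t ^+ m).
  by rewrite -tt -exprM mulnC exprM exprS; ring.
apply: ler_pM => //; rewrite ?mulr_ge0 ?exprn_ge0//.
have t1' : 0 < 1 - t by lra.
rewrite -[leRHS]mul1r ler_pdivlMr//.
have : 1 - t ^+ m.+1 <= 1 by rewrite lerBlDr lerDl exprn_ge0.
apply: le_trans.
have -> : 1 - t ^+ m.+1 = (\sum_(i < m.+1) t ^+ i) * (1 - t).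
  by rewrite -[LHS]opprB subrX1; ring.
rewrite ler_wpM2r ?(ltW t1')//.
rewrite mulr_natl -[X in _ *+ X](card_ord m.+1) -sumr_const; apply: ler_sum => i _.
by rewrite ler_wiXn2l// ?(ltW t1)// -ltnS.
Qed.

Lemma pow_lt_exp N (B A : R) : 0 <= B -> B < A -> exists m, m.+1%:R ^+ N * B ^+ m < A ^+ m.
Proof.
move=> B0 BA; have A0 : 0 < A by lra.
pose t := Num.sqrt (B / A).
have q0 : 0 <= B / A by rewrite divr_ge0// ltW.
have q1 : B / A < 1 by rewrite ltr_pdivrMr// mul1r.
have t0 : 0 <= t by exact: sqrtr_ge0.
have tt : t ^+ 2 = B / A by rewrite sqr_sqrtr.
have t1 : t < 1 by rewrite -sqrtr1 ltr_sqrt.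
have t01 : 0 <= t < 1 by rewrite t0.
have [D hD] := pow_exp_bound N t01.
have e0 : 0 < (2 * (`|D| + 1))^-1 by rewrite invr_gt0 mulr_gt0// ltr_wpDl.
have [m hm] := small_expr t01 e0; exists m.
have -> : B = t ^+ 2 * A by rewrite tt divfK// gt_eqF.
rewrite exprMn mulrA -[ltRHS]mul1r ltr_pM2r ?exprn_gt0//.
rewrite -exprM mulnC exprM expr2 mulrA.
have h1 := hD m; have h2 := hm m (leqnn _).
have tm : 0 <= t ^+ m by rewrite exprn_ge0.
apply: (@le_lt_trans _ _ ((`|D| + 1) * (2 * (`|D| + 1))^-1)).
  rewrite ler_pM// ?mulr_ge0 ?exprn_ge0//; apply: le_trans h1 _.
  by apply: le_trans (ler_norm _) _; rewrite lerDl.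
have d0 : 0 < `|D| + 1 by rewrite ltr_wpDl.
rewrite invfM mulrCA divff ?gt_eqF// mulr1; lra.
Qed.

(* The component of weight [s] of [e ^ m] is a Fourier coefficient of
   [e ^ m] along the imaginary flow. *)
Lemma separate_component lam K p (e : env -> C) (B : R) : pol e -> K 0 ->
  (forall z th, K z -> cmod (e (toEnv (PhiX lam z (0 +i* th)%C))) <= B) ->
  B < cmod (e (toEnv p)) ->
  exists sigma q (b : R), [/\ monomials q lam sigma, (forall z, K z -> cmod (q z) <= b),
    0 <= b & b < cmod (q p)].
Proof.
move=> pe K0 eB Bp; have [N [c [a eE]]] := monomial_expansion pe.
have B0 : 0 <= B by apply: le_trans (eB 0 0 K0); exact: cmod_ge0.
pose sg j := wt lam (a j).
(* The terms of e^m are indexed by the choice of one monomial in each factor; equal products are not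
   collected. *)
pose x m (f : {ffun 'I_m -> 'I_N}) z : C := \prod_i c (f i) * \prod_k (z ord0 k : C) ^+ (\sum_i a (f i) k).
pose W' m (f : {ffun 'I_m -> 'I_N}) := \sum_i sg (f i).
pose Q m s z := \sum_(f | @W' m f == s) @x m f z.
have wE m (f : {ffun 'I_m -> 'I_N}) : wt lam (fun k => \sum_i a (f i) k)%N = W' m f.
  rewrite /W' /sg /wt exchange_big/=; apply: eq_bigr => k _.
  by rewrite natr_sum mulr_sumr.
have eX m z : e (toEnv z) ^+ m = \sum_(f : {ffun 'I_m -> 'I_N}) x m f z.
  rewrite eE -[X in _ ^+ X](card_ord m) -prodr_const.
  rewrite (bigA_distr_bigA (fun _ j => c j * \prod_k (z ord0 k : C) ^+ a j k))/=.
  apply: eq_bigr => f _; rewrite big_split/=; congr (_ * _); rewrite exchange_big/=.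
  by apply: eq_bigr => k _; rewrite -expr_sum.
have mQ m s : monomials (Q m s) lam s.
  by apply: monomials_fin => f /eqP <-; exact: wE.
have QB m s z : K z -> cmod (Q m s z) <= B ^+ m.
  move=> Kz; rewrite (_ : Q m s z = \sum_(f | - W' m f == - s) x m f z); last first.
    by apply: eq_bigl => f; rewrite eqr_opp.
  apply: trig_coef => th.
  have := eB z th Kz; have := eX m (PhiX lam z (0 +i* th)%C).
  have -> : \sum_f x m f (PhiX lam z (0 +i* th)%C) = \sum_f x m f z * cis (- W' m f * th).
    apply: eq_bigr => f _; rewrite /x -mulrA; congr (_ * _).
    rewrite -wE.
    have -> : cis (- wt lam (fun k => \sum_i a (f i) k)%N * th) =
        cexp (- ((wt lam (fun k => \sum_i a (f i) k)%N)%:C * (0 +i* th)))%C.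
      by rewrite /cis; congr cexp; apply/eqP; rewrite eq_complex /=; apply/andP; split; apply/eqP; ring.
    rewrite -cexp_flow -big_split/=; apply: eq_bigr => k _.
    by rewrite mxE exprMn.
  move=> <- h; rewrite cmodX lerXn2r ?nnegrE ?cmod_ge0//.
apply: contrapT => H.
have {}H m s : cmod (Q m s p) <= B ^+ m.
  rewrite leNgt; apply/negP => lt; apply: H; exists s, (Q m s), (B ^+ m); split => //.
  - by move=> z; exact: QB.
  - by rewrite exprn_ge0.
have [m hm] := pow_lt_exp N B0 Bp.
suff : cmod (e (toEnv p)) ^+ m <= m.+1%:R ^+ N * B ^+ m by rewrite leNgt hm.
pose S := undup [seq W' m f | f : {ffun 'I_m -> 'I_N}].
have -> : cmod (e (toEnv p)) ^+ m = cmod (\sum_(s <- S) Q m s p).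
  rewrite -cmodX eX; congr (cmod _); rewrite /Q.
  rewrite (exchange_big_dep xpredT)//=; apply: eq_bigr => f _.
  rewrite -big_filter; have fS : W' m f \in S by rewrite mem_undup map_f// mem_enum.
  rewrite (_ : [seq s <- S | W' m f == s] = [:: W' m f]) ?big_seq1//.
  rewrite -(filter_pred1_uniq (undup_uniq _) fS); apply: eq_filter => s.
  by rewrite /= eq_sym.
apply: le_trans (cmod_sum _ _ _) _.
apply: le_trans (_ : \sum_(s <- S) B ^+ m <= _); first by apply: ler_sum => s _; exact: H.
rewrite big_const_seq count_predT iter_addr_0 -[_ *+ _]mulr_natl.
rewrite ler_wpM2r ?exprn_ge0// -natrX ler_nat.
(* The weight of a product depends only on how often each of the N monomials occurs, and every
   multiplicity is at most m: hence at most (m+1)^N weights. *)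
pose g (v : {ffun 'I_N -> 'I_m.+1}) : R := \sum_j sg j * (v j)%:R.
have -> : (m.+1 ^ N)%N = size [seq g v | v : {ffun 'I_N -> 'I_m.+1}].
  by rewrite size_map -cardE card_ffun !card_ord.
apply: uniq_leq_size; first exact: undup_uniq.
move=> s; rewrite mem_undup => /mapP[f _ ->].
have cf j : (#|[pred i | f i == j]| < m.+1)%N.
  by rewrite ltnS -[X in (_ <= X)%N](card_ord m) max_card.
apply/mapP; exists [ffun j => Ordinal (cf j)]; first by rewrite mem_enum.
rewrite /g /W' (partition_big f predT)//=; apply: eq_bigr => j _; rewrite ffunE /=.
rewrite (eq_bigr (fun=> sg j)) => [|i /eqP ->//].
by rewrite sumr_const -[LHS]mulr_natr; congr (_ * _%:R); exact: eq_card.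
Qed.

End Separation.

(** * The extremal function *)

Section Envelope.
Variables (R : realType) (n : nat).
Local Notation C := (R[i]).
Local Notation V := (Cn R n).
Local Notation env := (nat -> R[i]).
Local Notation mu := (@lebesgue_measure R).
Implicit Types (lam : 'I_n -> R) (z w p : V) (K : set V) (u : V -> R).

Lemma ofEnv_lin (y y' : env) (t : C) :
  ofEnv n (fun k => y k + t * y' k) = ofEnv n y + (t : CC R) *: ofEnv n y'.
Proof. by apply/rowP => k; rewrite !mxE. Qed.

Lemma usc_env_of u : usc u -> usc_env n (fun y => u (ofEnv n y)).
Proof.
move=> uu y c /uu /nbhs_Cn [d d0 h]; exists d => // y' hy; apply: h => k.
by rewrite !mxE; exact: hy.
Qed.

Lemma subm_env_of u : psh u -> subm_env (fun y => u (ofEnv n y)).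
Proof.
move=> [_ su] y y'; have := su (ofEnv n y) (ofEnv n y').
set J := (X in (_ * X)%E) => h.
have <- : J = (\int[mu]_(th in [set` `[0%R, (2 * pi)%R]%R]) (u (ofEnv n (fun k => (y k + cis th * y' k)%R)))%:E)%E.
  by apply: eq_integral => th _; rewrite ofEnv_lin.
have := lee_wpmul2l (_ : (0 <= (2 * pi)%:E)%E) h; rewrite lee_fin (ltW (@pi2_gt0 R)) => /(_ isT).
by rewrite muleA -!EFinM divff ?mul1e// gt_eqF// pi2_gt0.
Qed.

Lemma H_lam_at0 lam u : H_lam lam u -> u 0 = 0.
Proof.
move=> [_ _ _ hom]; have := hom 0 1; rewrite (_ : PhiX lam 0 1 = 0); last first.
  by apply/rowP => k; rewrite !mxE mul0r.
move=> /eqP; rewrite -subr_eq0 -[X in X - _]mul1r -mulrBl mulf_eq0 => /orP[|/eqP//].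
rewrite subr_eq0 eq_sym -[X in _ == X]expR0 (inj_eq (@expR_inj R)) oppr_eq0 /=.
by rewrite oner_eq0.
Qed.

(** By semicontinuity u < 1 near 0. Within time t the flow contracts a whole polydisc into that
    neighbourhood, and homogeneity returns the bound e^t. *)
Lemma bdd_env_of lam u : (forall k, 0 < lam k) -> H_lam lam u ->
  bdd_env n (fun y => u (ofEnv n y)).
Proof.
move=> l0 Hu M; have [[uu _] u0 _ hom] := Hu.
have := uu 0 1; rewrite (H_lam_at0 Hu) => /(_ ltr01) /nbhs_Cn[d d0 h].
pose t := \sum_k `|M| / (d * lam k).
have t0 : 0 <= t by apply: sumr_ge0 => k _; rewrite divr_ge0// mulr_ge0// ltW.
exists (expR t) => y hy.
have := hom (ofEnv n y) (t%:C)%C => /= E.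
have : u (PhiX lam (ofEnv n y) (t%:C)%C) < 1.
  apply: h => k; rewrite !mxE subr0 cmodM cmod_cexp.
  have -> : complex.Re (- ((lam k)%:C * t%:C))%C = - (lam k * t) by rewrite /=; ring.
  rewrite expRN ltr_pdivrMr ?expR_gt0//.
  apply: le_lt_trans (hy k (ltn_ord k)) _; apply: le_lt_trans (ler_norm M) _.
  have : `|M| <= d * (lam k * t).
    have : `|M| / (d * lam k) <= t.
      by rewrite /t (bigD1 k)//= lerDl sumr_ge0// => j _; rewrite divr_ge0// mulr_ge0// ltW.
    by rewrite ler_pdivrMr ?mulr_gt0// mulrC mulrA.
  have : d * (1 + lam k * t) <= d * expR (lam k * t) by rewrite ler_pM2l// expR_ge1Dx.
  by rewrite mulrDr mulr1; move: d0; lra.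
rewrite E expRN mulrC ltr_pdivrMr ?expR_gt0// mul1r => lt.
by apply/ltW; exact: lt.
Qed.

(** Compactness of [K] with 0 gives a uniform neighbourhood where u < c, for c halfway between 1 and
    u(p). The imaginary flow preserves u and the modulus of each coordinate, so the same radius
    works around all the orbits. *)
Lemma not_in_hull lam K u p : (forall k, 0 < lam k) -> compact K -> H_lam lam u ->
  (forall z, K z -> u z <= 1) -> 1 < u p ->
  ~ hull [set y : env | exists z th, (K z \/ z = 0) /\ y = toEnv (PhiX lam z (0 +i* th)%C)] (toEnv p).
Proof.
move=> l0 cK Hu uK up hp; have [pshu u0 _ hom] := Hu.
have cK0 : compact (K `|` [set 0 : V]) by apply: compactU => //; exact: compact_set1.
have [B B0 hB] := compact_bounded_coord cK0.
pose c := (1 + u p) / 2.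
have [|z Kz|d [d0 hd]] := @compact_uniform R n (K `|` [set 0 : V])
  (fun d z => forall w, (forall k, cmod (w ord0 k - z ord0 k : C) < d) -> u w < c) cK0.
- by move=> d d' z dd' h w hw; apply: h => k; exact: lt_le_trans dd'.
- have uz : u z < c.
    apply: (@le_lt_trans _ _ 1); last by rewrite /c; lra.
    by case: Kz => [/uK//|->]; rewrite (H_lam_at0 Hu).
  have [d d0 h] := (nbhs_Cn _ _).1 (pshu.1 z c uz).
  exists (d / 2); split => [|w hw v hv]; first by lra.
  apply: h => k; have -> : v ord0 k - z ord0 k = (v ord0 k - w ord0 k) + (w ord0 k - z ord0 k) :> C by ring.
  by apply: le_lt_trans (cmodD _ _) _; have := hw k; have := hv k; lra.
have mod1 (x th : R) : cmod (cexp (- (x%:C * (0 +i* th)))%C : C) = 1.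
  by rewrite cmod_cexp /= mulr0 mul0r subrr oppr0 expR0.
have : u (ofEnv n (toEnv p)) <= c.
  apply: (@max_principle R n (fun y => u (ofEnv n y)) _ (toEnv p) c d _ _ _ _ _ _ hp d0) => //.
  - exact: usc_env_of pshu.1.
  - exact: bdd_env_of Hu.
  - exact: subm_env_of.
  - apply: pol_bounded_coord => i; exists B => y [z [th [Kz ->]]].
    rewrite /toEnv; case: insubP => [k _ _|_]; last by rewrite cmod0 ltW.
    by rewrite mxE cmodM mod1 mulr1; apply: hB.
  - by move=> y [z [th [_ ->]]] i ni; rewrite /toEnv insubN// -leqNgt.
  move=> y w [z [th [Kz ->]]] hw; apply/ltW.
  pose w' := PhiX lam (ofEnv n w) (0 +i* (- th))%C.
  have -> : u (ofEnv n w) = u w' by rewrite /w' hom /= oppr0 expR0 mul1r.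
  apply: (hd z Kz) => k; rewrite /w' !mxE.
  have := hw k (ltn_ord k); rewrite toEnvE mxE.
  apply: le_lt_trans.
  have E : cexp (- ((lam k)%:C * (0 +i* th)))%C * cexp (- ((lam k)%:C * (0 +i* (- th))))%C = 1 :> C.
    rewrite -cexpD (_ : _ + _ = 0 :> C) ?cexp0//.
    by apply/eqP; rewrite eq_complex /=; apply/andP; split; apply/eqP; ring.
  have -> : w k * cexp (- ((lam k)%:C * (0 +i* (- th))))%C - z ord0 k =
    (w k - z ord0 k * cexp (- ((lam k)%:C * (0 +i* th)))%C) * cexp (- ((lam k)%:C * (0 +i* (- th))))%C :> C.
    by rewrite mulrBl -mulrA E mulr1.
  by rewrite cmodM mod1 mulr1.
by rewrite toEnvK /c; lra.
Qed.

(** The real flow takes [z0] to p with u(p) = u(z0) / c' > 1. Flowing back multiplies a polynomial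
    of weight sigma by c'^sigma, so that modulus above 1 at p becomes modulus above c'^sigma at
    [z0]. *)
Lemma separate_root lam K u z0 (c' : R) : (forall k, 0 < lam k) -> compact K -> H_lam lam u ->
  (forall z, K z -> u z <= 1) -> 0 < c' -> c' < u z0 ->
  exists sigma q, [/\ 0 < sigma, weight_semigroup lam sigma, quasi_hom lam sigma 0 q,
    (forall z, K z -> cmod (q z) <= 1) & c' <= cmod (q z0) `^ sigma^-1].
Proof.
move=> l0 cK Hu uK c0 cu; pose p := PhiX lam z0 ((ln c')%:C)%C.
have [_ _ _ hom] := Hu.
have up : 1 < u p by rewrite /p hom /= expRN lnK ?posrE// mulrC ltr_pdivlMr// mul1r.
have [e [pe [B [hB Bp]]]] : exists e, pol e /\ exists B : R, (forall z th, (K `|` [set 0 : V]) z ->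
    cmod (e (toEnv (PhiX lam z (0 +i* th)%C))) <= B) /\ B < cmod (e (toEnv p)).
  apply: contrapT => H; apply: (not_in_hull l0 cK Hu uK up) => e pe B hB.
  rewrite leNgt; apply/negP => lt; apply: H; exists e; split => //; exists B; split => //.
  by move=> z th Kz; apply: hB; exists z, th.
have [|s [q [b [mq qb b0 bp]]]] := @separate_component R n lam (K `|` [set 0 : V]) p e B pe _ hB Bp.
  by right.
have [N [cc [a [cw qE]]]] := mq.
have [j cj] : exists j, cc j != 0.
  apply: contrapT => H; move: bp; rewrite qE big1 ?cmod0 ?ltNge ?b0// => j _.
  have [->|cj] := eqVneq (cc j) 0; first by rewrite mul0r.
  by exfalso; apply: H; exists j.
have sE := cw j cj.
have s0 : 0 < s.
  rewrite lt_def -sE wt_ge0// andbT sE; apply/eqP => s0; move: mq; rewrite s0 => /monomials0 q0.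
  have := qb 0 (or_intror erefl); rewrite -(q0 p l0) leNgt bp//.
(* The midpoint is used to normalise because b itself may be 0. *)
pose b' := (b + cmod (q p)) / 2.
have b'0 : 0 < b' by rewrite /b'; lra.
pose r : C := ((b'^-1)%:C)%C.
have cr : cmod r = b'^-1 by rewrite cmod_real ger0_norm// invr_ge0 ltW.
have mq' := monomials_scale r mq.
exists s, (fun z => r * q z); split => //.
- by exists (a j); rewrite -sE.
- exact: monomials_quasi_hom.
- move=> z Kz; rewrite cmodM cr mulrC ler_pdivrMr// mul1r.
  by apply: le_trans (qb z (or_introl Kz)) _; rewrite /b'; lra.
have : 1 < cmod (r * q p) by rewrite cmodM cr mulrC ltr_pdivlMr// mul1r /b'; lra.
have -> : cmod (r * q p) = expR (complex.Re (- (s%:C * (ln c')%:C))%C) * cmod (r * q z0).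
  by rewrite -cmod_cexp -cmodM; congr (cmod _); exact: (monomials_flow mq').
move=> h.
have {}h : c' `^ s <= cmod (r * q z0).
  move: h; have -> : complex.Re (- (s%:C * (ln c')%:C))%C = - (ln c' * s) by rewrite /=; ring.
  rewrite expRN expRM lnK ?posrE// mulrC ltr_pdivlMr ?powR_gt0// mul1r.
  exact: ltW.
have : (c' `^ s) `^ s^-1 <= cmod (r * q z0) `^ s^-1.
  by apply: powR_le => //; rewrite ?powR_ge0// invr_ge0 ltW.
by rewrite -powRrM divff ?gt_eqF// powRr1// ltW.
Qed.

End Envelope.

Theorem mainTheorem11 (R : realType) (n : nat) (lam : 'I_n -> R)
    (rho : nat -> R) :
  (0 < n)%N ->
  (forall i : 'I_n, nat_of_ord i = 0%N -> lam i = 1) ->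
  (forall i : 'I_n, 0 < lam i) ->
  (forall m : nat, rho m < rho m.+1) ->
  (forall r : R, (exists m : nat, rho m = r) <-> weight_semigroup lam r) ->
  forall (K : set (Cn R n)), compact K ->
  forall z : Cn R n,
    Psi lam K z =
    ereal_sup [set ((cmod (mq.2 z)) `^ (rho mq.1)^-1)%:E
               | mq in [set mq : nat * (Cn R n -> CC R) |
                          [/\ (1 <= mq.1)%N,
                              quasi_hom lam (rho mq.1) 0 mq.2 &
                              (forall w, K w -> cmod (mq.2 w) <= 1)]]].
Proof.
move=> n0 lam1 l0 rhoS rhoW K cK z.
have rho_lt m m' : (m < m')%N -> rho m < rho m'.
  elim: m' => // m' IH; rewrite ltnS leq_eqVlt => /orP[/eqP ->//|/IH h].
  exact: lt_trans h (rhoS m').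
have rho_ge0 m : 0 <= rho m.
  have /rhoW[a ->] : exists m', rho m' = rho m by exists m.
  rewrite -[leRHS]/(wt lam a); exact: wt_ge0.
have rho_gt0 m : (0 < m)%N -> 0 < rho m.
  by move=> m0; apply: le_lt_trans (rho_ge0 0%N) (rho_lt _ _ m0).
have rho0 : rho 0%N = 0.
  have /rhoW[m hm] : weight_semigroup lam 0.
    by exists (fun=> 0%N); rewrite big1// => k _; rewrite mulr0.
  by case: m hm => // m hm; have := rho_gt0 m.+1 isT; rewrite hm ltxx.
apply/eqP; rewrite eq_le; apply/andP; split.
  set S := ereal_sup _.
  (* Witnessed by the zero polynomial with m = 1; it settles the case u(z) <= e, in which there is
     no positive level to separate. *)
  have S0 : (0 <= S)%E.
    apply: le_ereal_sup_tmp; exists (((cmod (0 : CC R)) `^ (rho 1%N)^-1)%:E); last by rewrite lee_fin powR_ge0.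
    exists (1%N, fun=> 0) => //; split => //=; last by move=> w _; rewrite cmod0.
    split; last by move=> t w _; rewrite mulr0.
    by exists 0%N, (fun=> 0), (fun _ _ => 0%N), (fun _ _ => 0%N) => w; rewrite big_ord0.
  apply: ge_ereal_sup => _ [u [Hu uK] <-]; apply/lee_subgt0Pr => e e0.
  have [ue|eu] := leP (u z) e.
    by apply: le_trans S0; rewrite -EFinB lee_fin subr_le0.
  have c0 : 0 < u z - e by rewrite subr_gt0.
  have cu : u z - e < u z by rewrite ltrBlDr ltrDl.
  have [s [q [s0 /rhoW[m ms] qh qK qz]]] := separate_root l0 cK Hu uK c0 cu.
  apply: le_ereal_sup_tmp; exists ((cmod (q z)) `^ (rho m)^-1)%:E; last first.
    by rewrite -EFinB lee_fin ms.
  exists (m, q) => //; split => //=; last by rewrite ms.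
  by case: m ms => // ms; move: s0; rewrite -ms rho0 ltxx.
apply: ge_ereal_sup => _ [[m q] /= [m0 qh qK] <-].
have mq := quasi_hom_monomials l0 qh; have r0 := rho_gt0 m m0.
have ir0 : 0 <= (rho m)^-1 by rewrite invr_ge0 ltW.
have [qz|qz] := eqVneq (q z) 0; last first.
  apply: ereal_sup_ubound; exists (fun w => cmod (q w) `^ (rho m)^-1) => //.
  split; first exact: (H_lam_root r0 mq qz).
  move=> w /qK h; have -> : 1 = 1 `^ (rho m)^-1 :> R by rewrite powR1.
  by apply: powR_le => //; exact: cmod_ge0.
(* Here q may vanish identically, and its root is then constant and outside [H_lam]. Only 0 <= Psi
   is wanted, and a multiple of the first coordinate, of weight 1 and bounded by 1 on [K], provides
   it. *)
rewrite qz cmod0 powR0 ?invr_eq0 ?gt_eqF//.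
pose i0 := Ordinal n0; have [B B0 hB] := compact_bounded_coord cK.
pose b : R[i] := ((B^-1)%:C)%C.
pose f : Cn R n -> R[i] := fun w => b * w ord0 i0.
have mf : monomials f lam 1.
  exists 1%N, (fun=> b), (fun _ k => nat_of_bool (k == i0)); split.
    move=> _ _; rewrite /wt (bigD1 i0)//= ?eqxx mulr1 lam1// big1 ?addr0// => k /negbTE ->.
    by rewrite mulr0.
  move=> w; rewrite big_ord1 (bigD1 i0)//= ?eqxx expr1 big1 ?mulr1// => k /negbTE ->.
  by rewrite expr0.
have f0 : f (const_mx 1) != 0.
  by rewrite /f mxE mulr1 -cmod_gt0 cmod_real normr_gt0 invr_eq0 gt_eqF.
have Hf := H_lam_root ltr01 mf f0.
apply: le_ereal_sup_tmp; exists (cmod (f z) `^ 1^-1)%:E; last by rewrite lee_fin powR_ge0.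
exists (fun w => cmod (f w) `^ 1^-1) => //; split => // w Kw.
rewrite invr1 powRr1 ?cmod_ge0// /f cmodM cmod_real ger0_norm ?invr_ge0 ?(ltW B0)//.
by rewrite mulrC ler_pdivrMr// mul1r hB.
Qed.
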